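(* Let $\Delta$ be a simplicial homology sphere of dimension $n-1$ over the field $\mathbb F_2$, with vertices $v_1,\ldots,v_N$. Let $K_0=\mathbb Q(a_{i,j})_{1\le i\le n,\,1\le j\le N}$, let $H(\Delta)$ be the generic cohomology ring of $\Delta$ defined over $K_0$, and let $l=x_1+\cdots+x_N\in H^1(\Delta)$. Then for every integer $m$ with $0\le m\le n/2$ the quadratic form \[ Q_l: H^m(\Delta)\to H^n(\Delta)\simeq K_0,\qquad Q_l(g)=l^{\,n-2m}g^2, \] is anisotropic; that is, if $g\in H^m(\Delta)$ and $l^{\,n-2m}g^2=0$ in $H^n(\Delta)$, then $g=0$.
   Context: A pure (finite, abstract) simplicial complex $\Delta$ of dimension $n-1$ is a homology sphere over a coefficient ring $R$ if for every simplex $\tau\in\Delta$, including the empty simplex (of dimension $-1$), the reduced simplicial homology of the link satisfies $\tilde H_i(\operatorname{Link}\tau;R)=R$ if $i=n-2-\dim\tau$ and $0$ otherwise. For a simplicial complex $\Delta$ of dimension $n-1$ with vertices $v_1,\ldots,v_N$, and $K_0=\mathbb Q(a_{i,j})$ the field of rational functions in indeterminates $a_{i,j}$, $1\le i\le n$, $1\le j\le N$, the Stanley-Reisner ring is $\mathcal A(\Delta)=K_0[x_1,\ldots,x_N]/I_\Delta$, where $I_\Delta$ is generated by the square-free monomials $\prod_{i\in S}x_i$ such that $\{v_i\}_{i\in S}$ is not a simplex of $\Delta$. The (generic) cohomology ring is the graded ring $H(\Delta)=\mathcal A(\Delta)/(\theta_1,\ldots,\theta_n)$, where $\theta_i=a_{i,1}x_1+\cdots+a_{i,N}x_N$.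 A homology sphere over $\mathbb F_2$ is also one over $\mathbb Q$, and $H^n(\Delta)\simeq K_0$ (one-dimensional); anisotropy does not depend on the choice of this isomorphism. *)

(* Defs.v *)
From HB Require Import structures.
From mathcomp Require Import all_boot all_order all_algebra.
From mathcomp Require Import generic_quotient ring_quotient fraction.
From mathcomp Require Import boolp.
From mathcomp.multinomials Require Import mpoly.

Set Implicit Arguments.
Unset Strict Implicit.
Unset Printing Implicit Defensive.

Import GRing.Theory.
Local Open Scope ring_scope.
Local Open Scope quotient_scope.

(* The vertices v_1, ..., v_N are the elements of 'I_N, and each of them is
   required to be a vertex of the complex. *)
Record simplicial_complex (N : nat) := SimplicialComplex {
  simplices :> {set {set 'I_N}};
  empty_simplex : set0 \in simplices;
  vertex_simplex : forall i, [set i] \in simplices;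
  face_simplex : forall s t : {set 'I_N},
    s \subset t -> t \in simplices -> s \in simplices
}.

Section Homology.
Variables (N : nat) (R : comNzRingType).

(* Simplices are counted by cardinality: those with k elements have dimension
   k - 1, so that k = 0 is the degree -1 of reduced homology. *)
Section Chains.
Variable G : {set {set 'I_N}}.

Definition simplex (k : nat) : Type :=
  {s : {set 'I_N} | (s \in G) && (#|s| == k)}.
HB.instance Definition _ k := Finite.on (simplex k).

Definition chain (k : nat) : Type := {ffun simplex k -> R^o}.
HB.instance Definition _ k := GRing.Lmodule.on (chain k).

(* The coefficient of t in the alternating boundary of s. *)
Definition incidence (s t : {set 'I_N}) : R :=
  \sum_(v in s | s :\ v == t) (-1) ^+ #|[set u in s | (u < v)%N]|.

Definition boundary k (c : chain k.+1) : chain k :=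
  [ffun t => \sum_s c s * incidence (val s) (val t)].

Lemma boundary_is_linear k : linear (@boundary k).
Proof.
move=> a c d; apply/ffunP=> t; rewrite !ffunE scaler_sumr -big_split /=.
by apply: eq_bigr => s _; rewrite !ffunE mulrDl /GRing.scale /= mulrA.
Qed.
HB.instance Definition _ k :=
  GRing.isLinear.Build R (chain k.+1) (chain k) _ (@boundary k)
    (@boundary_is_linear k).

Definition is_cycle k : {pred chain k} :=
  match k with
  | 0 => predT
  | k'.+1 => fun c => boundary c == 0
  end.

Lemma is_cycle_submod k : submod_closed (@is_cycle k).
Proof.
case: k => [|k]; split=> //; first by apply/eqP/linear0.
move=> a c d /eqP bc /eqP bd; apply/eqP.
by rewrite (boundary_is_linear a c d) bc bd scaler0 addr0.
Qed.
HB.instance Definition _ k :=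
  GRing.isSubmodClosed.Build R (chain k) (@is_cycle k) (@is_cycle_submod k).

Record cycles k := Cycles {
  cycles_chain :> chain k;
  _ : cycles_chain \in @is_cycle k
}.
HB.instance Definition _ k := [isSub for @cycles_chain k].
HB.instance Definition _ k := [Choice of cycles k by <:].
HB.instance Definition _ k := [SubChoice_isSubLmodule of cycles k by <:].

Definition is_boundary k : {pred cycles k} :=
  fun z => `[< exists c : chain k.+1, boundary c = z >].

Lemma is_boundary_submod k : submod_closed (@is_boundary k).
Proof.
split=> [|a y z]; first by apply/asboolP; exists 0; rewrite linear0.
move=> /asboolP[c cy] /asboolP[d dz]; apply/asboolP; exists (a *: c + d).
by rewrite (boundary_is_linear a c d) cy dz.
Qed.
HB.instance Definition _ k :=
  GRing.isSubmodClosed.Build R (cycles k) (@is_boundary k)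
    (@is_boundary_submod k).

(* The reduced homology module in degree k - 1. *)
Definition homology k : Type := Quotient.quot (@is_boundary k).
HB.instance Definition _ k := GRing.Zmodule.on (homology k).
HB.instance Definition _ k := EqQuotient.on (homology k).

Definition homology_scale k (a : R) : homology k -> homology k :=
  lift_op1 (homology k) ( *:%R a).

Lemma pi_scale k a :
  {morph \pi_(homology k) : z / a *: z >-> homology_scale a z}.
Proof.
move=> z; unlock homology_scale; apply/eqP; rewrite eqmodE /= Quotient.equivE.
by rewrite -scalerBr rpredZ // Quotient.idealrBE reprK.
Qed.

Lemma pi_homologyD k : {morph \pi_(homology k) : y z / y + z}.
Proof. exact: (raddfD (\pi_(homology k))). Qed.

Lemma homology_scalerA k a b (h : homology k) :
  homology_scale a (homology_scale b h) = homology_scale (a * b) h.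
Proof. by elim/quotW: h => z; rewrite -!pi_scale scalerA. Qed.

Lemma homology_scale1r k : left_id 1 (@homology_scale k).
Proof. by elim/quotW=> z; rewrite -pi_scale scale1r. Qed.

Lemma homology_scalerDr k : right_distributive (@homology_scale k) +%R.
Proof.
move=> a; elim/quotW=> y; elim/quotW=> z.
by rewrite -pi_homologyD -!pi_scale scalerDr pi_homologyD.
Qed.

Lemma homology_scalerDl k (h : homology k) :
  {morph (@homology_scale k)^~ h : a b / a + b}.
Proof.
by elim/quotW: h => z a b; rewrite -!pi_scale scalerDl pi_homologyD.
Qed.

HB.instance Definition _ k := GRing.Zmodule_isLmodule.Build R (homology k)
  (@homology_scalerA k) (@homology_scale1r k) (@homology_scalerDr k)
  (@homology_scalerDl k).

End Chains.

Definition link (D : {set {set 'I_N}}) (t : {set 'I_N}) : {set {set 'I_N}} :=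
  [set s : {set 'I_N} | [disjoint s & t] & s :|: t \in D].

(* Every facet has dimension n - 1. *)
Definition pure (n : nat) (D : simplicial_complex N) : Prop :=
  forall s, maxset (fun t => t \in simplices D) s -> #|s| = n.

(* With i = k - 1 and dim t = #|t| - 1, the condition i = n - 2 - dim t reads
   k + #|t| = n. *)
Definition homology_sphere (n : nat) (D : simplicial_complex N) : Prop :=
  pure n D /\
  forall t, t \in simplices D -> forall k,
    if (k + #|t| == n)%N
    then exists f : {linear homology (link D t) k -> R^o}, bijective f
    else forall h : homology (link D t) k, h = 0.

End Homology.

Arguments homology_sphere {N} R n D.

Definition generated_ideal (A : comNzRingType) (I : finType) (P : pred I)
    (g : I -> A) : {pred A} :=
  fun x => `[< exists c : I -> A, x = \sum_(i | P i) c i * g i >].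

Lemma generated_ideal_closed (A : comNzRingType) (I : finType) (P : pred I)
    (g : I -> A) :
  1 \notin generated_ideal P g -> idealr_closed (generated_ideal P g).
Proof.
move=> g1; split=> // [|a x y].
  by apply/asboolP; exists (fun=> 0); rewrite big1 // => i _; rewrite mul0r.
move=> /asboolP[c ->] /asboolP[d ->]; apply/asboolP.
exists (fun i => a * c i + d i); rewrite mulr_sumr -big_split /=.
by apply: eq_bigr => i _; rewrite mulrDl mulrA.
Qed.

Section GenericCohomology.
Variables (n N : nat).

Definition K0 : fieldType := {fraction {mpoly rat[n * N]}}.

Definition a_ (i : 'I_n) (j : 'I_N) : K0 :=
  tofrac ('X_(mxvec_index i j) : {mpoly rat[n * N]}).

Variable D : simplicial_complex N.

Definition SR_ideal : {pred {mpoly K0[N]}} :=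
  generated_ideal (fun S : {set 'I_N} => S \notin simplices D)
    (fun S => \prod_(i in S) 'X_i).

Lemma SR_ideal_meval0 p : p \in SR_ideal -> p.@[fun=> 0] = 0.
Proof.
move=> /asboolP[c ->]; rewrite rmorph_sum big1 // => S SD.
have [i iS] : exists i, i \in S.
  by apply/set0Pn; apply: contraNneq SD => ->; apply: empty_simplex.
by rewrite (bigD1 i) //= !mevalM mevalXU mul0r mulr0.
Qed.

Lemma SR_ideal_closed : idealr_closed SR_ideal.
Proof.
apply: generated_ideal_closed; apply/negP => /SR_ideal_meval0 /eqP.
by rewrite meval1 oner_eq0.
Qed.
HB.instance Definition _ :=
  isIdealr.Build {mpoly K0[N]} SR_ideal SR_ideal_closed.

Definition SR_ring : Type := {ideal_quot SR_ideal}.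
HB.instance Definition _ := GRing.ComNzRing.on SR_ring.

Definition SR_class (p : {mpoly K0[N]}) : SR_ring :=
  \pi_({ideal_quot SR_ideal}) p.

Definition theta (i : 'I_n) : {mpoly K0[N]} := \sum_j a_ i j *: 'X_j.

Definition theta_ideal : {pred SR_ring} :=
  generated_ideal xpredT (fun i => SR_class (theta i)).

Lemma theta_ideal_closed : idealr_closed theta_ideal.
Proof.
apply: generated_ideal_closed; apply/asboolP => -[c c1].
pose q := \sum_i repr (c i) * theta i.
have : 1 - q \in SR_ideal.
  rewrite Quotient.idealrBE; apply/eqP; rewrite rmorph1 rmorph_sum [LHS]c1.
  by apply: eq_bigr => i _; rewrite rmorphM /= reprK.
move=> /SR_ideal_meval0 /eqP; rewrite mevalB meval1 rmorph_sum.
rewrite big1 ?subr0 ?oner_eq0 //.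
move=> i _; rewrite rmorphM /= [X in _ * X]rmorph_sum big1 ?mulr0 // => j _.
by rewrite /= mevalZ mevalXU mulr0.
Qed.
HB.instance Definition _ :=
  isIdealr.Build SR_ring theta_ideal theta_ideal_closed.

Definition cohomology : Type := {ideal_quot theta_ideal}.
HB.instance Definition _ := GRing.ComNzRing.on cohomology.

Definition cohomology_class (p : {mpoly K0[N]}) : cohomology :=
  \pi_({ideal_quot theta_ideal}) (SR_class p).

(* Both ideals are homogeneous, so H^m is the image of the forms of degree m. *)
Definition in_degree (m : nat) (h : cohomology) : Prop :=
  exists2 p : {mpoly K0[N]}, p \is m.-homog & h = cohomology_class p.

Definition ell : cohomology := \sum_i cohomology_class 'X_i.

End GenericCohomology.

Arguments in_degree {n N D} m h.
Arguments ell n {N} D.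

(* Main.v *)
From HB Require Import structures.
Require Import Defs.
From mathcomp Require Import all_boot all_order all_algebra.
From mathcomp Require Import fingroup perm.
From mathcomp Require Import generic_quotient ring_quotient fraction.
From mathcomp Require Import boolp zify ring.
From mathcomp.multinomials Require Import mpoly.

(** The theorem is proved in characteristic 2 first, for the ring with generic
    coefficients over the field with two elements, and then transferred to the
    rational numbers.

    In characteristic 2, the top degree of the ring is read off by a degree map
    with values in rational functions in new indeterminates t_1, ..., t_n. It is
    the sum over the facets s of the restriction of a polynomial to s, where the
    linear forms theta_i take the values t_i, divided by the product of the
    coordinates and the determinant of the columns of s ([phi]). It kills the
    face ideal, turns theta_i into t_i and vanishes below degree n, so in degree
    n it factors through the quotient by the theta_i. Squares are constants for
    derivations in characteristic 2, and therefore, facet by facet,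
        d/da_{r,k} phi (x_M h^2) = d/dt_r phi (x_k x_M h^2)
    ([da_phi]). Taking one derivative for each r gives
        d_I phi (x_J g^2) = d_t phi (x_I x_J g^2)
    ([dA_phi]), where d_t phi (h^2) = phi (h)^2 for h of degree n ([dT_sqr]). So
    if x_J g^2 has degree zero for all J, then x_L g has degree zero for all L,
    and g = 0 by Poincare duality. For an odd power of l the same argument works
    because d_t phi (x_i x_k h^2) = 0 for distinct i and k ([dT_mixed]); the
    general case follows by halving the exponent of l ([anisotropic_char2]).

    Poincare duality and the regularity of the theta_i come from one diagram
    chase. The Stanley-Reisner ring has a resolution by the coordinate rings of
    the simplices in order of decreasing dimension, which is exact because the
    links have the homology of spheres ([face_exact]); the theta_i are regular
    on its terms, and this gives their regularity on the ring
    ([face_ring_regular]) and the vanishing of the socle below degree n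
    ([face_ring_socle]).

    For the transfer, let g have coefficients in the integral polynomials in the
    a_{i,j}, with l^(n-2m) g^2 = 0. As the theta_i are regular modulo 2, the
    equation can be reduced modulo 2, where it forces g to vanish; so g is twice
    another class, up to a factor that is not divisible by 2, and this class
    satisfies the same equation. Hence g is divisible by all powers of 2, and it
    vanishes because a linear functional with integral values would otherwise
    detect it ([descent]). *)

Set Implicit Arguments.
Unset Strict Implicit.
Unset Printing Implicit Defensive.

Import GRing.Theory.
Local Open Scope ring_scope.

(** * Face ideals and ideals generated by linear forms *)

Section LinearAndFaceIdeals.
Variables (N : nat) (R : comNzRingType).
Local Notation S := {mpoly R[N]}.
Implicit Types (K : {set {set 'I_N}}) (p q : S) (a : nat -> 'I_N -> R).

Definition supp (m : 'X_{1..N}) : {set 'I_N} := [set i | m i != 0%N].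

Lemma mem_supp m i : (i \in supp m) = (m i != 0%N).
Proof. by rewrite inE. Qed.

Lemma suppD m1 m2 : supp (m1 + m2)%MM = supp m1 :|: supp m2.
Proof.
apply/setP=> i; rewrite in_setU !mem_supp mnmDE.
by rewrite addn_eq0 negb_and.
Qed.

Lemma supp0 : supp 0%MM = set0.
Proof. by apply/setP=> i; rewrite mem_supp in_set0 mnm0E. Qed.

Lemma suppU i : supp U_(i)%MM = [set i].
Proof. by apply/setP=> j; rewrite mem_supp in_set1 mnm1E [i == j]eq_sym; case: (j == i). Qed.

Definition mfilter (P : pred 'X_{1..N}) p : S :=
  \sum_(m <- msupp p | P m) p@_m *: 'X_[m].

Lemma mcoeff_mfilter P p m : (mfilter P p)@_m = if P m then p@_m else 0.
Proof.
rewrite /mfilter raddf_sum /=.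
under eq_bigr do rewrite mcoeffZ mcoeffX.
have [mp|mp] := boolP (m \in msupp p).
  rewrite big_mkcond (bigD1_seq m) //= eqxx mulr1 big1 ?addr0 // => m' m'm.
  by rewrite (negPf m'm) mulr0 if_same.
rewrite (memN_msupp_eq0 mp) if_same big_seq_cond big1 // => m' /andP[m'p _].
have [e|_] := eqVneq m' m; last by rewrite mulr0.
by rewrite -e m'p in mp.
Qed.

Lemma mfilter_is_linear P : linear (mfilter P).
Proof.
move=> c p q; apply/mpolyP=> m; rewrite mcoeffD mcoeffZ !mcoeff_mfilter.
by rewrite mcoeffD mcoeffZ; case: ifP; rewrite ?mulr0 ?addr0.
Qed.
HB.instance Definition _ P :=
  GRing.isLinear.Build R S S _ (mfilter P) (mfilter_is_linear P).

Lemma pihomog_mfilter d p : pihomog mdeg d p = mfilter (fun m => mdeg m == d) p.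
Proof. by []. Qed.

Lemma mcoeff_pihomog d p m :
  (pihomog mdeg d p)@_m = if mdeg m == d then p@_m else 0.
Proof. by rewrite pihomog_mfilter mcoeff_mfilter. Qed.

Definition down_closed K :=
  forall s t : {set 'I_N}, s \subset t -> t \in K -> s \in K.

(** A monomial ideal is described by the coefficients that vanish on it. For a
    simplicial complex this is its Stanley-Reisner ideal, and for the faces of
    one simplex the ideal of a coordinate subspace. *)
Definition face_ideal K p := forall m, supp m \in K -> p@_m = 0.

Section FaceIdeal.
Variable K : {set {set 'I_N}}.

Lemma face_ideal0 : face_ideal K 0.
Proof. by move=> m _; rewrite mcoeff0. Qed.

Lemma face_idealD p q : face_ideal K p -> face_ideal K q -> face_ideal K (p + q).
Proof. by move=> hp hq m mK; rewrite mcoeffD hp // hq // addr0. Qed.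

Lemma face_idealN p : face_ideal K p -> face_ideal K (- p).
Proof. by move=> hp m mK; rewrite mcoeffN hp // oppr0. Qed.

Lemma face_ideal_pihomog d p : face_ideal K p -> face_ideal K (pihomog mdeg d p).
Proof. by move=> hp m mK; rewrite mcoeff_pihomog hp // if_same. Qed.

Lemma face_idealMl p q :
  down_closed K -> face_ideal K q -> face_ideal K (p * q).
Proof.
move=> dK hq m mK; apply/eqP; rewrite mcoeff_eq0; apply/negP => /msuppM_le.
case/allpairsP=> -[m1 m2] /= [_ m2q em].
move: m2q; rewrite mcoeff_msupp hq ?eqxx //.
by apply: dK mK; rewrite em suppD subsetUr.
Qed.

Lemma face_idealX m : supp m \notin K -> face_ideal K 'X_[m].
Proof.
by move=> mK m' m'K; rewrite mcoeffX; case: eqP => // e; rewrite e m'K in mK.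
Qed.

Lemma face_idealS K' p :
  K' \subset K -> face_ideal K p -> face_ideal K' p.
Proof. by move=> KK' hp m mK; apply/hp/(subsetP KK'). Qed.

End FaceIdeal.

Definition lform (v : 'I_N -> R) : S := \sum_j v j *: 'X_j.

Lemma mcoeff_lformU v i : (lform v)@_U_(i) = v i.
Proof.
rewrite /lform raddf_sum /= (bigD1 i) //= mcoeffZ mcoeffXU eqxx mulr1.
rewrite big1 ?addr0 // => j ji.
by rewrite mcoeffZ mcoeffXU (negPf ji) mulr0.
Qed.

Lemma lform_homog v : lform v \is 1.-homog.
Proof.
by apply: rpred_sum => j _; apply: rpredZ; rewrite dhomogX /= mdeg1.
Qed.

Lemma mcoeff_lform0 v : (lform v)@_0 = 0.
Proof. by rewrite (dhomog_nemf_coeff (lform_homog v)) //= mdeg0. Qed.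

Lemma pihomogM1 d p l : l \is 1.-homog ->
  pihomog mdeg d (p * l) = if d is e.+1 then pihomog mdeg e p * l else 0.
Proof.
move=> hl; elim/mpolyind: p => [|c m p _ _ IH].
  by rewrite mul0r raddf0; case: d => // d; rewrite raddf0 mul0r.
rewrite mulrDl raddfD /= {}IH -scalerAl linearZ /=.
have hml : 'X_[m] * l \is (mdeg m).+1.-homog.
  by rewrite -addn1; apply: dhomogM => //; rewrite dhomogX.
case: d => [|d].
  by rewrite addr0 (pihomog_ne0 _ hml) // scaler0.
rewrite raddfD /= mulrDl linearZ /= -scalerAl pihomogX.
case: eqP => [<-|/eqP e]; first by rewrite (pihomog_dE hml).
by rewrite (pihomog_ne0 _ hml) ?eqSS // mul0r.
Qed.

(** The linear forms are indexed by natural numbers, so that their number [r]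
    can vary in inductions. *)
Definition mod_ideal a K (r : nat) p :=
  exists q : nat -> S, face_ideal K (p - \sum_(s < r) q s * lform (a s)).

Section ModIdeal.
Variables (a : nat -> 'I_N -> R) (K : {set {set 'I_N}}).
Local Notation J := (mod_ideal a K).

Lemma mod_idealF r p : face_ideal K p -> J r p.
Proof.
move=> hp; exists (fun=> 0); rewrite big1 ?subr0 // => s _.
by rewrite mul0r.
Qed.

Lemma mod_ideal0 r : J r 0.
Proof. exact/mod_idealF/face_ideal0. Qed.

Lemma mod_idealD r p q : J r p -> J r q -> J r (p + q).
Proof.
move=> [u hu] [v hv]; exists (fun s => u s + v s).
under eq_bigr do rewrite mulrDl.
by rewrite big_split /= opprD addrACA; apply: face_idealD.
Qed.

Lemma mod_idealN r p : J r p -> J r (- p).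
Proof.
move=> [u hu]; exists (fun s => - u s).
under eq_bigr do rewrite mulNr.
by rewrite sumrN -opprD; apply: face_idealN.
Qed.

Lemma mod_idealB r p q : J r p -> J r q -> J r (p - q).
Proof. by move=> hp hq; apply/mod_idealD/mod_idealN. Qed.

Lemma mod_ideal_sum r (I : Type) (s : seq I) (P : pred I) (f : I -> S) :
  (forall i, P i -> J r (f i)) -> J r (\sum_(i <- s | P i) f i).
Proof.
move=> hf; elim/big_ind: _ => //; first exact: mod_ideal0.
exact: mod_idealD.
Qed.

Lemma mod_idealMl r p q : down_closed K -> J r q -> J r (p * q).
Proof.
move=> dK [u hu]; exists (fun s => p * u s).
under eq_bigr do rewrite -mulrA.
by rewrite -mulr_sumr -mulrBr; apply: face_idealMl.
Qed.

Lemma mod_idealZ r c p : down_closed K -> J r p -> J r (c *: p).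
Proof. by move=> dK hp; rewrite -mul_mpolyC; apply: mod_idealMl. Qed.

Lemma mod_idealSr r p : J r.+1 p <-> exists y, J r (p - y * lform (a r)).
Proof.
split=> [[q hq]|[y [q hq]]].
  exists (q r), q; move: hq; rewrite big_ord_recr /= opprD => hq.
  by rewrite addrAC -addrA.
exists (fun s => if s == r then y else q s).
rewrite big_ord_recr /= eqxx.
rewrite (eq_bigr (fun s : 'I_r => q s * lform (a s))) => [|s _].
  by rewrite opprD addrA addrAC.
by rewrite ltn_eqF.
Qed.

Lemma mod_ideal_theta r s p : (s < r)%N -> J r (p * lform (a s)).
Proof.
move=> sr; exists (fun i => if i == s then p else 0).
rewrite (bigD1 (Ordinal sr)) //= eqxx big1 ?addr0 ?subrr => [|i si].
  exact: face_ideal0.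
by rewrite ifN ?mul0r //; apply: contraNneq si => e.
Qed.

Lemma mod_ideal_pihomog r d p : J r p -> J r (pihomog mdeg d p).
Proof.
move=> [q /(face_ideal_pihomog d)].
rewrite pihomogB (raddf_sum (pihomog (@mdeg N) d)) /=.
under eq_bigr do rewrite pihomogM1 ?lform_homog //.
case: d => [|d] hq; last by exists (fun s => pihomog mdeg d (q s)).
by rewrite big1 // subr0 in hq; apply: mod_idealF.
Qed.

Lemma mod_ideal_coef0 r p : set0 \in K -> J r p -> p@_0 = 0.
Proof.
move=> K0 [q /(_ 0%MM)]; rewrite supp0 => /(_ K0).
rewrite mcoeffB raddf_sum big1 ?subr0 // => s _ /=.
by rewrite (rmorphM (mcoeff 0%MM)) /= mcoeff_lform0 mulr0.
Qed.

End ModIdeal.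

Lemma mod_idealS a K K' r p :
  K' \subset K -> mod_ideal a K r p -> mod_ideal a K' r p.
Proof. by move=> KK' [q hq]; exists q; apply: face_idealS hq. Qed.

Lemma powerset_down (t : {set 'I_N}) : down_closed (powerset t).
Proof. by move=> s u su; rewrite !inE; apply: subset_trans. Qed.

End LinearAndFaceIdeals.


(** * Generic linear forms on a simplex *)

Section LinearIdeals.
Variables (N : nat) (F : fieldType).
Local Notation S := {mpoly F[N]}.
Implicit Types (p q : S) (t u : {set 'I_N}).

Lemma lformD (v w : 'I_N -> F) :
  lform (fun j => v j + w j) = lform v + lform w.
Proof. by rewrite -big_split /=; apply: eq_bigr => j _; rewrite scalerDl. Qed.

Lemma lformB (v w : 'I_N -> F) :
  lform (fun j => v j - w j) = lform v - lform w.
Proof. by rewrite -sumrB; apply: eq_bigr => j _; rewrite scalerBl. Qed.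

Lemma lform_sum (I : finType) (c : I -> F) (v : I -> 'I_N -> F) :
  lform (fun j => \sum_i c i * v i j) = \sum_i c i *: lform (v i).
Proof.
under [RHS]eq_bigr do rewrite scaler_sumr.
rewrite exchange_big /=; apply: eq_bigr => j _.
by rewrite scaler_suml; apply: eq_bigr => i _; rewrite scalerA.
Qed.

Lemma lform_delta i : lform (fun j => (i == j)%:R) = 'X_i :> S.
Proof.
rewrite /lform (bigD1 i) //= eqxx scale1r big1 ?addr0 // => j.
by rewrite eq_sym => /negPf ->; rewrite scale0r.
Qed.

Lemma eq_lform (v w : 'I_N -> F) : v =1 w -> lform v = lform w.
Proof. by move=> vw; apply: eq_bigr => j _; rewrite vw. Qed.

Lemma face_ideal_lform t (v : 'I_N -> F) :
  {in t, forall j, v j = 0} -> face_ideal (powerset t) (lform v).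
Proof.
move=> v0 m; rewrite inE => mt; rewrite /lform raddf_sum big1 // => j _ /=.
rewrite mcoeffZ mcoeffX; case: eqP => [e|_]; last by rewrite mulr0.
by rewrite v0 ?mul0r //; apply: (subsetP mt); rewrite -e suppU set11.
Qed.

Variables (a : nat -> 'I_N -> F).
Local Notation J t := (mod_ideal a (powerset t)).

Lemma mod_ideal_coef1 K r p : mod_ideal a K r p ->
  exists w : nat -> F, forall j, [set j] \in K ->
    p@_U_(j) = \sum_(s < r) w s * a s j.
Proof.
move=> [q hq]; exists (fun s => (q s)@_0) => j jK.
have := hq U_(j)%MM; rewrite suppU => /(_ jK) /eqP.
rewrite mcoeffB raddf_sum subr_eq0 => /eqP -> /=.
apply: eq_bigr => s _.
transitivity ((pihomog (@mdeg N) 1 (q s * lform (a s)))@_U_(j)).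
  by rewrite mcoeff_pihomog mdeg1 eqxx.
rewrite pihomogM1 ?lform_homog //.
have -> : pihomog (@mdeg N) 0 (q s) = ((q s)@_0)%:MP.
  apply/mpolyP=> m; rewrite mcoeff_pihomog mcoeffC mdeg_eq0.
  by case: eqP => [->|_]; rewrite ?mulr1 ?mulr0.
by rewrite mul_mpolyC mcoeffZ mcoeff_lformU.
Qed.

Section Substitution.
Variables (t : {set 'I_N}) (r : nat).

(* The rows of V are the coordinates of linear forms spanning the ideal, and
   M is a projection along the row space of V. *)
Let V : 'M[F]_(r + N, N) :=
  col_mx (\matrix_(s < r, j < N) a s j) (diag_mx (\row_j (j \notin t)%:R)).
Let M : 'M[F]_N := 1%:M - pinvmx V *m V.
Let subst : S -> S := mmap (@mpolyC N F) (fun i => lform (M i)).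

Let subst_morph : {rmorphism S -> S} := mmap (@mpolyC N F) (fun i => lform (M i)).

Let substD p q : subst (p + q) = subst p + subst q.
Proof. exact: (raddfD subst_morph). Qed.

Let substM p q : subst (p * q) = subst p * subst q.
Proof. exact: (rmorphM subst_morph). Qed.

Let subst_sum (I : Type) (s : seq I) (f : I -> S) :
  subst (\sum_(i <- s) f i) = \sum_(i <- s) subst (f i).
Proof. exact: (raddf_sum subst_morph). Qed.

Let substZ c p : subst (c *: p) = c *: subst p.
Proof. by rewrite /subst mmapZ mul_mpolyC. Qed.

Let VM : V *m M = 0.
Proof. by rewrite mulmxBr mulmx1 mulmxA mulmxKpV ?subrr. Qed.

Let substX i : subst 'X_i = lform (M i).
Proof. by rewrite /subst mmapX mmap1U. Qed.

Let subst_lform v : subst (lform v) = lform (fun j => \sum_i v i * M i j).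
Proof.
rewrite {1}/lform subst_sum.
under eq_bigr do rewrite substZ substX.
by rewrite -lform_sum.
Qed.

Let subst_theta s : (s < r)%N -> subst (lform (a s)) = 0.
Proof.
move=> sr; rewrite subst_lform /lform big1 // => j _.
have /matrixP/(_ (lshift N (Ordinal sr)) j) := VM.
rewrite mxE [RHS]mxE => e; rewrite [X in X *: _](_ : _ = 0) ?scale0r //.
rewrite -[RHS]e; apply: eq_bigr => i _.
by congr (_ * _); rewrite /V col_mxEu mxE.
Qed.

Let substX0 i : i \notin t -> subst 'X_i = 0.
Proof.
move=> it; rewrite substX /lform big1 // => j _.
have /matrixP/(_ (rshift r i) j) := VM.
rewrite mxE [RHS]mxE => e; rewrite [X in X *: _](_ : _ = 0) ?scale0r //.
rewrite -[RHS]e (bigD1 i) //= big1 ?addr0 => [|k ki].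
  have -> : V (rshift r i) i = 1 by rewrite /V col_mxEd !mxE eqxx it.
  by rewrite mul1r.
have -> : V (rshift r i) k = 0.
  by rewrite /V col_mxEd !mxE eq_sym (negPf ki).
by rewrite mul0r.
Qed.

Let subst_face p : face_ideal (powerset t) p -> subst p = 0.
Proof.
move=> hp; rewrite (mpolyE p) subst_sum.
rewrite big_seq big1 // => m; rewrite mcoeff_msupp => pm.
rewrite substZ /subst mmapX /mmap1.
have [i mi it] : exists2 i, m i != 0%N & i \notin t.
  have : ~~ (supp m \subset t).
    by apply: contraNN pm => mt; rewrite hp ?inE.
  by case/subsetPn => i; rewrite mem_supp; exists i.
rewrite (bigD1 i) //= -substX substX0 //.
by rewrite expr0n (negPf mi) mul0r scaler0.
Qed.

Lemma lform_in_span (v : 'rV[F]_N) : (v <= V)%MS -> J t r (lform (v 0)).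
Proof.
move=> /submxP[W ->]; rewrite -[W]hsubmxK mul_row_col.
set W1 := lsubmx W; set W2 := rsubmx W.
rewrite (@eq_lform _ (fun j => \sum_(s < r) W1 0 s * a s j +
    (W2 *m diag_mx (\row_j (j \notin t)%:R)) 0 j)); last first.
  move=> j; rewrite mxE; congr (_ + _); rewrite mxE.
  by apply: eq_bigr => s _; congr (_ * _); rewrite mxE.
rewrite lformD; apply: mod_idealD; last first.
  apply/mod_idealF/face_ideal_lform => j jt.
  rewrite mxE big1 // => i _; rewrite !mxE.
  by case: eqP => [->|_]; rewrite ?jt ?mulr0n mulr0.
rewrite lform_sum; apply: mod_ideal_sum => s _.
by rewrite -mul_mpolyC; apply: mod_ideal_theta.
Qed.

Let congruent q := J t r (q - subst q).

Let congruentM q1 q2 : congruent q1 -> congruent q2 -> congruent (q1 * q2).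
Proof.
have dt := @powerset_down N t.
move=> h1 h2; rewrite /congruent substM.
have -> : q1 * q2 - subst q1 * subst q2 =
    q1 * (q2 - subst q2) + subst q2 * (q1 - subst q1).
  by rewrite !mulrBr [subst q2 * q1]mulrC [subst q2 * _]mulrC addrA subrK.
by apply: mod_idealD; apply: mod_idealMl.
Qed.

Let congruentD q1 q2 : congruent q1 -> congruent q2 -> congruent (q1 + q2).
Proof. by rewrite /congruent substD opprD addrACA; apply: mod_idealD. Qed.

Let congruentC c : congruent c%:MP.
Proof. by rewrite /congruent /subst mmapC subrr; apply: mod_ideal0. Qed.

Let congruentX i : congruent 'X_i.
Proof.
rewrite /congruent substX -lform_delta -lformB.
have -> : lform (fun j => (i == j)%:R - M i j) =
          lform ((row i (pinvmx V *m V)) 0).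
  apply: eq_lform => j; rewrite [RHS]mxE /M mxE [_%:M _ _]mxE.
  by rewrite [in X in _ - (_ + X)]mxE subKr.
by apply: lform_in_span; rewrite (submx_trans (row_sub _ _)) ?submxMl.
Qed.

Let sub_subst p : congruent p.
Proof.
elim/mpolyind: p => [|c m p _ _ IH]; first exact: (congruentC 0).
rewrite -mul_mpolyC; apply: congruentD IH; apply: congruentM (congruentC c) _.
rewrite mpolyXE_id; elim/big_rec: _ => [|i q _ hq]; first exact: (congruentC 1).
apply: congruentM hq; elim: (m i) => [|k IHk]; first exact: (congruentC 1).
by rewrite exprS; apply: congruentM (congruentX i) IHk.
Qed.

(** On a simplex the ideal consists of the polynomials killed by a linear
    substitution, and in particular it is prime. *)
Lemma mod_ideal_subst p : J t r p <-> subst p = 0.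
Proof.
split=> [[q hq]|p0]; last by have := sub_subst p; rewrite /congruent p0 subr0.
rewrite -[p](subrK (\sum_(s < r) q s * lform (a s))) substD.
rewrite (subst_face hq) add0r subst_sum big1 // => s _.
by rewrite substM subst_theta // mulr0.
Qed.

Lemma mod_ideal_prime v p :
  J t r (p * lform v) -> J t r (lform v) \/ J t r p.
Proof.
move=> /mod_ideal_subst; rewrite substM.
by move/eqP; rewrite mulf_eq0 => /orP[]/eqP/mod_ideal_subst; [right|left].
Qed.

End Substitution.

Definition generic_rows n := forall s : {set 'I_N}, (#|s| <= n)%N ->
  \matrix_(i < #|s|, j < #|s|) a i (enum_val j) \in unitmx.

Variables (n : nat) (gen : generic_rows n).

Lemma generic_independent (s : {set 'I_N}) (w : nat -> F) : (#|s| <= n)%N ->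
  {in s, forall j, \sum_(i < #|s|) w i * a i j = 0} ->
  forall i, (i < #|s|)%N -> w i = 0.
Proof.
move=> sn w0 i si; have A := gen sn; set B := \matrix_(_, _) _ in A.
have : (\row_(i < #|s|) w i) *m B = 0.
  apply/rowP=> j; rewrite !mxE -[RHS](w0 _ (enum_valP j)).
  by apply: eq_bigr => k _; rewrite mxE /B mxE.
move/(congr1 (mulmx^~ (invmx B))); rewrite mulmxK // mul0mx.
by move/rowP/(_ (Ordinal si)); rewrite !mxE.
Qed.

Lemma generic_span (s : {set 'I_N}) (v : 'I_N -> F) : (#|s| <= n)%N ->
  exists w : nat -> F, {in s, forall j, \sum_(i < #|s|) w i * a i j = v j}.
Proof.
move=> sn; have A := gen sn; set B := \matrix_(_, _) _ in A.
pose W := (\row_(j < #|s|) v (enum_val j)) *m invmx B.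
exists (fun i => if insub i is Some k then W 0 k else 0) => j js.
have [k0 <-] : exists k : 'I_#|s|, enum_val k = j.
  by exists (enum_rank_in js j); apply: enum_rankK_in.
have := mulmxKV A (\row_(j < #|s|) v (enum_val j)); rewrite -/W.
move/rowP/(_ k0); rewrite [LHS]mxE [RHS]mxE => <-.
by apply: eq_bigr => k _; rewrite valK /B [X in _ = _ * X]mxE.
Qed.

Lemma exists_subset_card (T : finType) (A : {set T}) k : (k <= #|A|)%N ->
  exists2 B : {set T}, B \subset A & #|B| = k.
Proof.
move=> kA; have : (0 < #|[set B : {set T} | B \subset A & #|B| == k]|)%N.
  by rewrite cards_draws bin_gt0.
by case/card_gt0P => B; rewrite inE => /andP[BA /eqP Bk]; exists B.
Qed.

(** The ideal is prime, and it does not contain the form [a r] because the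
    first [r.+1] rows are independent on any [r.+1] columns. *)
Lemma mod_ideal_regular t r p : (r < #|t| <= n)%N ->
  J t r (p * lform (a r)) -> J t r p.
Proof.
case/andP=> rt tn /mod_ideal_prime[]// /mod_ideal_coef1[w hw].
have [u ut ur] := exists_subset_card rt.
have un : (#|u| <= n)%N by rewrite ur (leq_trans rt).
suff : (1 : F) = 0 by move/eqP; rewrite oner_eq0.
have := @generic_independent u (fun s => if s == r then 1 else - w s) un.
rewrite ur => /(_ _ r (ltnSn r)); rewrite eqxx; apply=> j ju.
rewrite big_ord_recr /= eqxx mul1r.
rewrite (eq_bigr (fun s : 'I_r => - (w s * a s j))) => [|s _]; last first.
  by rewrite ltn_eqF // mulNr.
rewrite sumrN -hw ?mcoeff_lformU ?addNr // inE sub1set.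
exact: (subsetP ut).
Qed.

Lemma mod_ideal_full t v : (#|t| <= n)%N -> J t #|t| (lform v).
Proof.
move=> tn; have [w hw] := generic_span v tn.
have -> : lform v = \sum_(s < #|t|) w s *: lform (a s) +
    lform (fun j => v j - \sum_(s < #|t|) w s * a s j).
  by rewrite lformB lform_sum addrC subrK.
apply: mod_idealD; last first.
  by apply/mod_idealF/face_ideal_lform => j jt; rewrite hw ?subrr.
by apply: mod_ideal_sum => s _; rewrite -mul_mpolyC; apply: mod_ideal_theta.
Qed.

Lemma mod_ideal_full_homog t p d : (#|t| <= n)%N ->
  p \is d.+1.-homog -> J t #|t| p.
Proof.
move=> tn /dhomogP hp; rewrite (mpolyE p) big_seq; apply: mod_ideal_sum => m mp.
have /eqP := hp _ mp; have dt := @powerset_down N t.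
rewrite /= => e; apply: mod_idealZ => //.
have [i mi] : exists i, m i != 0%N.
  apply/existsP; rewrite -negb_forall; apply/negP => /forallP m0.
  by move: e; rewrite mdegE big1 // => i _; apply/eqP.
rewrite -(submK (m := U_(i)) (m' := m)) ?lep1mP // mpolyXD -lform_delta.
by apply: mod_idealMl => //; apply: mod_ideal_full.
Qed.

(** Generic forms vanish together on a line that lies in no coordinate
    hyperplane. *)
Lemma mod_ideal_vertex t r v c : #|t| = r.+1 -> (r < n)%N -> v \in t ->
  J t r (c *: 'X_v) -> c = 0.
Proof.
move=> tr rn vt /mod_ideal_coef1[w hw].
have uc : #|t :\ v| = r by move: tr; rewrite (cardsD1 v) vt add1n => -[].
have w0 s : (s < r)%N -> w s = 0.
  rewrite -uc; apply: generic_independent; first by rewrite uc ltnW.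
  move=> j; rewrite uc in_setD1 => /andP[jv jt].
  by rewrite -hw ?inE ?sub1set // mcoeffZ mcoeffXU eq_sym (negPf jv) mulr0.
have := hw v; rewrite inE sub1set mcoeffZ mcoeffXU eqxx mulr1 => -> //.
by rewrite big1 // => s _; rewrite w0 ?mul0r.
Qed.

End LinearIdeals.


(** * Spheres modulo 2 and the complex of their cells *)

(** The combinatorial content of being a homology sphere over the field with
    two elements. The ridge and connectedness conditions come from the top
    homology of the links, exactness from the vanishing of the other groups;
    its coefficients are arbitrary so that it applies to polynomials. *)
Record mod2_sphere (N n : nat) (D : {set {set 'I_N}}) : Prop := Mod2Sphere {
  sphere_down : down_closed D;
  sphere_set0 : set0 \in D;
  sphere_dim : forall t, t \in D -> (#|t| <= n)%N;
  sphere_facet : forall t, t \in D ->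
    exists s : {set 'I_N}, [/\ s \in D, t \subset s & #|s| = n];
  sphere_ridge : forall u : {set 'I_N}, u \in D -> #|u|.+1 = n ->
    #|[set s in D | (u \subset s) && (#|s| == n)]| = 2%N;
  sphere_connected : forall (u : {set 'I_N}) (X : {set {set 'I_N}}),
    (exists2 s, s \in X & [/\ s \in D, u \subset s & #|s| = n]) ->
    (forall s t, s \in X -> t \in D -> #|s| = n -> #|t| = n ->
       u \subset s :&: t -> #|s :&: t|.+1 = n -> t \in X) ->
    forall s, s \in D -> u \subset s -> #|s| = n -> s \in X;
  sphere_exact : forall (V : zmodType), (forall v : V, v + v = 0) ->
    forall (u : {set 'I_N}) k, u \in D -> (k.+1 < n)%N ->
    forall c : {set 'I_N} -> V,
    (forall r : {set 'I_N}, r \in D -> u \subset r -> #|r| = k ->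
       \sum_(t in D | (r \subset t) && (#|t| == k.+1)) c t = 0) ->
    exists d : {set 'I_N} -> V,
      forall t : {set 'I_N}, t \in D -> u \subset t -> #|t| = k.+1 ->
      c t = \sum_(s in D | (t \subset s) && (#|s| == k.+2)) d s
}.

Section Cells.
Variables (N n : nat) (D : {set {set 'I_N}}) (sphD : mod2_sphere n D).

(** The cell [None] stands for the whole complex: it carries the
    Stanley-Reisner ring, sits in level [n.+1] above all facets, and makes the
    inclusion of that ring into the sum over the facets one more boundary. *)
Definition cell (k : nat) (x : option {set 'I_N}) : bool :=
  if x is Some t then (t \in D) && (#|t| == k) else k == n.+1.

Definition carrier (x : option {set 'I_N}) : {set {set 'I_N}} :=
  if x is Some t then powerset t else D.

Definition covers (y x : option {set 'I_N}) : bool :=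
  match y, x with
  | Some u, Some t => u \subset t
  | Some _, None => true
  | None, _ => false
  end.

Lemma carrier_down x : down_closed (carrier x).
Proof.
by case: x => [t|] //=; [apply: powerset_down | apply: sphere_down sphD].
Qed.

Lemma carrier_covers k x y : cell k y -> covers y x -> carrier y \subset carrier x.
Proof.
case: y x => [u|] [t|] //= /andP[uD _] => [ut|_]; apply/subsetP=> s; rewrite !inE.
  by move/subset_trans; apply.
by move=> su; apply: (sphere_down sphD) su uD.
Qed.

Variable F : fieldType.
Local Notation S := {mpoly F[N]}.
Implicit Types (f h : option {set 'I_N} -> S).

Definition bd k f (y : option {set 'I_N}) : S :=
  \sum_(x | cell k.+1 x && covers y x) f x.

Lemma big_cell_option k (P : pred (option {set 'I_N})) f :
  \sum_(x | P x && cell k x) f x =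
    f None *+ (P None && (k == n.+1)) +
    \sum_(t | P (Some t) && ((t \in D) && (#|t| == k))) f (Some t).
Proof.
rewrite big_mkcond (bigD1 None) //=; congr (_ + _).
  by case: ifP.
rewrite [RHS]big_mkcond /=.
rewrite (reindex_omap (Some : {set 'I_N} -> option {set 'I_N}) id) => [|[]] //=.
by apply: eq_bigl => t; rewrite eqxx.
Qed.

Lemma bd_face k f u : (k < n)%N ->
  bd k f (Some u) = \sum_(t in D | (u \subset t) && (#|t| == k.+1)) f (Some t).
Proof.
move=> kn; rewrite /bd; under eq_bigl do rewrite andbC.
rewrite big_cell_option /= eqSS ltn_eqF // add0r.
by apply: eq_bigl => t; rewrite andbCA.
Qed.

Lemma bd_facet f u : bd n f (Some u) = f None.
Proof.
rewrite /bd; under eq_bigl do rewrite andbC.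
rewrite big_cell_option /= eqxx big1 ?addr0 // => t /and3P[_ tD /eqP tn].
by have := sphere_dim sphD tD; rewrite tn ltnn.
Qed.

Lemma bdB k f h y : bd k (fun x => f x - h x) y = bd k f y - bd k h y.
Proof. by rewrite -sumrB. Qed.

Lemma bdM k p f y : bd k (fun x => p * f x) y = p * bd k f y.
Proof. by rewrite mulr_sumr. Qed.

Lemma bdMr k p f y : bd k (fun x => f x * p) y = bd k f y * p.
Proof. by rewrite mulr_suml. Qed.

Lemma bd_homog d k f y :
  (forall x, f x \is d.-homog) -> bd k f y \is d.-homog.
Proof. by move=> hf; apply: rpred_sum => x _. Qed.

(** Boundaries respect the ideals attached to the cells, since the ideal of a
    face contains the ideals of the cells above it. *)
Lemma bd_mod_ideal (a : nat -> 'I_N -> F) r k f y :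
  cell k y -> (forall x, cell k.+1 x -> mod_ideal a (carrier x) r (f x)) ->
  mod_ideal a (carrier y) r (bd k f y).
Proof.
move=> cy hf; apply: mod_ideal_sum => x /andP[cx yx].
by apply: mod_idealS (hf _ cx); apply: carrier_covers cy yx.
Qed.

Hypothesis char2 : 2%N \in [pchar F].

Lemma addpp2 (p : S) : p + p = 0.
Proof. by rewrite -mulr2n -scaler_nat pcharf0 // scale0r. Qed.

Lemma oppp2 (p : S) : - p = p.
Proof. by rewrite -[LHS]addr0 -(addpp2 p) addKr. Qed.

Lemma card_between (u t : {set 'I_N}) k : u \subset t -> #|u| = k -> #|t| = k.+2 ->
  #|[set w : {set 'I_N} | [&& u \subset w, w \subset t & #|w| == k.+1]]| = 2%N.
Proof.
move=> ut uk tk.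
have tu : #|t :\: u| = 2%N by rewrite cardsD (setIidPr ut) uk tk subSn // subSnn.
rewrite -tu -(card_in_imset (f := fun v => v |: u)); last first.
  move=> v w; rewrite !inE => /andP[vu _] _ /setP/(_ v).
  by rewrite !in_setU1 eqxx (negPf vu) !orbF => /esym/eqP.
congr #|pred_of_set _|; apply/setP=> w; rewrite inE; apply/and3P/imsetP.
  case=> uw wt /eqP wk; have /eqP/cards1P[v wu] : #|w :\: u| = 1%N.
    by rewrite cardsD (setIidPr uw) uk wk subSnn.
  exists v; first by have := set11 v; rewrite -wu !inE => /andP[-> /(subsetP wt)].
  rewrite -wu; apply/setP=> x; rewrite !inE.
  case: (boolP (x \in u)) => [/(subsetP uw) ->|_] //=.
  by rewrite orbF.
case=> v; rewrite inE => /andP[vu vt] ->; split.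
- exact: subsetUr.
- by rewrite subUset sub1set vt.
- by rewrite cardsU1 vu uk.
Qed.

Lemma bd_above h x : bd n.+1 h x = 0.
Proof.
rewrite /bd big1 // => -[t|] /andP[]; rewrite /= ?eqn_leq ?ltnn //.
by case/andP=> /(sphere_dim sphD) tn /andP[_]; rewrite ltnNge leqW.
Qed.

(** An interval of length two in the poset of cells has two middle elements:
    below a simplex always, and below the whole complex because a ridge lies in
    two facets. *)
Lemma bd_bd k f y : cell k y -> bd k (bd k.+1 f) y = 0.
Proof.
case: y => [u|] cy; last by rewrite /bd big1 // => x /andP[].
rewrite /bd (exchange_big_dep (cell k.+2)) /=; last by move=> x z _ /andP[].
apply: big1 => z cz; have [uD /eqP uk] := andP cy.
rewrite (eq_bigl (fun x => (covers (Some u) x && covers x z) && cell k.+1 x)); last first.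
  by move=> x; rewrite cz andTb -andbA andbC.
rewrite big_cell_option.
rewrite (_ : _ && _ = false) ?add0r; last first.
  by case: z cz => [t|] //= /eqP ->; rewrite andbF.
have [ut|ut] := boolP (covers (Some u) z); last first.
  rewrite big1 // => t /and3P[/andP[/= h1 h2] _ _].
  case/negP: ut; case: z h2 {cz} => [w|] //=; exact: subset_trans.
rewrite sumr_const.
suff -> : #|fun t : {set 'I_N} => covers (Some u) (Some t) && covers (Some t) z &&
    ((t \in D) && (#|t| == k.+1))| = 2%N by rewrite mulr2n addpp2.
case: z cz ut => [t /andP[tD /eqP tk] ut|/eqP[kn] _] /=; last first.
  rewrite -(sphere_ridge sphD uD); last by rewrite uk -kn.
  rewrite -kn; apply: eq_card => w; rewrite !inE.
  by rewrite -!topredE /= andbT andbCA.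
rewrite -(card_between ut uk tk); apply: eq_card => w; rewrite !inE -!topredE /=.
rewrite -andbA; case: (u \subset w) => //=; case wt: (w \subset t) => //=.
by rewrite (sphere_down sphD wt tD).
Qed.

Lemma mcoeff_face_filter (P : {set 'I_N} -> bool) (g : {set 'I_N} -> S) m :
  (\sum_(s | P s) mfilter (fun m' => supp m' == s) (g s))@_m =
    if P (supp m) then (g (supp m))@_m else 0.
Proof.
rewrite raddf_sum /= big_mkcond (bigD1 (supp m)) //= mcoeff_mfilter eqxx.
rewrite big1 ?addr0 // => s; rewrite mcoeff_mfilter eq_sym => /negPf ->.
by rewrite if_same.
Qed.

(** Exactness before passing to the quotient by linear forms: it splits by
    monomials, and the strand of a monomial with support [u] is the chain
    complex of the link of [u]. *)
Lemma face_exact k f :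
  (forall y, cell k y -> face_ideal (carrier y) (bd k f y)) ->
  exists h, forall x, cell k.+1 x -> face_ideal (carrier x) (f x - bd k.+1 h x).
Proof.
move=> cf; have [nk|nk|kn] := ltngtP k.+1 n; last first.
- (* At the facets: the two coefficients of a cycle across a ridge agree, so
     they are the same on all facets around a given support. *)
  have pick s : exists t : {set 'I_N}, s \in D -> [/\ t \in D, s \subset t & #|t| = n].
    have [sD|sD] := boolP (s \in D); last by exists set0.
    by have [t ht] := sphere_facet sphD sD; exists t.
  have [g hg] := choice pick.
  exists (fun=> \sum_(s in D) mfilter (fun m => supp m == s) (f (Some (g s)))).
  case=> [t /andP[tD /eqP tk] m|/eqP e]; last by have := n_Sn n; rewrite -{1}kn e.
  rewrite [in supp m \in _]/= inE => mt; rewrite kn bd_facet mcoeffB mcoeff_face_filter.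
  have mD : supp m \in D by apply: (sphere_down sphD) mt tD.
  have [gD mg gn] := hg _ mD; rewrite mD.
  pose X := [set s in D | (#|s| == n) && ((f (Some s))@_m == (f (Some (g (supp m))))@_m)].
  suff : t \in X by rewrite inE => /and3P[_ _ /eqP ->]; rewrite subrr.
  apply: (sphere_connected sphD (u := supp m)) => //; last by rewrite tk kn.
    by exists (g (supp m)); rewrite // inE gD gn !eqxx.
  move=> s s'; rewrite inE => /and3P[sD _ /eqP fs] s'D sn s'n mss' ridge.
  rewrite inE s'D s'n eqxx -fs /= -subr_eq0.
  have uD : s :&: s' \in D by apply: (sphere_down sphD) (subsetIl _ _) sD.
  have := cf (Some (s :&: s')); rewrite /= uD -eqSS ridge kn eqxx.
  move=> /(_ isT m); rewrite inE => /(_ mss'); rewrite bd_face -?kn // => /eqP.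
  congr (_ == _).
  have ss' : s != s' by apply/eqP=> e; move: ridge; rewrite e setIid s'n => /esym/n_Sn.
  have e : [set x in D | (s :&: s' \subset x) && (#|x| == n)] = [set s; s'].
    apply/esym/eqP; rewrite eqEcard (sphere_ridge sphD uD) // cards2 ss' leqnn andbT.
    by rewrite subUset !sub1set !inE sD s'D sn s'n subsetIl subsetIr eqxx.
  rewrite kn (eq_bigl (fun x => x \in [set s; s'])) => [|x]; last by rewrite -e inE.
  rewrite big_setU1 ?inE //= big_set1 mcoeffD addrC; congr (_ + _).
  by rewrite -{1}[f (Some s)]oppp2 mcoeffN.
- (* At the whole complex: every support lies in some facet. *)
  exists (fun=> 0); case=> [t /andP[tD /eqP tk]|/eqP[kn]].
    by have := sphere_dim sphD tD; rewrite tk; lia.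
  rewrite /bd big1 // subr0 => m mD.
  have [t [tD mt tn]] := sphere_facet sphD mD.
  have := cf (Some t); rewrite /= tD tn kn eqxx => /(_ isT m).
  by rewrite inE bd_facet; apply.
- (* Below the facets, support by support. *)
  have pick s : exists d : {set 'I_N} -> S, s \in D ->
      forall t : {set 'I_N}, t \in D -> s \subset t -> #|t| = k.+1 ->
      mfilter (fun m => supp m == s) (f (Some t)) =
      \sum_(v in D | (t \subset v) && (#|v| == k.+2)) d v.
    have [sD|sD] := boolP (s \in D); last by exists (fun=> 0).
    pose c t := mfilter (fun m => supp m == s) (f (Some t)).
    have [|d hd] := sphere_exact sphD addpp2 sD nk (c := c); last by exists d.
    move=> r rD sr rk; rewrite /c -raddf_sum /= -bd_face; last exact: ltnW.
    apply/mpolyP=> m; rewrite mcoeff_mfilter mcoeff0; case: eqP => // ms.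
    by apply: (cf (Some r)); rewrite /= ?rD ?rk ?eqxx // inE ms.
  have [d hd] := choice pick.
  pose h (x : option {set 'I_N}) := if x is Some v then
    \sum_(s in D | s \subset v) mfilter (fun m => supp m == s) (d s v) else 0.
  exists h; case=> [t /andP[tD /eqP tk] m|/eqP e]; last by move: nk; rewrite e; lia.
  rewrite inE => mt; have mD : supp m \in D by apply: (sphere_down sphD) mt tD.
  rewrite mcoeffB bd_face // raddf_sum /=.
  have /(congr1 (mcoeff m)) := hd _ mD t tD mt tk.
  rewrite mcoeff_mfilter eqxx raddf_sum /= => ->.
  apply/eqP; rewrite subr_eq0; apply/eqP; apply: eq_bigr => v /and3P[vD tv _].
  by rewrite mcoeff_face_filter mD (subset_trans mt tv).
Qed.

End Cells.


(** * Regularity of the linear forms and the socle *)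

Section Chase.
Variables (N n : nat) (D : {set {set 'I_N}}) (sphD : mod2_sphere n D).
Variables (F : fieldType) (char2 : 2%N \in [pchar F]).
Variables (a : nat -> 'I_N -> F) (gen : generic_rows a n).
Local Notation S := {mpoly F[N]}.
Local Notation th r := (lform (a r)).
Local Notation cell := (cell n D).
Local Notation J x := (mod_ideal a (carrier D x)).
Local Notation bd := (@bd N n D F).
Implicit Types (f g h : option {set 'I_N} -> S) (p : S).

Lemma cell_regular k x r p : cell k x -> (r < k <= n)%N ->
  J x r (p * th r) -> J x r p.
Proof.
case: x => [t|/eqP->]; last by rewrite ltnn andbF.
by case/andP=> _ /eqP <- tr; apply: (mod_ideal_regular gen tr).
Qed.

Lemma mod_ideal_choice k r f :
  (forall x, cell k x -> J x r.+1 (f x)) ->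
  exists g, forall x, cell k x -> J x r (f x - g x * th r).
Proof.
move=> hf.
have pick x : exists y, cell k x -> J x r (f x - y * th r).
  have [cx|cx] := boolP (cell k x); last by exists 0.
  by have /mod_idealSr[y hy] := hf x cx; exists y.
by have [g hg] := choice pick; exists g.
Qed.

(** Exactness survives division by a linear form that is regular on the
    modules involved, at the cost of one level. *)
Lemma quotient_exact r k f : (r < k <= n)%N ->
  (forall y, cell k y -> J y r (bd k f y)) ->
  exists h, forall x, cell k.+1 x -> J x r (f x - bd k.+1 h x).
Proof.
elim: r k f => [|r IH] k f.
  move=> _ hf; have [|h hh] := face_exact sphD char2 (k := k) (f := f).
    by move=> y /hf[q]; rewrite big_ord0 subr0.
  by exists h => x /hh; apply: mod_idealF.
case: k => // k /andP[rk kn] hf.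
have [g hg] := mod_ideal_choice hf.
have [w hw] : exists w, forall y, cell k.+1 y -> J y r (g y - bd k.+1 w y).
  apply: IH => [|z cz]; first by rewrite -ltnS rk ltnW.
  apply: (cell_regular cz); first by rewrite -ltnS rk ltnW.
  have := bd_mod_ideal sphD cz hg.
  rewrite bdB (bd_bd sphD char2 _ cz) sub0r => /mod_idealN.
  by rewrite opprK bdMr.
have [|y cy|v hv] := IH k.+1 (fun x => f x - th r * w x).
- by rewrite kn ltnW.
- rewrite bdB bdM.
  have -> : bd k.+1 f y - th r * bd k.+1 w y =
      (bd k.+1 f y - g y * th r) + th r * (g y - bd k.+1 w y).
    by rewrite mulrBr [th r * g y]mulrC addrA subrK.
  apply: mod_idealD; first exact: hg.
  by apply: mod_idealMl (hw _ cy); apply: (carrier_down sphD).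
exists v => x cx; apply/mod_idealSr; exists (w x).
by rewrite addrAC [w x * _]mulrC; apply: hv.
Qed.

(** Hence the linear forms are a regular sequence on the Stanley-Reisner ring:
    it embeds into the sum over the facets, where they are. *)
Lemma face_ring_regular r p : (r < n)%N ->
  mod_ideal a D r (p * th r) -> mod_ideal a D r p.
Proof.
move=> rn hp; have [|y cy|h hh] := @quotient_exact r n (fun=> p).
- by rewrite rn leqnn.
- case: y cy => [u|/eqP e]; last by have := n_Sn n; rewrite -e.
  move=> cy; rewrite bd_facet //; apply: (cell_regular cy); first by rewrite rn leqnn.
  by apply: mod_idealS hp; apply: (carrier_covers sphD (x := None) cy).
have := hh None; rewrite /= eqxx => /(_ isT).
by rewrite (bd_above sphD) subr0.
Qed.

(** At a cell [t] through [v], the product of ['X_v] with the boundary of [f] is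
    a multiple of the next linear form modulo the ideal. The constant term of
    the factor vanishes at the cells avoiding [v], hence also at [t], as these
    are the other cells around [t :\ v]. So a multiple of ['X_v] lies in the
    ideal of [t], where only its multiple by zero does. *)
Lemma socle_const r f : (r < n)%N -> (forall x, f x \is 0.-homog) ->
  (forall v, exists h, forall x, cell r.+2 x ->
     J x r.+1 ('X_v * f x - bd r.+2 h x)) ->
  forall x, cell r.+1 x -> bd r.+1 f x = 0.
Proof.
move=> rn f0 soc [t|/eqP[e]]; last by rewrite e ltnn in rn.
move=> ct; have [tD /eqP tr] := andP ct.
have [v vt] : exists v, v \in t by apply/set0Pn; rewrite -card_gt0 tr.
have [u hu] := soc v; have [g hg] := mod_ideal_choice hu.
have key x : cell r.+1 x -> J x r ('X_v * bd r.+1 f x - bd r.+1 g x * th r).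
  move=> cx; have := bd_mod_ideal sphD cx hg.
  by rewrite !bdB bdM bdMr (bd_bd sphD char2 _ cx) subr0.
have e0 w : w \in D -> #|w| = r.+1 -> v \notin w -> (bd r.+1 g (Some w))@_0 = 0.
  move=> wD wr vw; have cw : cell r.+1 (Some w) by rewrite /= wD wr eqxx.
  apply: (mod_ideal_coef0 (a := a) (K := powerset w) (r := r)); first by rewrite inE sub0set.
  apply: (cell_regular cw); first by rewrite ltnSn.
  have := key _ cw; rewrite mulrC => h.
  rewrite -[X in J _ _ X]opprK; apply: mod_idealN.
  rewrite -[X in J _ _ X](addKr (bd r.+1 f (Some w) * 'X_v)) addrC.
  apply: mod_idealB => //; apply/mod_idealF.
  apply: face_idealMl; first exact: powerset_down.
  by apply: face_idealX; rewrite suppU inE sub1set.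
have ct' : cell r (Some (t :\ v)).
  rewrite /= (sphere_down sphD (subD1set t v) tD).
  by move: tr; rewrite (cardsD1 v) vt add1n => -[->]; rewrite eqxx.
have e1 : (bd r.+1 g (Some t))@_0 = 0.
  have := congr1 (mcoeff 0%MM) (bd_bd sphD char2 g ct').
  rewrite mcoeff0 bd_face // (bigD1 t) /=; last by rewrite tD subD1set tr eqxx.
  rewrite mcoeffD [X in _ + X]raddf_sum /= big1 ?addr0 // => w /andP[/and3P[wD tw /eqP wr] wt].
  apply: e0 => //; apply: contra wt => vw.
  by rewrite eq_sym eqEcard tr wr leqnn -(setD1K vt) subUset sub1set vw tw.
have := mod_ideal_pihomog 1 (key _ ct).
rewrite pihomogB (pihomogM1 _ _ (lform_homog _)).
have -> : pihomog (@mdeg N) 0 (bd r.+1 g (Some t)) = 0.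
  apply/mpolyP=> m; rewrite mcoeff_pihomog mcoeff0 mdeg_eq0.
  by case: eqP => [->|].
have fc : bd r.+1 f (Some t) = ((bd r.+1 f (Some t))@_0)%:MP.
  apply/mpolyP=> m; rewrite mcoeffC; have [->|m0] := eqVneq m 0%MM; first by rewrite mulr1.
  by rewrite mulr0 (dhomog_nemf_coeff (bd_homog n D r.+1 (Some t) f0)) //= mdeg_eq0.
rewrite mul0r subr0 mulrC pihomog_dE; last first.
  by rewrite -[1%N]add0n; apply: dhomogM; [apply: bd_homog | rewrite dhomogX /= mdeg1].
rewrite fc mul_mpolyC => /(mod_ideal_vertex gen tr rn vt) ->.
by rewrite mpolyC0.
Qed.

(** The connecting maps of the chase are injective and lower both the number
    of linear forms and the degree, so a socle element below the top degree is
    carried down to degree 0, where it has to vanish. *)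
Lemma socle_cell d r f : (d < r <= n)%N -> (forall x, f x \is d.-homog) ->
  (forall v, exists h, forall x, cell r.+1 x ->
     J x r ('X_v * f x - bd r.+1 h x)) ->
  exists h, forall x, cell r.+1 x -> J x r (f x - bd r.+1 h x).
Proof.
elim: d r f => [|d IH] [//|r] f /andP[dr rn] fd soc.
  have [|h hh] := face_exact sphD char2 (k := r.+1) (f := f).
    by move=> y /(socle_const rn fd soc) ->; apply: face_ideal0.
  by exists h => x /hh; apply: mod_idealF.
have [g0 hg0] : exists g, forall x, cell r.+1 x -> J x r (bd r.+1 f x - g x * th r).
  apply: mod_ideal_choice => -[t|/eqP[e]]; last by rewrite e ltnn in rn.
  case/andP=> tD /eqP tr; have tn : (#|t| <= n)%N by rewrite tr.
  rewrite -[X in J _ X]tr; apply: (mod_ideal_full_homog gen tn (d := d)).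
  exact: bd_homog.
pose g x := pihomog (@mdeg N) d (g0 x).
have hg x : cell r.+1 x -> J x r (bd r.+1 f x - g x * th r).
  move=> /hg0/(mod_ideal_pihomog d.+1).
  by rewrite pihomogB (pihomogM1 _ _ (lform_homog _)) pihomog_dE //; apply: bd_homog.
have [w hw] : exists w, forall x, cell r.+1 x -> J x r (g x - bd r.+1 w x).
  apply: IH => [|x|v]; [by rewrite -ltnS dr ltnW | exact: pihomogP | ].
  have [u hu] := soc v; have [w hw] := mod_ideal_choice hu.
  exists w => x cx; apply: (cell_regular cx); first by rewrite ltnSn.
  have := bd_mod_ideal sphD cx hw.
  rewrite !bdB bdM bdMr (bd_bd sphD char2 _ cx) subr0 => h1.
  have h2 : J x r ('X_v * (bd r.+1 f x - g x * th r)).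
    by apply: mod_idealMl (hg _ cx); apply: (carrier_down sphD).
  have -> : ('X_v * g x - bd r.+1 w x) * th r =
     ('X_v * bd r.+1 f x - bd r.+1 w x * th r) - 'X_v * (bd r.+1 f x - g x * th r).
    by ring.
  exact: mod_idealB.
have [||v hv] := @quotient_exact r r.+1 (fun x => f x - th r * w x).
- by rewrite ltnSn.
- move=> y cy; rewrite bdB bdM.
  have -> : bd r.+1 f y - th r * bd r.+1 w y =
      (bd r.+1 f y - g y * th r) + th r * (g y - bd r.+1 w y).
    by rewrite mulrBr [th r * g y]mulrC addrA subrK.
  apply: mod_idealD; first exact: hg.
  by apply: mod_idealMl (hw _ cy); apply: (carrier_down sphD).
exists v => x cx; apply/mod_idealSr; exists (w x).
by rewrite addrAC [w x * _]mulrC; apply: hv.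
Qed.

(** The whole complex is the only cell above the facets, so this is the chase
    that starts with all [n] linear forms. *)
Lemma face_ring_socle d p : (d < n)%N -> p \is d.-homog ->
  (forall v, mod_ideal a D n ('X_v * p)) -> mod_ideal a D n p.
Proof.
move=> dn pd soc; have [|x|v|h hh] := @socle_cell d n (fun=> p).
- by rewrite dn leqnn.
- exact: pd.
- exists (fun=> 0) => -[t /andP[/(sphere_dim sphD) tn /eqP tn1]|_].
    by rewrite tn1 ltnn in tn.
  by rewrite (bd_above sphD) subr0.
have := hh None; rewrite /= eqxx => /(_ isT).
by rewrite (bd_above sphD) subr0.
Qed.

End Chase.


(** * Square-free monomials modulo the linear forms *)

Section Spanning.
Variables (N : nat).
Implicit Types (m : 'X_{1..N}) (s : {set 'I_N}).

Definition mset s : 'X_{1..N} := [multinom (i \in s : nat) | i < N].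

Lemma msetE s i : mset s i = (i \in s) :> nat.
Proof. by rewrite mnmE. Qed.

Lemma supp_mset s : supp (mset s) = s.
Proof. by apply/setP=> i; rewrite mem_supp msetE; case: (i \in s). Qed.

Lemma mdeg_mset s : mdeg (mset s) = #|s|.
Proof.
rewrite mdegE -sum1_card [RHS]big_mkcond; apply: eq_bigr => i _.
by rewrite msetE; case: (i \in s).
Qed.

Lemma mset_setU1 s i : i \notin s -> mset (i |: s) = (U_(i) + mset s)%MM.
Proof.
move=> si; apply/mnmP=> j; rewrite mnmDE mnm1E !msetE in_setU1 eq_sym.
by case: eqP => // <-; rewrite (negPf si).
Qed.

Lemma card_supp_le m : (#|supp m| <= mdeg m)%N.
Proof.
rewrite mdegE -sum1_card big_mkcond; apply: leq_sum => i _.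
by rewrite mem_supp; case: (m i).
Qed.

Lemma squarefree_or m :
  m = mset (supp m) \/ exists2 i, i \in supp m & m = (U_(i) + (m - U_(i)))%MM /\
    supp (m - U_(i)) = supp m.
Proof.
case: (pickP (fun i => 1 < m i)%N) => [i mi|m1]; [right|left].
  have im : i \in supp m by rewrite mem_supp; case: (m i) mi.
  exists i => //; split.
    by rewrite addmC submK // lep1mP; case: (m i) mi.
  apply/setP=> j; rewrite !mem_supp mnmBE mnm1E.
  by case: (eqVneq i j) => [<-|_]; [case: (m i) mi => [|[]]|rewrite subn0].
apply/mnmP=> i; rewrite msetE mem_supp.
by have := m1 i; case: (m i) => [|[]].
Qed.

Lemma mdeg_split m k : (k <= mdeg m)%N ->
  exists m1 m2, [/\ m = (m1 + m2)%MM, mdeg m1 = k & mdeg m2 = (mdeg m - k)%N].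
Proof.
elim: k => [|k IH] km; first by exists 0%MM, m; rewrite add0m mdeg0 subn0.
have [m1 [m2 [e d1 d2]]] := IH (ltnW km).
have [i mi] : exists i, m2 i != 0%N.
  apply/existsP; rewrite -negb_forall; apply/negP => /forallP m0.
  have : mdeg m2 = 0%N by rewrite mdegE big1 // => i _; apply/eqP.
  by rewrite d2 => /eqP; rewrite subn_eq0 leqNgt km.
exists (m1 + U_(i))%MM, (m2 - U_(i))%MM.
have e2 : m2 = (U_(i) + (m2 - U_(i)))%MM by rewrite addmC submK ?lep1mP.
split; first by rewrite -addmA -e2.
  by rewrite mdegD mdeg1 d1 addn1.
have := congr1 (@mdeg _) e2; rewrite mdegD mdeg1 d2 add1n subnS => ->.
by [].
Qed.

Lemma mdeg_tuple n m : mdeg m = n ->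
  exists I : n.-tuple 'I_N, m = (\sum_(i <- I) U_(i))%MM.
Proof.
elim: n m => [|n IH] m md.
  by exists [tuple]; apply/eqP; rewrite big_nil -mdeg_eq0 md.
have [|m1 [m2 [e /eqP/mdeg1P[i /eqP ei] d2]]] := @mdeg_split m 1; first by rewrite md.
have [|I eI] := IH m2; first by rewrite d2 md subn1.
by exists [tuple of i :: I]; rewrite big_cons e ei eI.
Qed.

Variables (F : fieldType) (n : nat) (D : {set {set 'I_N}}).
Variables (sphD : mod2_sphere n D) (a : nat -> 'I_N -> F) (gen : generic_rows a n).
Local Notation S := {mpoly F[N]}.
Local Notation th r := (lform (a r)).

Lemma mulX_lform (u : {set 'I_N}) (v : 'I_N -> F) : {in u, forall j, v j = 0} ->
  'X_[mset u] * lform v = \sum_(j | j \notin u) v j *: 'X_[mset (j |: u)] :> S.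
Proof.
move=> vu; rewrite /lform (bigID (fun j => j \in u)) /=.
rewrite [X in _ * (X + _)]big1 ?add0r => [|j ju]; last by rewrite vu ?scale0r.
rewrite mulr_sumr; apply: eq_bigr => j ju.
by rewrite mset_setU1 // mpolyXD -scalerAr mulrC.
Qed.

(** A subspace of the forms of degree [d] that contains what vanishes in the
    quotient ring. *)
Record relations d (P : S -> Prop) : Prop := Relations {
  relD : forall p q, P p -> P q -> P (p + q);
  relZ : forall c p, P p -> P (c *: p);
  relF : forall p, face_ideal D p -> P p;
  relT : forall e p (s : nat), d = e.+1 -> p \is e.-homog -> (s < n)%N -> P (p * th s)
}.

Section Relations.
Variables (d : nat) (P : S -> Prop) (relP : relations d P).

Lemma rel_sum (I : Type) (r : seq I) (A : pred I) (f : I -> S) :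
  (forall i, A i -> P (f i)) -> P (\sum_(i <- r | A i) f i).
Proof.
move=> hf; elim/big_ind: _ => //; last exact: relD relP.
exact/(relF relP)/face_ideal0.
Qed.

Lemma relB p q : P p -> P q -> P (p - q).
Proof. by move=> hp hq; apply: (relD relP) => //; rewrite -scaleN1r; apply: (relZ relP). Qed.

Lemma relZI c p : c != 0 -> P (c *: p) -> P p.
Proof. by move=> c0 /(relZ relP c^-1); rewrite scalerA mulVf // scale1r. Qed.

Lemma rel_form e p k (w : nat -> F) : d = e.+1 -> p \is e.-homog -> (k <= n)%N ->
  P (p * lform (fun j => \sum_(s < k) w s * a s j)).
Proof.
move=> de hp kn; rewrite lform_sum mulr_sumr; apply: rel_sum => s _.
by rewrite -scalerAr; apply/(relZ relP)/(relT relP de hp); apply: leq_trans kn.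
Qed.

(** Modulo the linear forms, a repeated vertex of a monomial can be traded for
    vertices outside its support. *)
Lemma rel_squarefree p : (d <= n)%N ->
  (forall s, s \in D -> #|s| = d -> P 'X_[mset s]) -> p \is d.-homog -> P p.
Proof.
move=> dn hs /dhomogP hp; rewrite (mpolyE p) big_seq; apply: rel_sum => m mp.
apply: (relZ relP); move: (hp _ mp) => {p hp mp} /= md.
have [k mk] : exists k, (d - #|supp m|)%N = k by exists (d - #|supp m|)%N.
elim: k m md mk => [|k IH] m md mk.
  have [mD|mD] := boolP (supp m \in D); last exact/(relF relP)/face_idealX.
  have mc : #|supp m| = d.
    by apply/eqP; rewrite eqn_leq -{1}md card_supp_le -subn_eq0 mk.
  have [->|[i im [e es]]] := squarefree_or m; first by apply: hs; rewrite ?supp_mset.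
  have := congr1 (@mdeg _) e; rewrite mdegD mdeg1 add1n md => dm.
  by have := card_supp_le (m - U_(i)); rewrite es mc dm ltnn.
have [mD|mD] := boolP (supp m \in D); last exact/(relF relP)/face_idealX.
have [e|[i im [e es]]] := squarefree_or m.
  by move: mk; rewrite -md {1}e mdeg_mset subnn.
have mn : (#|supp m| <= n)%N := sphere_dim sphD mD.
have [w hw] := generic_span gen (fun j => (i == j)%:R) mn.
pose v j := \sum_(s < #|supp m|) w s * a s j.
have {}hw : {in supp m, forall j, v j = (i == j)%:R} := hw.
have := congr1 (@mdeg _) e; rewrite md mdegD mdeg1 add1n => de.
have Pv : P ('X_[m - U_(i)] * lform v).
  by apply: rel_form de _ mn; rewrite dhomogX.
have -> : 'X_[m] = 'X_[m - U_(i)] * lform v -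
    \sum_(j | j \notin supp m) v j *: 'X_[U_(j) + (m - U_(i))].
  rewrite /lform (bigID (fun j => j \in supp m)) /= (bigD1 i) //= hw // eqxx scale1r.
  rewrite [X in 'X_i + X]big1 ?addr0 => [|j /andP[jm ji]]; last first.
    by rewrite hw // eq_sym (negPf ji) scale0r.
  rewrite mulrDr -mpolyXD addmC -e mulr_sumr.
  rewrite [X in _ + X - _](eq_bigr (fun j => v j *: 'X_[U_(j) + (m - U_(i))])) ?addrK //.
  by move=> j _; rewrite -scalerAr -mpolyXD addmC.
apply: relB Pv _; apply: rel_sum => j jm; apply/(relZ relP)/IH.
  by rewrite mdegD mdeg1 add1n -de.
rewrite suppD suppU es cardsU1 jm add1n subnS.
by rewrite mk.
Qed.

(** Some combination of the linear forms is [1] at [i] and [0] at the other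
    vertices of the facet [s]. Multiplied by the monomial of [u] it trades that
    of [i |: u] for faces that leave [s]. *)
Lemma rel_exchange s i (u : {set 'I_N}) : #|s| = n -> i \in s -> u \subset s -> i \notin u ->
  exists v : 'I_N -> F, [/\ v i = 1, {in u, forall j, v j = 0} &
    (d = #|u|.+1 -> P (\sum_(j | j \notin u) v j *: 'X_[mset (j |: u)])) /\
    (forall s' : {set 'I_N}, #|s'| = n -> {in s', forall j, v j = 0} -> False)].
Proof.
move=> sn is_ us iu; have sn' : (#|s| <= n)%N by rewrite sn.
have [w hw] := generic_span gen (fun j => (i == j)%:R) sn'.
pose v j := \sum_(k < #|s|) w k * a k j.
have {}hw : {in s, forall j, v j = (i == j)%:R} := hw.
have vu j : j \in u -> v j = 0.
  move=> ju; rewrite hw ?(subsetP us) //.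
  by case: eqP ju => // <-; rewrite (negPf iu).
exists v; split=> //; first by rewrite hw // eqxx.
split=> [de|s' s'n v0].
  rewrite -mulX_lform //.
  by apply: rel_form de _ sn'; rewrite dhomogX /= mdeg_mset.
have w0 : forall k, (k < #|s|)%N -> w k = 0.
  rewrite sn -s'n; apply: (generic_independent gen); first by rewrite s'n.
  by rewrite s'n -sn.
have := hw i is_; rewrite eqxx /v big1 => [/esym/eqP|k _]; first by rewrite oner_eq0.
by rewrite w0 ?mul0r.
Qed.

(** Two adjacent facets are proportional in the top degree, and facets are
    connected through ridges; so the top degree is spanned by one facet. *)
Lemma rel_facet s p : d = n -> s \in D -> #|s| = n -> P 'X_[mset s] ->
  p \is d.-homog -> P p.
Proof.
move=> dn sD sn Ps; apply: rel_squarefree; first by rewrite dn.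
rewrite dn => s' s'D s'n.
pose X := [set t in D | `[< P 'X_[mset t] >]].
suff : s' \in X by rewrite inE => /andP[_ /asboolP].
apply: (sphere_connected sphD (u := set0)) => //; rewrite ?sub0set //.
  by exists s; [rewrite inE sD; apply/asboolP | rewrite sub0set].
move=> t t'; rewrite inE => /andP[tD /asboolP Pt] t'D tn t'n _ ridge.
rewrite inE t'D; apply/asboolP.
have tt' : t != t' by apply/eqP=> e; move: ridge; rewrite e setIid t'n => /esym/n_Sn.
set u := t :&: t' in ridge *.
have uD : u \in D := sphere_down sphD (subsetIl _ _) tD.
have e : [set x in D | (u \subset x) && (#|x| == n)] = [set t; t'].
  apply/esym/eqP; rewrite eqEcard (sphere_ridge sphD uD) // cards2 tt' leqnn andbT.
  by rewrite subUset !sub1set !inE tD t'D tn t'n subsetIl subsetIr eqxx.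
have vert x : x \in D -> u \subset x -> #|x| = n -> exists2 i, i \notin u & x = i |: u.
  move=> xD ux xn; have /eqP/cards1P[i xi] : #|x :\: u| = 1%N.
    by rewrite cardsD (setIidPr ux) xn -ridge subSnn.
  exists i; first by have := set11 i; rewrite -xi inE => /andP[].
  rewrite -xi; apply/setP=> y; rewrite in_setU in_setD; case: (boolP (y \in u)) => yu.
    by rewrite (subsetP ux _ yu).
  by rewrite orbF.
have [i iu ti] := vert t tD (subsetIl _ _) tn.
have [i' i'u ti'] := vert t' t'D (subsetIr _ _) t'n.
have it : i \in t by rewrite ti setU11.
have [v [vi vu [Pv v0]]] := rel_exchange tn it (subsetIl _ _) iu.
have i'i : i' != i by apply: contraNneq tt' => ii; rewrite ti ti' ii.
have vi' : v i' != 0.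
  apply/eqP => vi'; apply: (v0 t' t'n) => j; rewrite ti' in_setU1.
  by case/orP=> [/eqP->|/vu].
apply: (relZI vi'); have := Pv; rewrite dn ridge => /(_ erefl).
rewrite (bigD1 i) //= vi scale1r -ti (bigD1 i') /=; last by rewrite i'u.
rewrite -ti' addrCA.
set Q := (X in _ + (_ + X)) => hQ.
rewrite -[X in P X](addrK ('X_[mset t] + Q)); apply: relB hQ _.
apply: (relD relP) => //; apply: rel_sum => j /andP[/andP[ju ji] ji'].
apply/(relZ relP)/(relF relP)/face_idealX; rewrite supp_mset.
apply/negP => jD.
have : (j |: u) \in [set x in D | (u \subset x) && (#|x| == n)].
  by rewrite inE jD subsetUr cardsU1 ju add1n ridge eqxx.
rewrite e !inE => /orP[]/eqP eju.
  by move: (setU11 j u); rewrite eju ti in_setU1 (negPf ji) (negPf ju).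
by move: (setU11 j u); rewrite eju ti' in_setU1 (negPf ji') (negPf ju).
Qed.

End Relations.
End Spanning.


(** * Derivations in characteristic 2 *)

Section Derivations.
Variable R : comNzRingType.

Record derivation (d : R -> R) : Prop := Derivation {
  derD : forall x y, d (x + y) = d x + d y;
  derM : forall x y, d (x * y) = d x * y + x * d y
}.

Variables (d : R -> R) (derd : derivation d).

Lemma der0 : d 0 = 0.
Proof. by apply: (addIr (d 0)); rewrite -(derD derd) !add0r. Qed.

Lemma der1 : d 1 = 0.
Proof.
by apply: (addIr (d 1)); rewrite add0r -{3}[1]mul1r (derM derd) mulr1 mul1r.
Qed.

Lemma der_nat k : d k%:R = 0.
Proof. by elim: k => [|k IH]; rewrite ?der0 // -natr1 (derD derd) IH der1 addr0. Qed.

Lemma der_sum (I : Type) (r : seq I) (P : pred I) (f : I -> R) :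
  d (\sum_(i <- r | P i) f i) = \sum_(i <- r | P i) d (f i).
Proof.
by elim/big_rec2: _ => [|i y1 y2 _ <-]; rewrite ?der0 ?(derD derd).
Qed.

Lemma der_prod0 (I : Type) (r : seq I) (P : pred I) (f : I -> R) :
  (forall i, P i -> d (f i) = 0) -> d (\prod_(i <- r | P i) f i) = 0.
Proof.
move=> hf; elim/big_rec: _ => [|i y Pi hy]; first exact: der1.
by rewrite (derM derd) hy hf // mul0r mulr0 addr0.
Qed.

Lemma der_const x y : d x = 0 -> d (x * y) = x * d y.
Proof. by move=> dx; rewrite (derM derd) dx mul0r add0r. Qed.

End Derivations.

Section FieldDerivations.
Variables (E : fieldType) (d : E -> E) (derd : derivation d).
Hypothesis char2 : 2%N \in [pchar E].

Lemma addff2 (x : E) : x + x = 0.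
Proof. by rewrite -mulr2n -mulr_natl pcharf0 // mul0r. Qed.

Lemma oppf2 (x : E) : - x = x.
Proof. by rewrite -[LHS]addr0 -(addff2 x) addKr. Qed.

Lemma der_sqr x : d (x ^+ 2) = 0.
Proof. by rewrite expr2 (derM derd) [x * _]mulrC addff2. Qed.

Lemma der_sqrM x y : d (x ^+ 2 * y) = x ^+ 2 * d y.
Proof. exact/(der_const derd)/der_sqr. Qed.

Lemma derV x : d x^-1 = x^-1 ^+ 2 * d x.
Proof.
have [->|x0] := eqVneq x 0; first by rewrite invr0 (der0 derd) mulr0.
by rewrite -der_sqrM expr2 -mulrA mulVf ?mulr1.
Qed.

End FieldDerivations.

Lemma sum_enum_val (V : nmodType) (T : finType) (s : {set T}) (f : T -> V) :
  \sum_(j in s) f j = \sum_(k < #|s|) f (enum_val k).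
Proof. exact: big_enum_val. Qed.

(** * The degree map and its derivatives *)

(** The degree map takes its values in a field [E] that contains [F] and
    indeterminates [t], and that carries the partial derivatives [dt] along
    them and [da] along the coefficients [a] of the linear forms. *)
Section DegreeMap.
Variables (N n : nat) (D : {set {set 'I_N}}) (sphD : mod2_sphere n D).
Variables (F : fieldType) (char2 : 2%N \in [pchar F]).
Variables (a : nat -> 'I_N -> F) (gen : generic_rows a n).
Variables (E : fieldType) (iota : {rmorphism F -> E}) (t : 'I_n -> E).
Variables (dt : 'I_n -> E -> E) (da : 'I_n -> 'I_N -> E -> E).
Hypothesis der_dt : forall r, derivation (dt r).
Hypothesis der_da : forall r k, derivation (da r k).
Hypothesis dt_t : forall r s, dt r (t s) = (r == s)%:R.
Hypothesis dt_iota : forall r c, dt r (iota c) = 0.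
Hypothesis da_t : forall r k s, da r k (t s) = 0.
Hypothesis da_a : forall r k (s : 'I_n) j,
  da r k (iota (a s j)) = ((r == s) && (k == j))%:R.
Hypothesis da_dt : forall r k s x, da r k (dt s x) = dt s (da r k x).
Local Notation S := {mpoly F[N]}.
Local Notation b i j := (iota (a i j)).
Implicit Types (u s : {set 'I_N}) (p h : S).

Lemma char2E : 2%N \in [pchar E].
Proof. exact: rmorph_pchar char2. Qed.

Section Solve.
Variable s : {set 'I_N}.

Let A := map_mx iota (\matrix_(i < #|s|, j < #|s|) a i (enum_val j)).

Let A_unit : #|s| = n -> A \in unitmx.
Proof. by move=> sn; rewrite map_unitmx; apply: gen; rewrite sn. Qed.

Lemma column_unique (x : 'I_N -> E) : #|s| = n -> (forall j, j \notin s -> x j = 0) ->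
  (forall i : 'I_n, \sum_j b i j * x j = 0) -> forall j, x j = 0.
Proof.
move=> sn x0 hx j; have [js|/x0//] := boolP (j \in s).
have : A *m (\col_k x (enum_val k)) = 0.
  apply/colP=> i; rewrite mxE [RHS]mxE.
  have ni : (i < n)%N by rewrite -sn.
  rewrite -[RHS](hx (Ordinal ni)) (bigID (fun j => j \in s)) /=.
  rewrite [X in _ + X]big1 ?addr0 => [|k ks]; last by rewrite x0 ?mulr0.
  by rewrite sum_enum_val; apply: eq_bigr => k _; rewrite !mxE.
move/(congr1 (mulmx (invmx A))); rewrite mulKmx ?A_unit // mulmx0.
have [k <-] : exists k : 'I_#|s|, enum_val k = j.
  by exists (enum_rank_in js j); apply: enum_rankK_in.
by move/colP/(_ k); rewrite !mxE.
Qed.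

(** The coordinates on the facet [s] as linear forms in the indeterminates
    [t i], to which the forms [a i] restrict. *)
Definition xval j : E :=
  \sum_(k < #|s| | enum_val k == j)
    (invmx A *m (\col_k oapp t 0 (insub (val k)))) k 0.

Lemma xval_out j : j \notin s -> xval j = 0.
Proof.
move=> js; rewrite /xval big_pred0 // => k; apply/negP => /eqP e.
by rewrite -e enum_valP in js.
Qed.

Lemma xval_eq (i : 'I_n) : #|s| = n -> \sum_j b i j * xval j = t i.
Proof.
move=> sn; rewrite (bigID (fun j => j \in s)) /=.
rewrite [X in _ + X]big1 ?addr0 => [|k ks]; last by rewrite xval_out ?mulr0.
rewrite sum_enum_val.
have := mulKVmx (A_unit sn) (\col_k oapp t 0 (insub (val k))).
move/colP/(_ (cast_ord (esym sn) i)); rewrite mxE [RHS]mxE /= valK /= => <-.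
apply: eq_bigr => k _; rewrite !mxE; congr (_ * _).
rewrite /xval (big_pred1 k) ?mxE // => k'.
by rewrite (inj_eq enum_val_inj).
Qed.

End Solve.

Lemma dt_xval s r (i : 'I_n) : #|s| = n ->
  \sum_j b i j * dt r (xval s j) = (r == i)%:R.
Proof.
move=> sn; rewrite -dt_t -(xval_eq i sn) (der_sum (der_dt r)).
by apply: eq_bigr => j _; rewrite (derM (der_dt r)) dt_iota mul0r add0r.
Qed.

Lemma dt_out s r j : j \notin s -> dt r (xval s j) = 0.
Proof. by move=> js; rewrite xval_out // (der0 (der_dt r)). Qed.

(** Derivative of the solution of the linear system with right-hand side [t]. *)
Lemma da_xval s r k j : #|s| = n ->
  da r k (xval s j) = xval s k * dt r (xval s j).
Proof.
move=> sn; apply/eqP; rewrite -subr_eq0; apply/eqP; move: j.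
apply: (column_unique sn) => [j js|i].
  by rewrite dt_out // mulr0 subr0 xval_out // (der0 (der_da r k)).
under eq_bigr do rewrite mulrBr mulrCA.
rewrite sumrB -mulr_sumr dt_xval //.
have : da r k (\sum_j b i j * xval s j) = 0 by rewrite xval_eq.
rewrite (der_sum (der_da r k)).
under eq_bigr do rewrite (derM (der_da r k)) da_a addrC.
rewrite big_split /= [X in _ + X](bigD1 k) //= eqxx andbT.
rewrite [X in _ + (_ + X)]big1 ?addr0 => [|j jk]; last first.
  by rewrite [k == j]eq_sym (negPf jk) andbF mul0r.
by rewrite (oppf2 char2E) [xval s k * _]mulrC.
Qed.

Lemma xval_row s j : #|s| = n -> j \in s -> exists w : nat -> F,
  {in s, forall i, \sum_(r < n) w r * a r i = (j == i)%:R} /\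
  xval s j = \sum_(r < n) iota (w r) * t r.
Proof.
move=> sn js; have sn' : (#|s| <= n)%N by rewrite sn.
have [w] := generic_span gen (fun i => (j == i)%:R) sn'; rewrite sn => hw.
exists w; split=> //; under [RHS]eq_bigr do rewrite -(xval_eq _ sn) mulr_sumr.
rewrite exchange_big /= (bigD1 j) //= [X in _ + X]big1 ?addr0 => [|i ij].
  under eq_bigr do rewrite mulrA -rmorphM.
  by rewrite -mulr_suml -rmorph_sum hw // eqxx rmorph1 mul1r.
under eq_bigr do rewrite mulrA -rmorphM.
rewrite -mulr_suml -rmorph_sum; have [is_|/xval_out->] := boolP (i \in s); last by rewrite mulr0.
by rewrite hw // eq_sym (negPf ij) rmorph0 mul0r.
Qed.

Lemma xval_neq0 s j : #|s| = n -> j \in s -> xval s j != 0.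
Proof.
move=> sn js; have [w [hw e]] := xval_row sn js.
apply/eqP => x0; have w0 (r : 'I_n) : iota (w r) = 0.
  have : dt r (xval s j) = 0 by rewrite x0 (der0 (der_dt r)).
  rewrite e (der_sum (der_dt r)) (bigD1 r) //= big1 ?addr0 => [|i ir].
    by rewrite (der_const (der_dt r)) ?dt_iota // dt_t eqxx mulr1.
  by rewrite (der_const (der_dt r)) ?dt_iota // dt_t eq_sym (negPf ir) mulr0.
have := hw j js; rewrite eqxx big1 => [/esym/eqP|r _]; first by rewrite oner_eq0.
by have /eqP := w0 r; rewrite fmorph_eq0 => /eqP ->; rewrite mul0r.
Qed.

(** The determinant of the columns [s]. In characteristic 2 it is a permanent,
    so that it depends on the set [s] but on no ordering of it. *)
Definition det2 s : E :=
  \sum_(f : {ffun 'I_n -> 'I_N} | f @: [set: 'I_n] == s) \prod_(i : 'I_n) b i (f i).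

Definition cof2 (r : 'I_n) k s : E :=
  \sum_(f : {ffun 'I_n -> 'I_N} | (f @: [set: 'I_n] == s) && (f r == k))
    \prod_(i : 'I_n | i != r) b i (f i).

Lemma enumeration_inj s (f : {ffun 'I_n -> 'I_N}) : #|s| = n ->
  f @: [set: 'I_n] == s -> injective f.
Proof.
move=> sn /eqP fs i j.
have /imset_injP fi : #|f @: [set: 'I_n]| == #|[set: 'I_n]|.
  by rewrite fs sn cardsT card_ord.
by apply: fi; rewrite inE.
Qed.

Lemma det2_row (r : 'I_n) s : det2 s = \sum_k b r k * cof2 r k s.
Proof.
rewrite /det2 (partition_big (fun f : {ffun 'I_n -> 'I_N} => f r) xpredT) //=.
apply: eq_bigr => k _; rewrite mulr_sumr; apply: eq_bigr => f /andP[_ /eqP fk].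
by rewrite (bigD1 r) //= fk.
Qed.

(** Exchanging the rows [i] and [r] pairs the terms of the sum. *)
Lemma cof2_alien (r i : 'I_n) s : #|s| = n -> i != r -> \sum_k b i k * cof2 r k s = 0.
Proof.
move=> sn ir.
under eq_bigr do rewrite mulr_sumr.
have -> : \sum_k \sum_(f : {ffun 'I_n -> 'I_N} | (f @: [set: 'I_n] == s) && (f r == k))
      b i k * \prod_(j : 'I_n | j != r) b j (f j) =
    \sum_(f : {ffun 'I_n -> 'I_N} | f @: [set: 'I_n] == s)
      b i (f r) * \prod_(j : 'I_n | j != r) b j (f j).
  rewrite [RHS](partition_big (fun f : {ffun 'I_n -> 'I_N} => f r) xpredT) //=.
  by apply: eq_bigr => k _; apply: eq_bigr => f /andP[_ /eqP ->].
pose g (f : {ffun 'I_n -> 'I_N}) := [ffun j => f (tperm i r j)].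
have gK : involutive g by move=> f; apply/ffunP=> j; rewrite !ffunE tpermK.
have gs f : (g f @: [set: 'I_n] == s) = (f @: [set: 'I_n] == s).
  congr (_ == s); apply/setP=> x; apply/imsetP/imsetP => -[j _ ->].
    by exists (tperm i r j); rewrite ?ffunE.
  by exists (tperm i r j); rewrite ?ffunE ?tpermK.
have gF f : b i (g f r) * \prod_(j : 'I_n | j != r) b j (g f j) =
    b i (f r) * \prod_(j : 'I_n | j != r) b j (f j).
  rewrite (bigD1 i) //= [in RHS](bigD1 i) //= !ffunE tpermL tpermR.
  rewrite mulrCA; congr (_ * (_ * _)); apply: eq_bigr => j /andP[jr ji].
  by rewrite ffunE tpermD // eq_sym.
rewrite (bigID (fun f : {ffun 'I_n -> 'I_N} => f i < f r)%N) /=.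
rewrite [X in _ + X](reindex_inj (inv_inj gK)) /=.
rewrite [X in _ + X](eq_bigl (fun f : {ffun 'I_n -> 'I_N} =>
    (f @: [set: 'I_n] == s) && (f i < f r)%N)); last first.
  move=> f; rewrite gs; have [fs|//] := boolP (_ == s).
  rewrite /= !ffunE tpermL tpermR -leqNgt leq_eqVlt.
  case: eqP => //= /val_inj /(enumeration_inj sn fs) e.
  by rewrite e eqxx in ir.
by under [X in _ + X]eq_bigr do rewrite gF; rewrite (addff2 char2E).
Qed.

Lemma cof2_out r k s : k \notin s -> cof2 r k s = 0.
Proof.
move=> ks; rewrite /cof2 big_pred0 // => f; apply/negP => /andP[/eqP fs /eqP fk].
by move: ks; rewrite -fs -fk imset_f.
Qed.

(** Cramer's rule. *)
Lemma cof2_xval r k s : #|s| = n -> cof2 r k s = det2 s * dt r (xval s k).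
Proof.
move=> sn; apply/eqP; rewrite -subr_eq0; apply/eqP; move: k.
apply: (column_unique sn) => [j js|i].
  by rewrite dt_out // mulr0 subr0 cof2_out.
under eq_bigr do rewrite mulrBr mulrCA.
rewrite sumrB -mulr_sumr dt_xval //.
have [<-|ri] := eqVneq r i; first by rewrite -det2_row mulr1 subrr.
by rewrite mulr0 subr0 cof2_alien // eq_sym.
Qed.

Lemma da_det2 r k s : #|s| = n -> da r k (det2 s) = det2 s * dt r (xval s k).
Proof.
move=> sn; rewrite -cof2_xval // /det2 (der_sum (der_da r k)).
rewrite /cof2 [RHS]big_mkcondr /=; apply: eq_bigr => f _.
rewrite (bigD1 r) //= (derM (der_da r k)) da_a eqxx /= [k == _]eq_sym.
rewrite (der_prod0 (der_da r k)) => [|i ir].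
  by case: eqP; rewrite ?mul1r ?mul0r mulr0 addr0.
by rewrite da_a eq_sym (negPf ir).
Qed.

Lemma dt_det2 r s : dt r (det2 s) = 0.
Proof.
rewrite (der_sum (der_dt r)) big1 // => f _.
by apply: (der_prod0 (der_dt r)) => i _.
Qed.

(** The two folds run in opposite directions, so that a derivative of one kind
    can be exchanged for one of the other kind at a time. *)
Definition dA (I : n.-tuple 'I_N) (x : E) : E :=
  foldl (fun y r => da r (tnth I r) y) x (enum 'I_n).

Definition dT (x : E) : E := foldr dt x (enum 'I_n).

Lemma dA_sum I (T : Type) (r : seq T) (P : pred T) (f : T -> E) :
  dA I (\sum_(i <- r | P i) f i) = \sum_(i <- r | P i) dA I (f i).
Proof.
rewrite /dA; elim: (enum _) f => //= j e IH f.
by rewrite (der_sum (der_da _ _)) IH.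
Qed.

Lemma dA0 I : dA I 0 = 0.
Proof. by rewrite /dA; elim: (enum _) => //= j e; rewrite (der0 (der_da _ _)). Qed.

Lemma dA_sqrM I x y : dA I (x ^+ 2 * y) = x ^+ 2 * dA I y.
Proof.
rewrite /dA; elim: (enum _) y => //= j e IH y.
by rewrite (der_sqrM (der_da _ _) char2E) IH.
Qed.

Lemma dT_sum (T : Type) (r : seq T) (P : pred T) (f : T -> E) :
  dT (\sum_(i <- r | P i) f i) = \sum_(i <- r | P i) dT (f i).
Proof.
rewrite /dT; elim: (enum _) => //= j e ->.
by rewrite (der_sum (der_dt _)).
Qed.

Lemma dT0 : dT 0 = 0.
Proof. by rewrite /dT; elim: (enum _) => //= j e ->; rewrite (der0 (der_dt _)). Qed.

Lemma dTD x y : dT (x + y) = dT x + dT y.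
Proof. by rewrite /dT; elim: (enum _) => //= j e ->; rewrite (derD (der_dt _)). Qed.

Lemma dT_iotaM c x : dT (iota c * x) = iota c * dT x.
Proof.
by rewrite /dT; elim: (enum _) => //= j e ->; rewrite (der_const (der_dt _)).
Qed.

Lemma dT_sqrM x y : dT (x ^+ 2 * y) = x ^+ 2 * dT y.
Proof.
by rewrite /dT; elim: (enum _) => //= j e ->; rewrite (der_sqrM (der_dt _) char2E).
Qed.

Lemma dA_prod I (f : {ffun 'I_n -> 'I_N}) :
  dA I (\prod_(i : 'I_n) b i (f i)) = \prod_(i : 'I_n) (f i == tnth I i)%:R.
Proof.
have key (rs : seq 'I_n) : uniq rs ->
  foldl (fun y r => da r (tnth I r) y) (\prod_(i : 'I_n) b i (f i)) rs =
  \prod_(i : 'I_n) (if i \in rs then (f i == tnth I i)%:R else b i (f i)).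
  elim/last_ind: rs => [_|rs r IH]; first by apply: eq_bigr.
  rewrite rcons_uniq foldl_rcons => /andP[rrs /IH ->].
  rewrite (bigD1 r) //= (negPf rrs) [RHS](bigD1 r) //= mem_rcons mem_head.
  rewrite (derM (der_da _ _)) da_a eqxx /= [X in _ + _ * X](der_prod0 (der_da _ _)).
    rewrite mulr0 addr0 eq_sym; congr (_ * _); apply: eq_bigr => i ir.
    by rewrite mem_rcons in_cons (negPf ir).
  move=> i ir; case: ifP => _; first exact: (der_nat (der_da _ _)).
  by rewrite da_a eq_sym (negPf ir).
rewrite /dA key ?enum_uniq //; apply: eq_bigr => i _.
by rewrite mem_enum.
Qed.

Lemma dA_det2 I s : dA I (det2 s) = ([set tnth I i | i : 'I_n] == s)%:R.
Proof.
rewrite dA_sum; under eq_bigr do rewrite dA_prod.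
pose f0 := [ffun i => tnth I i].
have prod0 f : f != f0 -> \prod_(i : 'I_n) (f i == tnth I i)%:R = 0 :> E.
  move=> ff; have [i fi] : exists i, f i != tnth I i.
    apply/existsP; rewrite -negb_forall; apply: contra ff => /forallP h.
    by apply/eqP/ffunP=> i; rewrite ffunE; apply/eqP.
  by rewrite (bigD1 i) //= (negPf fi) mul0r.
have -> : [set tnth I i | i : 'I_n] = f0 @: [set: 'I_n].
  by apply/setP=> x; apply/imsetP/imsetP => -[i _ ->]; exists i; rewrite ?ffunE.
have [fs|fs] := boolP (f0 @: _ == s).
  rewrite (bigD1 f0) //= [X in _ + X]big1 ?addr0 => [|f /andP[_ /prod0//]].
  by rewrite big1 // => i _; rewrite ffunE eqxx.
rewrite big1 // => f fs'; apply: prod0.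
by apply: contraNneq fs => <-.
Qed.

Lemma set_tuple_enum s : #|s| = n ->
  exists I : n.-tuple 'I_N, [set tnth I i | i : 'I_n] = s /\
    (\sum_(i <- I) U_(i))%MM = mset s.
Proof.
move=> sn; have sz : size (enum s) == n by rewrite -cardE sn.
exists (Tuple sz); split.
  apply/setP=> x; apply/imsetP/idP => [[i _ ->]|xs].
    by rewrite -mem_enum mem_tnth.
  have /tnthP[i ->] : x \in Tuple sz by rewrite mem_enum.
  by exists i.
rewrite big_enum /=; apply/mnmP=> j; rewrite mnm_sumE msetE.
under eq_bigr do rewrite mnm1E.
have [js|js] := boolP (j \in s); last first.
  by rewrite big1 // => i is_; case: eqP => // e; rewrite -e is_ in js.
by rewrite (bigD1 j) //= eqxx big1 // => i /andP[_ /negPf->].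
Qed.

Lemma det2_neq0 s : #|s| = n -> det2 s != 0.
Proof.
move=> sn; have [I [Is _]] := set_tuple_enum sn.
apply/eqP => d0; have := dA_det2 I s.
by rewrite d0 dA0 Is eqxx => /esym/eqP; rewrite oner_eq0.
Qed.

Lemma dA_det2V I s : dA I (det2 s)^-1 =
  (det2 s)^-1 ^+ 2 * ([set tnth I i | i : 'I_n] == s)%:R.
Proof.
have [d0|d0] := eqVneq (det2 s) 0; first by rewrite d0 invr0 dA0 expr2 !mul0r.
by rewrite -dA_det2 -dA_sqrM expr2 -mulrA mulVf ?mulr1.
Qed.

(** The degree map, by localization at the facets. *)
Definition weight s : E := (det2 s * \prod_(j in s) xval s j)^-1.

Definition phi p : E :=
  \sum_(s in D | #|s| == n) mmap iota (xval s) p * weight s.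

Lemma phi_sum (T : Type) (r : seq T) (P : pred T) (f : T -> S) :
  phi (\sum_(i <- r | P i) f i) = \sum_(i <- r | P i) phi (f i).
Proof.
rewrite /phi exchange_big; apply: eq_bigr => s _.
by rewrite raddf_sum mulr_suml.
Qed.

Lemma phiD p q : phi (p + q) = phi p + phi q.
Proof.
by rewrite /phi -big_split; apply: eq_bigr => s _; rewrite raddfD mulrDl.
Qed.

Lemma phiZ c p : phi (c *: p) = iota c * phi p.
Proof. by rewrite mulr_sumr; apply: eq_bigr => s _; rewrite mmapZ mulrA. Qed.

Lemma mmap_face s p : face_ideal (powerset s) p -> mmap iota (xval s) p = 0.
Proof.
move=> hp; rewrite /mmap big_seq big1 // => m; rewrite mcoeff_msupp => pm.
have [i mi is_] : exists2 i, m i != 0%N & i \notin s.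
  have : ~~ (supp m \subset s) by apply: contraNN pm => ms; rewrite hp ?inE.
  by case/subsetPn => i; rewrite mem_supp; exists i.
by rewrite /mmap1 (bigD1 i) //= xval_out // expr0n (negPf mi) mul0r mulr0.
Qed.

Lemma phi_face p : face_ideal D p -> phi p = 0.
Proof.
move=> hp; rewrite /phi big1 // => s /andP[sD _].
rewrite mmap_face ?mul0r //; apply: face_idealS hp; apply/subsetP=> u.
by rewrite inE => us; apply: (sphere_down sphD) us sD.
Qed.

Lemma mmap_lform s (v : 'I_N -> F) :
  mmap iota (xval s) (lform v) = \sum_j iota (v j) * xval s j.
Proof.
rewrite /lform raddf_sum /=; apply: eq_bigr => j _.
by rewrite mmapZ mmapX mmap1U.
Qed.

Lemma phi_theta (i : 'I_n) p : phi (p * lform (a i)) = t i * phi p.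
Proof.
rewrite [RHS]mulr_sumr; apply: eq_bigr => s /andP[_ /eqP sn].
by rewrite rmorphM /= mmap_lform xval_eq // mulrAC mulrC.
Qed.

Lemma mmap_mset s u : mmap iota (xval s) 'X_[mset u] = \prod_(j in u) xval s j.
Proof.
rewrite mmapX /mmap1 [RHS]big_mkcond; apply: eq_bigr => j _.
by rewrite msetE; case: (j \in u).
Qed.

Lemma mmap_mset0 s u : ~~ (u \subset s) -> mmap iota (xval s) 'X_[mset u] = 0.
Proof.
case/subsetPn => j ju js; rewrite mmap_mset (bigD1 j) //= xval_out //.
by rewrite mul0r.
Qed.

Lemma prod_xval_neq0 s : #|s| = n -> \prod_(j in s) xval s j != 0.
Proof. by move=> sn; apply/prodf_neq0 => j js; apply: xval_neq0. Qed.

Lemma phi_facet s : s \in D -> #|s| = n -> phi 'X_[mset s] = (det2 s)^-1.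
Proof.
move=> sD sn; rewrite /phi (bigD1 s) /=; last by rewrite sD sn eqxx.
rewrite big1 ?addr0 => [|s' /andP[/andP[_ /eqP s'n] ss']].
  by rewrite mmap_mset /weight invfM mulrCA divff ?mulr1 ?prod_xval_neq0.
rewrite mmap_mset0 ?mul0r //; apply: contra ss' => ss'.
by rewrite eq_sym eqEcard ss' sn s'n leqnn.
Qed.

(** The cofactor of the facet [i |: u] at the vertex [i] only involves the
    columns of the ridge [u]. *)
Definition ridge_cof (r : 'I_n) i u : E :=
  \sum_(f : {ffun 'I_n -> 'I_N} | (f r == i) && (f @: [set~ r] == u))
    \prod_(j : 'I_n | j != r) b j (f j).

Lemma cof2_ridge r i u : i \notin u -> #|u|.+1 = n ->
  cof2 r i (i |: u) = ridge_cof r i u.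
Proof.
move=> iu un; apply: eq_bigl => f; rewrite andbC; case: eqP => //= fi.
have fT : f @: [set: 'I_n] = i |: f @: [set~ r].
  rewrite -fi -imset_set1 -imsetU; congr (f @: pred_of_set _).
  by apply/setP=> j; rewrite !inE orbN.
rewrite fT; apply/eqP/eqP=> [e|-> //].
have sn : #|i |: u| = n by rewrite cardsU1 iu add1n.
have fs : f @: [set: 'I_n] == i |: u by rewrite fT e.
have inj := enumeration_inj sn fs.
have ni : i \notin f @: [set~ r].
  apply/imsetP => -[j jr ij]; move: jr; rewrite !inE => /eqP[].
  by apply: inj; rewrite fi.
by rewrite -(setU1K iu) -e setU1K.
Qed.

Lemma ridge_cof_indep r i j u : ridge_cof r i u = ridge_cof r j u.
Proof.
pose h k (f : {ffun 'I_n -> 'I_N}) := [ffun l => if l == r then k else f l].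
have him k (f : {ffun 'I_n -> 'I_N}) : h k f @: [set~ r] = f @: [set~ r].
  by apply: eq_in_imset => l; rewrite !inE ffunE => /negPf->.
have hh k l (f : {ffun 'I_n -> 'I_N}) : f r = l -> h l (h k f) = f.
  by move=> fl; apply/ffunP=> x; rewrite !ffunE; case: eqP => [->|].
rewrite /ridge_cof (reindex_onto (h i) (h j)) /=; last first.
  by move=> f /andP[/eqP fi _]; apply: hh.
apply: eq_big => [f|f _]; last first.
  by apply: eq_bigr => l lr; rewrite ffunE (negPf lr).
rewrite him ffunE eqxx eqxx /= andbC; congr (_ && _).
apply/eqP/eqP => [<-|]; first by rewrite ffunE eqxx.
by apply: hh.
Qed.

Lemma det2_xval s i : #|s| = n -> i \in s ->
  det2 s * xval s i = \sum_r t r * cof2 r i s.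
Proof.
move=> sn is_; have [w [_ e]] := xval_row sn is_.
have dw (r : 'I_n) : dt r (xval s i) = iota (w r).
  rewrite e (der_sum (der_dt r)) (bigD1 r) //= big1 ?addr0 => [|k kr].
    by rewrite (der_const (der_dt r)) // dt_t eqxx mulr1.
  by rewrite (der_const (der_dt r)) // dt_t eq_sym (negPf kr) mulr0.
rewrite e mulr_sumr; apply: eq_bigr => r _.
by rewrite cof2_xval // dw mulrA mulrC.
Qed.

(** By Cramer's rule the contribution of a facet [i |: u] only depends on [u],
    and there are two such facets. *)
Lemma phi_ridge u : u \in D -> #|u|.+1 = n -> phi 'X_[mset u] = 0.
Proof.
move=> uD un; pose R := [set s in D | (u \subset s) && (#|s| == n)].
have R2 : #|R| = 2%N := sphere_ridge sphD uD un.
have val s : s \in R -> exists i,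
    mmap iota (xval s) 'X_[mset u] * weight s = (\sum_r t r * ridge_cof r i u)^-1.
  rewrite inE => /and3P[sD us /eqP sn].
  have /eqP/cards1P[i si] : #|s :\: u| = 1%N.
    by rewrite cardsD (setIidPr us) sn -un subSnn.
  have iu : i \notin u by have := set11 i; rewrite -si inE => /andP[].
  have es : s = i |: u.
    apply/eqP; rewrite eq_sym eqEcard cardsU1 iu add1n un sn leqnn andbT.
    by rewrite subUset us andbT -si subsetDl.
  have is_ : i \in s by rewrite es setU11.
  exists i; rewrite /weight (bigD1 i) //=.
  rewrite [X in _ * (_ * X)](_ : _ = \prod_(j in u) xval s j); last first.
    apply: eq_bigl => j; rewrite es in_setU1; case: (eqVneq j i) => [->|_].
      by rewrite (negPf iu).
    by rewrite andbT.
  rewrite mulrA det2_xval // mmap_mset invfM mulrCA divff ?mulr1; last first.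
    apply/prodf_neq0 => j ju; apply: xval_neq0 => //; exact: (subsetP us).
  by congr (_^-1); apply: eq_bigr => r _; rewrite {1}es cof2_ridge.
have [s0 s0R] : exists s, s \in R by apply/set0Pn; rewrite -card_gt0 R2.
have [i0 _] := val _ s0R.
rewrite /phi (bigID (fun s => u \subset s)) /= [X in _ + X]big1 ?addr0; last first.
  by move=> s /andP[_ us]; rewrite mmap_mset0 ?mul0r.
rewrite (eq_bigl (fun s => s \in R)) => [|s]; last by rewrite inE -andbA [_ && (#|s| == n)]andbC.
rewrite (eq_bigr (fun=> (\sum_r t r * ridge_cof r i0 u)^-1)).
  by rewrite sumr_const R2 mulr2n (addff2 char2E).
move=> s /val[i ->]; congr (_^-1); apply: eq_bigr => r _.
by rewrite (ridge_cof_indep r i i0).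
Qed.

(** Descending induction on [u]: a linear form that is [1] at [i] and [0] at the
    other vertices of a facet [s] sends the monomial of [u] to those of larger
    faces, and it multiplies the degree map by the nonzero scalar [xval s i]. *)
Lemma phi_face_monomial k u : u \in D -> (#|u| + k).+1 = n -> phi 'X_[mset u] = 0.
Proof.
elim: k u => [|k IH] u uD un; first by apply: phi_ridge; rewrite // -un addn0.
have [s [sD us sn]] := sphere_facet sphD uD.
have [i is_ iu] : exists2 i, i \in s & i \notin u.
  by apply/subsetPn; apply/negP => /subset_leq_card; rewrite sn -un; lia.
have [w [hw e]] := xval_row sn is_.
have := phi_sum (index_enum 'I_n) xpredT
   (fun r : 'I_n => 'X_[mset u] * (w r *: lform (a r))).
rewrite -mulr_sumr -lform_sum mulX_lform; last first.
  move=> j ju; rewrite hw ?(subsetP us) //.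
  by case: eqP ju => // <-; rewrite (negPf iu).
rewrite phi_sum big1 => [|j ju]; last first.
  rewrite phiZ; have [jD|jD] := boolP ((j |: u) \in D).
    rewrite IH ?mulr0 // cardsU1 ju; lia.
  by rewrite phi_face ?mulr0 //; apply: face_idealX; rewrite supp_mset.
under eq_bigr do rewrite -scalerAr phiZ phi_theta mulrA.
rewrite -mulr_suml -e => /esym/eqP.
by rewrite mulf_eq0 (negPf (xval_neq0 sn is_)) => /eqP.
Qed.

Lemma phi_low d p : (d < n)%N -> p \is d.-homog -> phi p = 0.
Proof.
elim: d p => [|d IH] p dn hp;
  apply: (@rel_squarefree _ _ _ _ sphD _ gen _ (fun p => phi p = 0) _ p) hp;
  rewrite ?(ltnW dn) //.
- split=> [p1 p2|c p1|p1|//].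
  + by rewrite phiD => -> ->; rewrite addr0.
  + by rewrite phiZ => ->; rewrite mulr0.
  + exact: phi_face.
- by move=> s sD s0; apply: (phi_face_monomial (k := n.-1)) => //; rewrite s0; lia.
- split=> [p1 p2|c p1|p1|e p1 i [<-] hp1 ni].
  + by rewrite phiD => -> ->; rewrite addr0.
  + by rewrite phiZ => ->; rewrite mulr0.
  + exact: phi_face.
  + by rewrite (phi_theta (Ordinal ni)) IH ?mulr0 // ltnW.
- move=> s sD s0; apply: (phi_face_monomial (k := (n - d.+2)%N)) => //.
  by rewrite s0; lia.
Qed.

Lemma phi_mod_ideal p : p \is n.-homog -> mod_ideal a D n p -> phi p = 0.
Proof.
move=> hp [q /(face_ideal_pihomog n)].
rewrite pihomogB (raddf_sum (pihomog (@mdeg N) n)) /= pihomog_dE // => hq.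
rewrite -[p](subrK (\sum_(i < n) pihomog (@mdeg N) n (q i * lform (a i)))).
rewrite phiD phi_face // add0r phi_sum big1 // => i _.
have [e en] : exists e, n = e.+1.
  by exists n.-1; rewrite prednK // (leq_ltn_trans _ (ltn_ord i)).
have -> : pihomog (@mdeg N) n (q i * lform (a i)) =
    pihomog (@mdeg N) e (q i) * lform (a i).
  by rewrite (pihomogM1 n _ (lform_homog _)) {1}en.
by rewrite phi_theta (@phi_low e) ?mulr0 ?pihomogP // en.
Qed.

(** A derivative of the degree map along an entry of the column [k] is a
    derivative along [t] of its product with ['X_k]; this holds facet by
    facet. *)
Lemma da_phi r k m h :
  da r k (phi ('X_[m] * h ^+ 2)) = dt r (phi ('X_k * ('X_[m] * h ^+ 2))).
Proof.
rewrite /phi (der_sum (der_da r k)) (der_sum (der_dt r)).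
apply: eq_bigr => s /andP[_ /eqP sn].
rewrite [in RHS]rmorphM /= mmapX mmap1U.
pose good (v : E) := da r k v = xval s k * dt r v.
have goodM v1 v2 : good v1 -> good v2 -> good (v1 * v2).
  rewrite /good (derM (der_da r k)) (derM (der_dt r)) => -> ->.
  by rewrite mulrDr !mulrA [v1 * xval s k]mulrC.
have good_sqr v : good (v ^+ 2).
  by rewrite /good !(der_sqr _ char2E) // mulr0.
have goodV v : good v -> good v^-1.
  move=> hv; rewrite /good (derV (der_da r k) char2E) (derV (der_dt r) char2E).
  by rewrite hv mulrCA.
have good1 : good 1 by rewrite /good (der1 (der_da r k)) (der1 (der_dt r)) mulr0.
have goodx j : good (xval s j) by apply: da_xval.
pose v := mmap iota (xval s) ('X_[m] * h ^+ 2) / \prod_(j in s) xval s j.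
have -> : mmap iota (xval s) ('X_[m] * h ^+ 2) * weight s = v * (det2 s)^-1.
  by rewrite /weight invfM [(det2 s)^-1 * _]mulrC mulrA.
have gv : good v.
  apply: (goodM); last first.
    by apply: (goodV); elim/big_ind: _ => // *; apply: (goodM).
  rewrite rmorphM rmorphXn /=; apply: (goodM) => //.
  rewrite mmapX /mmap1; elim/big_ind: _ => [//|*|j _]; first exact: (goodM).
  by elim: (m j) => [//|e IH]; rewrite exprS; apply: (goodM).
have -> : xval s k * mmap iota (xval s) ('X_[m] * h ^+ 2) * weight s =
    (xval s k * v) * (det2 s)^-1.
  by rewrite /v /weight -!mulrA invfM [(det2 s)^-1 * _]mulrC.
rewrite (derM (der_da r k)) (derM (der_dt r)) (derM (der_dt r)) gv.
rewrite (derV (der_da r k) char2E) (derV (der_dt r) char2E) dt_det2 mulr0 mulr0 addr0.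
rewrite da_det2 // expr2 -[_^-1 * _^-1 * _]mulrA mulKf ?det2_neq0 //.
rewrite mulrDl addrC; congr (_ + _).
by rewrite [(det2 s)^-1 * _]mulrC mulrA [v * _]mulrC.
Qed.

(** Differentiating once in each row multiplies the argument by a monomial of
    degree [n]. This is the identity that makes the quadratic form visible. *)
Lemma dA_phi I m h :
  dA I (phi ('X_[m] * h ^+ 2)) =
  dT (phi ('X_[\sum_(i <- I) U_(i)] * ('X_[m] * h ^+ 2))).
Proof.
have fold_dt r (rs : seq 'I_n) y :
    foldl (fun y r => da r (tnth I r) y) (dt r y) rs =
    dt r (foldl (fun y r => da r (tnth I r) y) y rs).
  by elim: rs y => //= j rs IH y; rewrite da_dt IH.
have key (rs : seq 'I_n) m' :
    foldl (fun y r => da r (tnth I r) y) (phi ('X_[m'] * h ^+ 2)) rs =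
    foldr dt (phi ('X_[\sum_(r <- rs) U_(tnth I r)] * ('X_[m'] * h ^+ 2))) rs.
  elim: rs m' => [|r rs IH] m' /=; first by rewrite big_nil mpolyX0 mul1r.
  rewrite da_phi mulrA -mpolyXD fold_dt IH; congr (dt r (foldr dt (phi _) rs)).
  by rewrite big_cons !mpolyXD -!mulrA mulrCA.
rewrite /dA key /dT big_enum /= (big_tuple _ _ I xpredT (fun i => U_(i)%MM)).
by [].
Qed.

(** A monomial of degree at least [n] has a divisor of degree [n], which can be
    traded for derivatives of a degree map in degree less than [n]. *)
Lemma dT_low d p : (d < n.*2)%N -> p \is d.-homog -> dT (phi p) = 0.
Proof.
move=> dn /dhomogP hp; rewrite (mpolyE p) phi_sum dT_sum big_seq big1 // => m /hp /= md.
rewrite phiZ dT_iotaM; have [dn'|nd] := ltnP d n.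
  by rewrite (phi_low dn') ?dT0 ?mulr0 // dhomogX /= md.
have [|m1 [m2 [em d1 d2]]] := @mdeg_split _ m n; first by rewrite md.
have [I eI] := mdeg_tuple d1.
have -> : 'X_[m] =
    'X_[\sum_(i <- I) U_(i)] * ('X_[m2] * 1 ^+ 2) :> S.
  by rewrite expr1n mulr1 em eI mpolyXD.
rewrite -dA_phi expr1n mulr1 (@phi_low (mdeg m2)) ?dA0 ?mulr0 //.
  by rewrite d2 md ltn_subLR // addnn.
by rewrite dhomogX.
Qed.

Lemma sqrD2 p q : (p + q) ^+ 2 = p ^+ 2 + q ^+ 2.
Proof. by rewrite sqrrD mulr2n (addpp2 char2) addr0. Qed.

Lemma homog_sqr d p : p \is d.-homog -> p ^+ 2 \is d.*2.-homog.
Proof. by move=> hp; rewrite -muln2; apply: dhomogMn. Qed.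

Lemma sphere_has_facet : exists2 s, s \in D & #|s| = n.
Proof.
by have [s [sD _ sn]] := sphere_facet sphD (sphere_set0 sphD); exists s.
Qed.

(** Both sides are Frobenius-semilinear in [h] and vanish on multiples of the
    linear forms, so it is enough to compare them on one facet. *)
Lemma dT_sqr h : h \is n.-homog -> dT (phi (h ^+ 2)) = phi h ^+ 2.
Proof.
have [s sD sn] := sphere_has_facet.
apply: (@rel_facet _ _ _ _ sphD _ gen n
  (fun h => dT (phi (h ^+ 2)) = phi h ^+ 2) _ s) => //.
  split=> [p q|c p|p hp|e p i ne hp ni].
  - rewrite sqrD2 !phiD dTD => -> ->.
    by rewrite sqrrD mulr2n (addff2 char2E) addr0.
  - by rewrite exprZn !phiZ rmorphXn dT_sqrM exprMn => ->.
  - rewrite expr2 !phi_face ?dT0 ?expr0n //.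
    by apply: face_idealMl hp; apply: sphere_down sphD.
  rewrite [_ ^+ 2 in LHS]exprMn [lform _ ^+ 2]expr2 mulrA !(phi_theta (Ordinal ni)).
  rewrite mulrA -expr2 dT_sqrM (dT_low (d := e.*2)) ?homog_sqr // ?ne ?ltn_double //.
  by rewrite (phi_low (d := e)) ?ne // !mulr0 expr0n.
have [I [Is Im]] := set_tuple_enum sn.
have -> : 'X_[mset s] ^+ 2 = 'X_[\sum_(i <- I) U_(i)] * ('X_[mset s] * 1 ^+ 2) :> S.
  by rewrite expr1n mulr1 Im expr2.
by rewrite -dA_phi expr1n mulr1 phi_facet // dA_det2V Is eqxx mulr1.
Qed.

(** Again the expression is semilinear in [h], so that [h] can be taken to be a
    square-free monomial avoiding [i]. Then the derivatives in question are
    along columns among which [i] does not occur, whereas only a facet through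
    [i] contributes. *)
Lemma dT_mixed i k e h : i != k -> n = e.+1 -> h \is e.-homog ->
  dT (phi ('X_i * 'X_k * h ^+ 2)) = 0.
Proof.
move=> ik ne hh.
pose P h := dT (phi ('X_i * 'X_k * h ^+ 2)) = 0.
have relP : relations n D a e P.
  split=> [p q|c p|p hp|e' p r ee' hp rn]; rewrite /P.
  - by rewrite sqrD2 mulrDr phiD dTD => -> ->; rewrite addr0.
  - by rewrite exprZn -scalerAr phiZ rmorphXn dT_sqrM => ->; rewrite mulr0.
  - rewrite phi_face ?dT0 // expr2 mulrA.
    by apply: face_idealMl hp; apply: sphere_down sphD.
  rewrite exprMn mulrA expr2 mulrA !(phi_theta (Ordinal rn)) mulrA -expr2 dT_sqrM.
  rewrite (dT_low (d := (2 + e'.*2)%N)) ?mulr0 //; first by rewrite ne ee' doubleS; lia.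
  apply: dhomogM (homog_sqr hp).
  have X1 j : ('X_j : S) \is 1.-homog by rewrite dhomogX /= mdeg1.
  exact: dhomogM (X1 i) (X1 k).
have en : (e <= n)%N by rewrite ne.
have avoid u : #|u| = e -> i \notin u -> P 'X_[mset u].
  move=> ue iu; rewrite /P.
  have [sD|sD] := boolP ((i |: (k |: u)) \in D); last first.
    rewrite phi_face ?dT0 // expr2 -!mpolyXD.
    apply: face_idealX; rewrite !suppD !suppU supp_mset setUid.
    by rewrite -setUA.
  have ku : k \in u.
    apply: contraTT sD => ku; apply/negP => /(sphere_dim sphD).
    by rewrite !cardsU1 in_setU1 (negPf ik) (negPf iu) ku ue ne !add1n ltnn.
  have su : k |: u = u by apply/setUidPr; rewrite sub1set.
  rewrite su in sD; have sn : #|i |: u| = n by rewrite cardsU1 iu ue ne.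
  have [I eI] : exists I : n.-tuple 'I_N, (U_(k) + mset u)%MM = (\sum_(i <- I) U_(i))%MM.
    by apply: mdeg_tuple; rewrite mdegD mdeg1 mdeg_mset ue ne.
  have -> : 'X_i * 'X_k * 'X_[mset u] ^+ 2 =
      'X_[\sum_(i <- I) U_(i)] * ('X_[mset (i |: u)] * 1 ^+ 2) :> S.
    by rewrite expr1n mulr1 -eI mset_setU1 // !mpolyXD expr2; ring.
  rewrite -dA_phi expr1n mulr1 phi_facet // dA_det2V.
  case: eqP => [Is|]; last by rewrite mulr0.
  have : i \in [set tnth I i | i : 'I_n] by rewrite Is setU11.
  case/imsetP => r _ ir; have /mnmP/(_ i) := eI.
  rewrite mnmDE mnm1E eq_sym (negPf ik) msetE (negPf iu) => /esym/eqP.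
  rewrite mnm_sumE (big_tuple _ _ I xpredT (fun j => U_(j)%MM i)).
  by rewrite (bigD1 r) //= mnm1E -ir eqxx.
apply: (rel_squarefree sphD gen relP) hh => // u uD ue.
have [iu|/(avoid u ue)//] := boolP (i \in u).
have [s [sD us sn]] := sphere_facet sphD uD.
have ui : #|u :\ i|.+1 = e by rewrite -ue (cardsD1 i u) iu.
have := rel_exchange gen relP sn (subsetP us _ iu) (subset_trans (subD1set u i) us).
case=> [|v [vi vu [Pv _]]]; first by rewrite !inE eqxx.
have {Pv} := Pv (esym ui); rewrite (bigD1 i) /= ?vi ?scale1r ?setD1K ?inE ?eqxx //.
set Q := (X in _ + X) => hQ.
rewrite -[X in P X](addrK Q); apply: (relB relP) hQ _.
apply: (rel_sum relP) => j /andP[ju ji].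
by apply/(relZ relP)/avoid; rewrite ?cardsU1 ?ju ?ui // in_setU1 !inE eqxx orbF eq_sym.
Qed.

(** The top degree is spanned by one facet, and the degree of that facet is not
    zero. *)
Lemma phi_faithful p : p \is n.-homog -> phi p = 0 -> mod_ideal a D n p.
Proof.
move=> hp p0; have [s sD sn] := sphere_has_facet.
have dD := sphere_down sphD.
have [c hc] : exists c, mod_ideal a D n (p - c *: 'X_[mset s]).
  apply: (@rel_facet _ _ _ _ sphD _ gen n (fun p => exists c,
    mod_ideal a D n (p - c *: 'X_[mset s])) _ s) hp => //; last first.
    by exists 1; rewrite scale1r subrr; apply: mod_ideal0.
  split=> [p1 p2 [c1 h1] [c2 h2]|c p1 [c1 h1]|p1 h1|e p1 i _ _ ni].
  - exists (c1 + c2); rewrite scalerDl opprD addrACA; exact: mod_idealD.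
  - exists (c * c1); rewrite -scalerA -scalerBr; exact: mod_idealZ.
  - by exists 0; rewrite scale0r subr0; apply: mod_idealF.
  - by exists 0; rewrite scale0r subr0; apply: mod_ideal_theta.
have hs : ('X_[mset s] : S) \is n.-homog by rewrite dhomogX /= mdeg_mset sn.
have /phi_mod_ideal/(_ hc) : p - c *: 'X_[mset s] \is n.-homog.
  by apply: rpredB => //; apply: rpredZ.
rewrite -scaleNr phiD phiZ p0 add0r phi_facet // => /eqP.
rewrite mulf_eq0 fmorph_eq0 invr_eq0 (negPf (det2_neq0 sn)) orbF oppr_eq0.
by move/eqP => c0; rewrite c0 scale0r subr0 in hc.
Qed.

(** Poincare duality: below the top degree there is no socle. *)
Lemma poincare_duality m g : (m <= n)%N -> g \is m.-homog ->
  (forall L, mdeg L = (n - m)%N -> phi ('X_[L] * g) = 0) -> mod_ideal a D n g.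
Proof.
move=> mn; have [k mk] : exists k, (n - m)%N = k by exists (n - m)%N.
elim: k m g mn mk => [|k IH] m g mn mk gm hg.
  have nm : m = n by apply/eqP; rewrite eqn_leq mn -subn_eq0 mk.
  apply: phi_faithful; first by rewrite -nm.
  by rewrite -[g]mul1r -mpolyX0; apply: hg; rewrite mk mdeg0.
have mn' : (m < n)%N by rewrite -subn_gt0 mk.
apply: (face_ring_socle sphD char2 gen mn' gm) => v.
have nm : (n - m.+1)%N = k by rewrite subnS mk.
apply: (IH _ _ mn' nm) => [|L dL].
  by rewrite -add1n; apply: dhomogM => //; rewrite dhomogX /= mdeg1.
rewrite mulrA -mpolyXD; apply: hg.
by rewrite mdegD mdeg1 dL nm mk addn1.
Qed.

(** * Anisotropy in characteristic 2 *)

(** For [L = J + M] and [I = J + M + M], the square of [phi ('X_[L] * g)] is the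
    derivative along [I] of [phi ('X_[J] * g ^+ 2)]. *)
Lemma anisotropic_even m g : (m.*2 <= n)%N -> g \is m.-homog ->
  (forall J, mdeg J = (n - m.*2)%N -> phi ('X_[J] * g ^+ 2) = 0) ->
  mod_ideal a D n g.
Proof.
move=> mn gm hg; have mn' : (m <= n)%N by lia.
apply: (poincare_duality mn' gm) => L dL.
have [|J [M [eL dJ dM]]] := @mdeg_split _ L (n - m.*2); first by rewrite dL; lia.
have [I eI] : exists I : n.-tuple 'I_N, (J + (M + M))%MM = (\sum_(i <- I) U_(i))%MM.
  by apply: mdeg_tuple; rewrite !mdegD dJ dM dL; lia.
have := dA_phi I J g; rewrite hg // dA0 -eI.
have -> : 'X_[J + (M + M)] * ('X_[J] * g ^+ 2) = ('X_[L] * g) ^+ 2.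
  by rewrite eL !mpolyXD; ring.
rewrite dT_sqr; first by move/esym/eqP; rewrite sqrf_eq0 => /eqP.
have -> : n = ((n - m) + m)%N by rewrite subnK.
by apply: dhomogM => //; rewrite dhomogX /= dL.
Qed.

Local Notation l := (\sum_i 'X_i : S).

(** As in the even case with [L = J + U_(i0) + M] and [I = J + U_(i0) + M + M]:
    the term of [l] at [i0] yields a square, and the other terms of [l] do not
    contribute. *)
Lemma anisotropic_odd m g : (m.*2 < n)%N -> g \is m.-homog ->
  (forall J, mdeg J = (n - m.*2.+1)%N -> phi ('X_[J] * (l * g ^+ 2)) = 0) ->
  mod_ideal a D n g.
Proof.
move=> mn gm hg; have mn' : (m <= n)%N by lia.
apply: (poincare_duality mn' gm) => L dL.
have [|J [M' [eL dJ dM']]] := @mdeg_split _ L (n - m.*2.+1); first by rewrite dL; lia.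
have [|U [M [eM' /eqP/mdeg1P[i0 /eqP eU] dM]]] := @mdeg_split _ M' 1.
  by rewrite dM' dL; lia.
have [I eI] : exists I : n.-tuple 'I_N,
    (J + U_(i0) + (M + M))%MM = (\sum_(i <- I) U_(i))%MM.
  by apply: mdeg_tuple; rewrite !mdegD dJ mdeg1 dM dM' dL; lia.
pose h : S := 'X_[J + M] * g.
have hh : h \is n.-1.-homog.
  have -> : n.-1 = (mdeg (J + M)%MM + m)%N by rewrite mdegD dJ dM dM' dL; lia.
  by apply: dhomogM => //; rewrite dhomogX.
have : dA I (phi ('X_[J] * (l * g ^+ 2))) = 0 by rewrite hg // dA0.
have -> : 'X_[J] * (l * g ^+ 2) = \sum_i 'X_[J + U_(i)] * g ^+ 2.
  by rewrite mulrA mulr_sumr mulr_suml; apply: eq_bigr => i _; rewrite mpolyXD.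
rewrite phi_sum dA_sum (bigD1 i0) //= big1 ?addr0 => [|i ii0]; last first.
  rewrite dA_phi -eI.
  have -> : 'X_[J + U_(i0) + (M + M)] * ('X_[J + U_(i)] * g ^+ 2) =
      'X_i * 'X_i0 * h ^+ 2 by rewrite /h !mpolyXD; ring.
  by apply: dT_mixed ii0 _ hh; lia.
rewrite dA_phi -eI.
have -> : 'X_[J + U_(i0) + (M + M)] * ('X_[J + U_(i0)] * g ^+ 2) = ('X_[L] * g) ^+ 2.
  by rewrite eL eM' eU !mpolyXD; ring.
rewrite dT_sqr; first by move/eqP; rewrite sqrf_eq0 => /eqP.
have -> : n = ((n - m) + m)%N by rewrite subnK.
by apply: dhomogM => //; rewrite dhomogX /= dL.
Qed.

(** The form is a square, or [l] times a square, in [l ^+ p./2 * g]. This kills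
    [l ^+ p./2 * g], hence the same form with [p] replaced by its half. *)
Lemma anisotropic_char2 (p m : nat) (g : S) : (m.*2 + p <= n)%N -> g \is m.-homog ->
  mod_ideal a D n (l ^+ p * g ^+ 2) -> mod_ideal a D n g.
Proof.
have dD := sphere_down sphD.
have l1 : l \is 1.-homog.
  by apply: rpred_sum => i _; rewrite dhomogX /= mdeg1.
have lk k : l ^+ k \is k.-homog by rewrite -[k in k.-homog]mul1n; apply: dhomogMn.
have [k] := ubnP p; elim: k p m g => // k IH p m g pk mp gm hg.
have pE := odd_double_half p; case: (odd p) pE => /=; rewrite ?add1n ?add0n => pE.
  have h1 : mod_ideal a D n (l ^+ p./2 * g).
    apply: (@anisotropic_odd (p./2 + m)); first by lia.
      exact: dhomogM.
    move=> J dJ; apply: phi_mod_ideal.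
      have -> : n = (n - (p./2 + m).*2.+1 + (1 + (p./2 + m).*2))%N by lia.
      apply: dhomogM; first by rewrite dhomogX /= dJ.
      by apply: dhomogM => //; apply: homog_sqr; apply: dhomogM.
    apply: mod_idealMl => //.
    suff -> : l * (l ^+ p./2 * g) ^+ 2 = l ^+ p * g ^+ 2 by [].
    by rewrite -[in RHS]pE [in RHS]exprS exprMn -exprM muln2 mulrA.
  have [p0|p0] := posnP p./2; first by rewrite p0 expr0 mul1r in h1.
  apply: (IH p./2) gm _; [by lia | by lia | ].
  by rewrite expr2 mulrA mulrC; apply: mod_idealMl.
have h1 : mod_ideal a D n (l ^+ p./2 * g).
  apply: (@anisotropic_even (p./2 + m)); first by lia.
    exact: dhomogM.
  move=> J dJ; apply: phi_mod_ideal.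
    have -> : n = (n - (p./2 + m).*2 + (p./2 + m).*2)%N by lia.
    apply: dhomogM; first by rewrite dhomogX /= dJ.
    by apply: homog_sqr; apply: dhomogM.
  apply: mod_idealMl => //.
  suff -> : (l ^+ p./2 * g) ^+ 2 = l ^+ p * g ^+ 2 by [].
  by rewrite -[in RHS]pE exprMn -exprM muln2.
have [p0|p0] := posnP p./2; first by rewrite p0 expr0 mul1r in h1.
apply: (IH p./2) gm _; [by lia | by lia | ].
by rewrite expr2 mulrA mulrC; apply: mod_idealMl.
Qed.

End DegreeMap.


(** * Generic coefficients over the field with two elements *)

Section FractionDerivation.
Variable R : idomainType.
Local Notation "x %:F" := (@FracField.tofrac R x).
Local Notation K := {fraction R}.

Lemma fraction_repr (x : K) :
  x = (frac (repr x)).1%:F / (frac (repr x)).2%:F.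
Proof.
rewrite -{1}[x]reprK; move: (repr x) => r.
have d0 := denom_ratioP r.
have q0 : (frac r).2%:F != 0 by rewrite tofrac_eq0.
apply: (mulIf q0); rewrite divfK //.
unlock FracField.tofrac; rewrite -[LHS]FracField.pi_mul.
apply/eqmodP => /=; rewrite FracField.equivfE /FracField.mulf /=.
by rewrite !numden_Ratio ?oner_eq0 ?mulr1 ?mul1r // mulrC.
Qed.

Lemma fractionP (x : K) : exists p q, q != 0 /\ x = p%:F / q%:F.
Proof.
exists (frac (repr x)).1, (frac (repr x)).2; split; first exact: denom_ratioP.
exact: fraction_repr.
Qed.

Lemma eq_derivation_fraction (d1 d2 : K -> K) : derivation d1 -> derivation d2 ->
  (forall p, d1 p%:F = d2 p%:F) -> d1 =1 d2.
Proof.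
move=> h1 h2 h12 x; have [p [q [q0 e]]] := fractionP x.
have q0' : q%:F != 0 by rewrite tofrac_eq0.
have xq : x * q%:F = p%:F by rewrite e mulfVK.
have := h12 p; rewrite -xq (derM h1) (derM h2) h12 => /addIr.
exact: mulIf.
Qed.

Variables (d : R -> R) (derd : derivation d).

(** The quotient rule on a chosen representative; any other one gives the same
    value. *)
Definition frac_der (x : K) : K :=
  let p := (frac (repr x)).1 in let q := (frac (repr x)).2 in
  (d p * q - p * d q)%:F / q%:F ^+ 2.

Lemma frac_derE p q : q != 0 ->
  frac_der (p%:F / q%:F) = (d p * q - p * d q)%:F / q%:F ^+ 2.
Proof.
move=> q0; set x := p%:F / q%:F; rewrite /frac_der.
have := fraction_repr x; have := denom_ratioP (repr x).
move: (frac (repr x)).1 (frac (repr x)).2 => p' q' q'0 e.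
have q0F : q%:F != 0 by rewrite tofrac_eq0.
have q0F' : q'%:F != 0 by rewrite tofrac_eq0.
have pq : p * q' = p' * q.
  apply/eqP; rewrite -tofrac_eq !rmorphM /=; apply/eqP.
  by move/eqP: e; rewrite eqr_div // => /eqP.
have dpq : d p * q' + p * d q' = d p' * q + p' * d q by rewrite -!(derM derd) pq.
apply/eqP; rewrite eqr_div ?expf_neq0 // -!rmorphXn -!rmorphM tofrac_eq; apply/eqP.
have -> : (d p' * q' - p' * d q') * q ^+ 2 =
   (d p' * q) * (q' * q) - (p' * q) * (d q' * q) by ring.
have -> : d p' * q = d p * q' + p * d q' - p' * d q by rewrite dpq addrK.
rewrite -pq.
have -> : (d p * q' + p * d q' - p' * d q) * (q' * q) - p * q' * (d q' * q) =
   d p * q' * q' * q - (p' * q) * (d q * q') by ring.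
by rewrite -pq; ring.
Qed.

Lemma frac_der_tofrac p : frac_der p%:F = (d p)%:F.
Proof.
have := @frac_derE p 1 (oner_neq0 _); rewrite tofrac1 divr1 => ->.
by rewrite (der1 derd) mulr1 mulr0 subr0 expr1n divr1.
Qed.

Lemma frac_der_derivation : derivation frac_der.
Proof.
split=> x y.
  have [p [q [q0 ->]]] := fractionP x; have [p' [q' [q'0 ->]]] := fractionP y.
  have q0F : q%:F != 0 by rewrite tofrac_eq0.
  have q0F' : q'%:F != 0 by rewrite tofrac_eq0.
  rewrite addf_div // -!rmorphM -rmorphD !frac_derE ?mulf_neq0 //.
  rewrite addf_div ?expf_neq0 // -!rmorphXn -!rmorphM -rmorphD.
  rewrite exprMn (derD derd) !(derM derd); congr (_%:F / _).
  by ring.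
have [p [q [q0 ->]]] := fractionP x; have [p' [q' [q'0 ->]]] := fractionP y.
have q0F : q%:F != 0 by rewrite tofrac_eq0.
have q0F' : q'%:F != 0 by rewrite tofrac_eq0.
rewrite mulf_div -!rmorphM !frac_derE ?mulf_neq0 //.
rewrite !mulf_div addf_div ?mulf_neq0 ?expf_neq0 //.
rewrite -!rmorphXn -!rmorphM -rmorphD.
apply/eqP; rewrite eqr_div; last first.
- by rewrite tofrac_eq0 !mulf_neq0 ?expf_neq0.
- by rewrite tofrac_eq0 ?expf_neq0 ?mulf_neq0.
rewrite -!rmorphM tofrac_eq !(derM derd); apply/eqP.
by ring.
Qed.

End FractionDerivation.

(** A commutator of derivations is a derivation, so it is determined by its
    values on the ring. *)
Lemma frac_der_comm (R : idomainType) (d1 d2 : {fraction R} -> {fraction R}) :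
  derivation d1 -> derivation d2 ->
  (forall p : R, d1 (d2 (FracField.tofrac p)) = d2 (d1 (FracField.tofrac p))) ->
  forall x, d1 (d2 x) = d2 (d1 x).
Proof.
move=> h1 h2 h12 x; apply/eqP; rewrite -subr_eq0; apply/eqP.
pose c x := d1 (d2 x) - d2 (d1 x).
apply: (@eq_derivation_fraction _ c (fun=> 0)).
- split=> y z; rewrite /c.
    by rewrite !(derD h1, derD h2) opprD addrACA.
  by rewrite !(derM h1, derM h2, derD h1, derD h2); ring.
- by split=> y z; rewrite ?addr0 ?mul0r ?mulr0 ?addr0.
- by move=> p; rewrite /c h12 subrr.
Qed.

Section CoefficientDerivation.
Variables (R : comNzRingType) (k : nat) (d : R -> R) (derd : derivation d).

Definition coef_der (p : {mpoly R[k]}) : {mpoly R[k]} :=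
  \sum_(m <- msupp p) d p@_m *: 'X_[m].

Lemma mcoeff_coef_der p m : (coef_der p)@_m = d p@_m.
Proof.
rewrite /coef_der raddf_sum /=.
under eq_bigr do rewrite mcoeffZ mcoeffX.
have [mp|mp] := boolP (m \in msupp p).
  rewrite (bigD1_seq m) //= eqxx mulr1 big1 ?addr0 // => m' m'm.
  by rewrite (negPf m'm) mulr0.
rewrite (memN_msupp_eq0 mp) (der0 derd) big_seq big1 // => m' m'p.
have [e|_] := eqVneq m' m; last by rewrite mulr0.
by rewrite -e m'p in mp.
Qed.

Lemma coef_der_derivation : derivation coef_der.
Proof.
split=> p q; apply/mpolyP=> m.
  by rewrite mcoeffD !mcoeff_coef_der mcoeffD (derD derd).
rewrite mcoeffD mcoeff_coef_der !mcoeffM (der_sum derd) -big_split /=.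
by apply: eq_bigr => i _; rewrite (derM derd) !mcoeff_coef_der.
Qed.

Lemma coef_derC c : coef_der c%:MP = (d c)%:MP.
Proof.
apply/mpolyP=> m; rewrite mcoeff_coef_der !mcoeffC; case: (m == 0%MM).
  by rewrite !mulr1.
by rewrite !mulr0 (der0 derd).
Qed.

Lemma coef_derX m : coef_der 'X_[m] = 0.
Proof.
apply/mpolyP=> m'; rewrite mcoeff_coef_der mcoeffX mcoeff0.
exact: (der_nat derd).
Qed.

Lemma coef_der_mderiv i p : coef_der (mderiv i p) = mderiv i (coef_der p).
Proof.
apply/mpolyP=> m; rewrite mcoeff_coef_der !mcoeff_mderiv mcoeff_coef_der.
by rewrite -mulr_natl (derM derd) (der_nat derd) mul0r add0r mulr_natl.
Qed.

End CoefficientDerivation.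

Lemma mderiv_derivation (R : comNzRingType) k (i : 'I_k) :
  derivation (@mderiv k R i).
Proof. by split=> p q; rewrite ?mderivD ?mderivM. Qed.

Lemma mxvec_index_eq n N (r s : 'I_n) (k j : 'I_N) :
  (mxvec_index r k == mxvec_index s j) = (r == s) && (k == j).
Proof.
by rewrite /mxvec_index (inj_eq (@cast_ord_inj _ _ _)) (inj_eq enum_rank_inj) xpair_eqE.
Qed.

(** The row index is a natural number, as for all families of linear forms here;
    rows from [n] on are zero. *)
Definition generic_coef (R : nzRingType) n N (i : nat) (j : 'I_N) :
    {mpoly R[n * N]} :=
  if insub i is Some r then 'X_(mxvec_index (r : 'I_n) j) else 0.

(** Specializing the rows to unit vectors turns the block into the identity. *)
Lemma generic_coef_rows (R : idomainType) n N :
  generic_rows (fun i j => FracField.tofrac (@generic_coef R n N i j)) n.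
Proof.
move=> s sn; rewrite unitmxE unitfE.
have -> : \matrix_(i < #|s|, j < #|s|) FracField.tofrac (generic_coef R n i (enum_val j)) =
    map_mx (@FracField.tofrac _) (\matrix_(i < #|s|, j < #|s|) generic_coef R n i (enum_val j)).
  by apply/matrixP=> i j; rewrite !mxE.
rewrite det_map_mx tofrac_eq0.
pose M : 'M[R]_(n, N) := \matrix_(r, j)
  (if insub (val r) is Some k then enum_val (k : 'I_#|s|) == j else false)%:R.
apply/eqP => /(congr1 (meval (fun k => mxvec M 0 k))).
rewrite meval0 -det_map_mx.
rewrite [map_mx _ _](_ : _ = 1%:M) ?det1 => [/eqP|]; first by rewrite oner_eq0.
apply/matrixP=> i j; rewrite !mxE /generic_coef.
have ni : (i < n)%N by rewrite (leq_trans _ sn).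
rewrite insubT /= mevalXU mxvecE mxE /= valK (inj_eq enum_val_inj).
by [].
Qed.

Lemma submm k (m : 'X_{1..k}) : (m - m)%MM = 0%MM.
Proof. by apply/mnmP=> i; rewrite mnmBE mnm0E subnn. Qed.

Section GenericChar2.
Variables (n N : nat) (D : {set {set 'I_N}}) (sphD : mod2_sphere n D).

Definition gen_field2 : fieldType := {fraction {mpoly 'F_2[n * N]}}.
Local Notation F := gen_field2.
Local Notation E := {fraction {mpoly F[n]}}.
Definition gen_coef2 (i : nat) (j : 'I_N) : F :=
  FracField.tofrac (generic_coef 'F_2 n i j).

Lemma gen_field2_char : 2%N \in [pchar F].
Proof.
rewrite inE /= -(rmorph_nat (@FracField.tofrac {mpoly 'F_2[n * N]})).
by rewrite -mpolyC_nat pchar_Zp // mpolyC0 tofrac0.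
Qed.

Let iota : {rmorphism F -> E} := (@FracField.tofrac {mpoly F[n]} \o @mpolyC n F).
Let t (r : 'I_n) : E := FracField.tofrac 'X_r.
Let dF (r : 'I_n) (k : 'I_N) : F -> F := frac_der (mderiv (mxvec_index r k)).
Let dt (r : 'I_n) : E -> E := frac_der (mderiv r).
Let da (r : 'I_n) (k : 'I_N) : E -> E := frac_der (coef_der (dF r k)).

Let der_dF r k : derivation (dF r k).
Proof. exact/frac_der_derivation/mderiv_derivation. Qed.

(** The degree map is taken over the rational functions in [t] over [F], to
    which the derivatives of [F] extend coefficientwise. *)
Theorem generic_anisotropic_char2 (m p : nat) (g : {mpoly F[N]}) :
  (m.*2 + p <= n)%N -> g \is m.-homog ->
  mod_ideal gen_coef2 D n ((\sum_i 'X_i) ^+ p * g ^+ 2) ->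
  mod_ideal gen_coef2 D n g.
Proof.
have der_dt r : derivation (dt r).
  exact/frac_der_derivation/mderiv_derivation.
have der_da r k : derivation (da r k).
  exact/frac_der_derivation/coef_der_derivation.
have dt_t r s : dt r (t s) = (r == s)%:R.
  rewrite /dt /t frac_der_tofrac; last exact: mderiv_derivation.
  rewrite mderivX mnm1E eq_sym; case: eqP => [->|_]; last by rewrite scale0r tofrac0.
  by rewrite scale1r submm mpolyX0 tofrac1.
have dt_iota r c : dt r (iota c) = 0.
  rewrite /dt frac_der_tofrac; last exact: mderiv_derivation.
  by rewrite mderivC tofrac0.
have da_iota r k c : da r k (iota c) = iota (dF r k c).
  rewrite /da frac_der_tofrac; last exact/coef_der_derivation/der_dF.
  by rewrite coef_derC //; apply: der_dF.
have da_t r k s : da r k (t s) = 0.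
  rewrite /da frac_der_tofrac; last exact/coef_der_derivation/der_dF.
  by rewrite coef_derX ?tofrac0 //; apply: der_dF.
have da_a r k (s : 'I_n) j : da r k (iota (gen_coef2 s j)) = ((r == s) && (k == j))%:R.
  rewrite da_iota -(rmorph_nat iota); congr (iota _).
  rewrite /dF frac_der_tofrac; last exact: mderiv_derivation.
  rewrite -(rmorph_nat (@FracField.tofrac _)); congr (FracField.tofrac _).
  rewrite /generic_coef valK mderivX mnm1E -mxvec_index_eq eq_sym.
  case: eqP => [->|_]; last by rewrite scale0r.
  by rewrite scale1r submm mpolyX0.
have da_dt r k s x : da r k (dt s x) = dt s (da r k x).
  have comm (p' : {mpoly F[n]}) : da r k (dt s (FracField.tofrac p')) =
      dt s (da r k (FracField.tofrac p')).
    have dc := coef_der_derivation n (der_dF r k).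
    have dm := mderiv_derivation F s.
    rewrite /da /dt (frac_der_tofrac dm) !(frac_der_tofrac dc) (frac_der_tofrac dm).
    by rewrite (coef_der_mderiv (der_dF r k)).
  exact: (frac_der_comm (der_da r k) (der_dt s) comm).
have gen : generic_rows gen_coef2 n := @generic_coef_rows 'F_2 n N.
have := (anisotropic_char2 sphD gen_field2_char gen (iota := iota) (t := t) (da := da)
  der_dt der_da dt_t dt_iota da_t da_a da_dt).
by apply.
Qed.

End GenericChar2.


(** * Homology spheres over the field with two elements *)

Lemma F2_cases (x : 'F_2) : x = 0 \/ x = 1.
Proof. by case: x => [[|[|k]] hk] //; [left|right]; apply: val_inj. Qed.

Lemma setD_setU (T : finType) (u s : {set T}) : u \subset s -> (s :\: u) :|: u = s.
Proof.
move=> us; apply/setP=> x; rewrite in_setU in_setD.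
by have [xu|xu] := boolP (x \in u); rewrite ?orbT ?orbF //= (subsetP us _ xu).
Qed.

Local Open Scope quotient_scope.

Section LinkChains.
Variables (N : nat) (D : simplicial_complex N).
Implicit Types (u s t r : {set 'I_N}).

Lemma incidence2 s t :
  incidence 'F_2 s t = ((t \subset s) && (#|s| == #|t|.+1))%:R.
Proof.
rewrite /incidence; have sgn k : (-1) ^+ k = 1 :> 'F_2.
  by rewrite (_ : -1 = 1) ?expr1n //; apply: val_inj.
under eq_bigr do rewrite sgn.
case: (boolP (_ && _)) => [/andP[ts /eqP st]|nts].
  have /eqP/cards1P[v sv] : #|s :\: t| = 1%N.
    by rewrite cardsD (setIidPr ts) st subSnn.
  have /andP[vt vs] : (v \notin t) && (v \in s).
    by have := set11 v; rewrite -sv inE.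
  have tE : s :\ v = t by rewrite -sv setDDr setDv set0U; apply/setIidPr.
  rewrite (bigD1 v) /=; last by rewrite vs tE eqxx.
  rewrite big1 ?addr0 // => w /andP[/andP[ws /eqP wt] wv].
  have : w \in t by rewrite -tE in_setD1 wv.
  by rewrite -wt !inE eqxx.
rewrite big1 // => v /andP[vs /eqP e]; case/negP: nts.
by rewrite -e subD1set (cardsD1 v s) vs add1n eqxx.
Qed.

Section Link.
Variable u : {set 'I_N}.
Local Notation L := (link (simplices D) u).

Lemma mem_link s : (s \in L) = [disjoint s & u] && (s :|: u \in simplices D).
Proof. by rewrite inE. Qed.

Lemma disjoint_setUD s : [disjoint s & u] = ((s :|: u) :\: u == s).
Proof.
rewrite setDUl setDv setU0; apply/idP/eqP => [/setDidPl//|<-].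
by rewrite disjoints_subset setDE subsetIr.
Qed.

(** Chains of the link, read on the simplices that contain [u]. *)
Definition extend k (e : chain 'F_2 L k) s : 'F_2 :=
  if insub (s :\: u) is Some w then e w else 0.

Definition restrict k (c : {set 'I_N} -> 'F_2) : chain 'F_2 L k :=
  [ffun s => c (val s :|: u)].

Lemma extend_restrict k c s : s \in simplices D -> u \subset s ->
  #|s| = (k + #|u|)%N -> extend (restrict k c) s = c s.
Proof.
move=> sD us sk; rewrite /extend.
have sus := setD_setU us.
have hs : (s :\: u \in L) && (#|s :\: u| == k).
  rewrite mem_link disjoint_setUD sus eqxx sD /=.
  by rewrite cardsD (setIidPr us) sk addnK.
by rewrite insubT ffunE /= sus.
Qed.

Lemma sum_extend k (e : chain 'F_2 L k.+1) r : r \in L -> #|r| = k ->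
  \sum_s e s * incidence 'F_2 (val s) r =
  \sum_(s in simplices D | (r :|: u \subset s) && (#|s| == (k + #|u|).+1)) extend e s.
Proof.
move=> rL rk; have [ru _] := andP (etrans (esym (mem_link r)) rL).
rewrite [RHS](reindex_onto (fun v => v :|: u) (fun s => s :\: u)) /=; last first.
  move=> s /and3P[_ rus _]; apply: setD_setU.
  by apply: subset_trans rus; apply: subsetUr.
rewrite [RHS](reindex_omap (val : simplex L k.+1 -> {set 'I_N}) insub) /=; last first.
  move=> v /andP[/and3P[vD rv vk]]; rewrite -disjoint_setUD => vu.
  rewrite insubT //= mem_link vu vD /=.
  by move: vk; rewrite cardsU disjoint_setI0 // cards0 subn0 -addSn eqn_add2r.
rewrite [LHS]big_mkcond [RHS]big_mkcond; apply: eq_bigr => w _ /=.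
have /andP[] := valP w; rewrite mem_link => /andP[wu wD] /eqP wk.
rewrite incidence2 wk rk eqxx andbT valK eqxx andbT wD -disjoint_setUD wu andbT.
rewrite cardsU disjoint_setI0 // cards0 subn0 wk addSn eqxx andbT /=.
have -> : (r :|: u \subset val w :|: u) = (r \subset val w).
  apply/idP/idP => [|rw]; last exact: setSU.
  by move/(setSD u); rewrite !setDUl !setDv !setU0 (setDidPl ru) (setDidPl wu).
rewrite /extend (eqP (etrans (esym (disjoint_setUD _)) wu)) valK.
by case: (r \subset _); rewrite ?mulr1 ?mulr0.
Qed.

Lemma cycleP k (c : {set 'I_N} -> 'F_2) :
  (forall r, r \in simplices D -> u \subset r -> #|r|.+1 = (k + #|u|)%N ->
     \sum_(s in simplices D | (r \subset s) && (#|s| == (k + #|u|)%N)) c s = 0) ->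
  restrict k c \in @is_cycle N 'F_2 L k.
Proof.
case: k => // k hc; apply/eqP/ffunP=> r; rewrite ffunE [RHS]ffunE.
have /andP[rL /eqP rk] := valP r.
rewrite sum_extend //; have [ru rD] := andP (etrans (esym (mem_link _)) rL).
rewrite -[RHS](hc (val r :|: u)) ?subsetUr //; last first.
  by rewrite cardsU disjoint_setI0 // cards0 subn0 rk.
apply: eq_bigr => s /and3P[sD rus /eqP sk]; apply: extend_restrict => //.
by apply: subset_trans rus; apply: subsetUr.
Qed.

Lemma link_exact k : (forall h : homology 'F_2 L k, h = 0) ->
  forall z : chain 'F_2 L k, z \in @is_cycle N 'F_2 L k ->
  exists e : chain 'F_2 L k.+1, boundary e = z.
Proof.
move=> h0 z zc; pose z' := Cycles zc.
have : z' - 0 \in @is_boundary N 'F_2 L k.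
  by rewrite Quotient.idealrBE; apply/eqP; rewrite raddf0; apply: h0.
by rewrite subr0 => /asboolP.
Qed.

(** In the top degree of the link there are no boundaries, so that a link with
    one-dimensional top homology has exactly one nonzero cycle. *)
Section Top.
Variables (n k : nat) (dimD : forall s, s \in simplices D -> (#|s| <= n)%N).
Hypotheses (uk : (k + #|u|)%N = n)
  (f : {linear homology 'F_2 L k -> ('F_2)^o}) (f_bij : bijective f).

Let pi0 (z : cycles 'F_2 L k) : \pi_(homology 'F_2 L k) z = 0 -> z = 0.
Proof.
move=> z0; have : z - 0 \in @is_boundary N 'F_2 L k.
  by rewrite Quotient.idealrBE; apply/eqP; rewrite raddf0.
rewrite subr0 => /asboolP[e ez]; apply: val_inj => /=; rewrite -ez.
apply/ffunP=> r; rewrite ffunE [RHS]ffunE big1 // => s _.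
have /andP[] := valP s; rewrite mem_link => /andP[su /dimD].
by rewrite cardsU disjoint_setI0 // cards0 subn0 => sn /eqP sk; move: sn; rewrite sk; lia.
Qed.

Lemma top_cycle_unique (z1 z2 : chain 'F_2 L k) :
  z1 \in @is_cycle N 'F_2 L k -> z2 \in @is_cycle N 'F_2 L k ->
  z1 != 0 -> z2 != 0 -> z1 = z2.
Proof.
move=> c1 c2 n1 n2; pose y1 := Cycles c1; pose y2 := Cycles c2.
have f1 (y : cycles 'F_2 L k) : val y != 0 -> f (\pi_(homology 'F_2 L k) y) = 1.
  move=> y0; have [fy|//] := F2_cases (f (\pi_(homology 'F_2 L k) y)).
  case/eqP: y0; rewrite (_ : y = 0) //; apply: pi0.
  by apply: (bij_inj f_bij); rewrite fy raddf0.
have : y1 - y2 = 0.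
  apply: pi0; rewrite raddfB; apply: (bij_inj f_bij).
  by rewrite raddfB /= !f1 // subrr raddf0.
by move/eqP; rewrite subr_eq0 => /eqP/(congr1 val).
Qed.

Lemma top_cycle_exists : exists2 z : chain 'F_2 L k,
  z \in @is_cycle N 'F_2 L k & z != 0.
Proof.
have [g fK gK] := f_bij; pose y := repr (g 1).
exists (val y); first exact: valP.
apply/eqP => y0; have yE : y = 0 by apply: val_inj.
have : f (g 1) = 0 by rewrite -[g 1]reprK -/y yE !raddf0.
by rewrite gK => /eqP; rewrite oner_eq0.
Qed.

End Top.
End Link.
End LinkChains.

(** Exactness of a complex of 'F_2-vector spaces is witnessed by a contraction,
    which makes sense with coefficients in any group of exponent 2. *)
Section CoefficientChange.
Variables (T : finType) (V : zmodType) (V2 : forall v : V, v + v = 0).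

Let act (v : V) (x : 'F_2) : V := v *+ x.

Let actDr v x y : act v (x + y) = act v x + act v y.
Proof.
rewrite /act; have [->|->] := F2_cases x; have [->|->] := F2_cases y;
  by rewrite ?addr0 ?add0r ?V2 // (_ : (1 + 1 : 'F_2) = 0) //; apply: val_inj.
Qed.

Let actM v x y : act v (x * y) = act (act v x) y.
Proof.
rewrite /act; have [->|->] := F2_cases x; have [->|->] := F2_cases y;
  by rewrite ?mulr0 ?mul0r ?mulr1 ?mulr0n ?mul0rn.
Qed.

Let act_sumr v (I : finType) (g : I -> 'F_2) :
  act v (\sum_i g i) = \sum_i act v (g i).
Proof. by elim/big_rec2: _ => [|i x y _ <-]; rewrite ?actDr. Qed.

Let act_suml (I : finType) (g : I -> V) x :
  act (\sum_i g i) x = \sum_i act (g i) x.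
Proof. by rewrite /act -sumrMnl. Qed.

Variables (X Y Z : pred T) (e : rel T).

Lemma exact_coefficients :
  (forall c : T -> 'F_2, (forall x, X x -> \sum_(y | Y y && e x y) c y = 0) ->
     exists d, forall y, Y y -> c y = \sum_(z | Z z && e y z) d z) ->
  forall c : T -> V, (forall x, X x -> \sum_(y | Y y && e x y) c y = 0) ->
     exists d, forall y, Y y -> c y = \sum_(z | Z z && e y z) d z.
Proof.
move=> ex2 c hc.
pose A : 'M['F_2]_#|T| := \matrix_(i, j)
  (let y := enum_val i in let x := enum_val j in [&& Y y, X x & e x y])%:R.
pose B : 'M['F_2]_#|T| := \matrix_(i, j)
  (let z := enum_val i in let y := enum_val j in [&& Z z, Y y & e y z])%:R.
pose P : 'M['F_2]_#|T| := diag_mx (\row_i (Y (enum_val i))%:R).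
have sumT (W : nmodType) (g : T -> W) : \sum_(i < #|T|) g (enum_val i) = \sum_y g y.
  by rewrite [RHS](reindex_onto (@enum_val T predT) enum_rank) => [|y _]; rewrite ?enum_rankK //;
    apply: eq_bigl => i; rewrite enum_valK eqxx.
have KB : (kermx A *m P <= B)%MS.
  apply/row_subP => i; rewrite row_mul; set k := row i (kermx A).
  have kA : k *m A = 0 by apply/sub_kermxP/row_sub.
  move: k kA => k kA.
  have [|d hd] := ex2 (fun y => k 0 (enum_rank y)).
    move=> x Xx; have /rowP/(_ (enum_rank x)) := kA; rewrite [LHS]mxE [RHS]mxE => kx.
    transitivity (\sum_j k 0 j * A j (enum_rank x)) => //.
    rewrite [LHS]big_mkcond -[LHS]sumT; apply: eq_bigr => j _.
    rewrite mxE /= enum_rankK Xx enum_valK /=.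
    by case: (Y _); case: (e _ _); rewrite /= ?mulr1 ?mulr0.
  apply/submxP; exists (\row_j d (enum_val j)); apply/rowP=> j.
  rewrite [in LHS]mul_mx_diag [LHS]mxE [RHS]mxE [in LHS]mxE.
  have [Yj|Yj] := boolP (Y (enum_val j)).
    have := hd _ Yj; rewrite enum_valK mulr1 => ->.
    rewrite [LHS]big_mkcond -[LHS]sumT; apply: eq_bigr => l _.
    by rewrite mxE [in RHS]mxE /= Yj; case: (Z _); case: (e _ _); rewrite /= ?mulr1 ?mulr0.
  by rewrite mulr0 big1 // => l _; rewrite [B _ _]mxE /= (negPf Yj) andbF mulr0.
have [G GB] : exists G, P = G *m B + A *m (pinvmx A *m P).
  have : ((1%:M - A *m pinvmx A) *m P <= B)%MS.
    apply: submx_trans KB; apply/submxMr/sub_kermxP.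
    by rewrite mulmxBl mul1mx mulmxKpV ?subrr.
  case/submxP => G eG; exists G; rewrite -eG mulmxBl mul1mx.
  by rewrite [A *m (pinvmx A *m P)]mulmxA subrK.
pose c' y := if Y y then c y else 0.
exists (fun z => \sum_y act (c' y) (G (enum_rank y) (enum_rank z))) => y Yy.
have cP : c y = \sum_y' act (c' y') (P (enum_rank y') (enum_rank y)).
  rewrite (bigD1 y) //= big1 ?addr0 => [|y' y'y].
    by rewrite mxE eqxx mxE enum_rankK Yy /c' Yy.
  by rewrite mxE (inj_eq enum_rank_inj) (negPf y'y).
have c'A j : \sum_y' act (c' y') (A (enum_rank y') j) = 0.
  have [Xj|Xj] := boolP (X (enum_val j)); last first.
    by rewrite big1 // => y' _; rewrite mxE /= (negPf Xj) andbF /act mulr0n.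
  transitivity (\sum_(y' | Y y' && e (enum_val j) y') c y'); last exact: hc.
  rewrite [RHS]big_mkcond; apply: eq_bigr => y' _.
  rewrite mxE /= enum_rankK Xj /c' /act.
  by case: (Y y'); case: (e _ _); rewrite /= ?mulr0n ?mulr1n ?mul0rn.
have swap (Q : 'M['F_2]_#|T|) (W : 'M['F_2]_#|T|) j :
    \sum_y' act (c' y') ((Q *m W) (enum_rank y') j) =
    \sum_l act (\sum_y' act (c' y') (Q (enum_rank y') l)) (W l j).
  under [RHS]eq_bigr do rewrite act_suml.
  rewrite exchange_big; apply: eq_bigr => y' _.
  by rewrite mxE act_sumr; apply: eq_bigr => l _; rewrite actM.
rewrite cP GB; under eq_bigr do rewrite mxE actDr.
rewrite big_split /= !swap [X in _ + X]big1 ?addr0 => [|l _]; last first.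
  by rewrite c'A /act mul0rn.
rewrite [RHS]big_mkcond -[RHS]sumT; apply: eq_bigr => l _.
rewrite enum_valK [B _ _]mxE /= enum_rankK Yy /act.
by case: (Z _); case: (e _ _); rewrite /= ?mulr0n ?mulr1n.
Qed.

End CoefficientChange.

Section SphereLinks.
Variables (N n : nat) (D : simplicial_complex N).
Hypothesis sphere : homology_sphere 'F_2 n D.
Implicit Types (u s t r : {set 'I_N}).

Lemma facet_above t : t \in simplices D ->
  exists s, [/\ s \in simplices D, t \subset s & #|s| = n].
Proof.
move=> tD; have [s smax ts] := @maxset_exists _ (fun s => s \in simplices D) _ tD.
exists s; split=> //; last by case: sphere => /(_ s smax).
by case/maxsetP: smax.
Qed.

Lemma simplex_dim t : t \in simplices D -> (#|t| <= n)%N.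
Proof. by case/facet_above => s [_ /subset_leq_card ts <-]. Qed.

Lemma star_exact u k : u \in simplices D -> k.+1 != n ->
  let star j s := [&& s \in simplices D, u \subset s & #|s| == j] in
  forall c : {set 'I_N} -> 'F_2,
  (forall r, star k r -> \sum_(t | star k.+1 t && (r \subset t)) c t = 0) ->
  exists d, forall t, star k.+1 t ->
    c t = \sum_(s | star k.+2 s && (t \subset s)) d s.
Proof.
move=> uD kn star c hc; have [ku|uk] := ltnP k.+1 #|u|.
  exists (fun=> 0) => t /and3P[_ /subset_leq_card ut /eqP tk].
  by move: ku; rewrite -tk ltnNge ut.
pose j := (k.+1 - #|u|)%N; have jk : (j + #|u|)%N = k.+1 by rewrite subnK.
have h0 : forall h : homology 'F_2 (link (simplices D) u) j, h = 0.
  by case: sphere => _ /(_ u uD j); rewrite jk (negPf kn).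
have zc : restrict D u j c \in @is_cycle N 'F_2 (link (simplices D) u) j.
  apply: cycleP => r rD ur rk; rewrite jk in rk *.
  rewrite -[RHS](hc r); last by rewrite /star rD ur -eqSS rk eqxx.
  apply: eq_bigl => s; rewrite /star; case rs: (r \subset s); last by rewrite !andbF.
  by rewrite (subset_trans ur rs) andbT.
have [e ez] := link_exact h0 zc.
exists (extend (u := u) e) => t /and3P[tD ut /eqP tk].
have tk' : #|t| = (j + #|u|)%N by rewrite jk.
rewrite -[LHS](extend_restrict c tD ut tk') -ez.
have tL : t :\: u \in link (simplices D) u.
  by rewrite mem_link disjoint_setUD setD_setU // eqxx tD.
have tj : #|t :\: u| = j by rewrite cardsD (setIidPr ut) tk' addnK.
have tLj : (t :\: u \in link (simplices D) u) && (#|t :\: u| == j) by rewrite tL tj eqxx.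
rewrite {1}/extend insubT ffunE /= sum_extend //.
rewrite setD_setU // jk; apply: eq_bigl => s; rewrite /star.
case ts: (t \subset s); last by rewrite !andbF.
by rewrite (subset_trans ut ts) andbT.
Qed.

Definition star_facets u : {set {set 'I_N}} :=
  [set s in simplices D | (u \subset s) && (#|s| == n)].

(** The sets of facets containing [u] that are cycles modulo 2. *)
Definition ridge_even u (A : {set {set 'I_N}}) : Prop :=
  forall r, r \in simplices D -> u \subset r -> #|r|.+1 = n ->
  ~~ odd #|[set s in star_facets u :&: A | r \subset s]|.

Section TopChains.
Variables (u : {set 'I_N}) (k : nat).
Hypotheses (uD : u \in simplices D) (uk : (k + #|u|)%N = n).
Local Notation L := (link (simplices D) u).

Local Notation facets := (star_facets u).
Local Notation closed := (ridge_even u).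

Let chain_of (A : {set {set 'I_N}}) : chain 'F_2 L k :=
  restrict D u k (fun s => (s \in A)%:R).

Let chain_cycle A : closed A -> chain_of A \in @is_cycle N 'F_2 L k.
Proof.
move=> cA; apply: cycleP => r rD ur; rewrite uk => rn.
rewrite (eq_bigr (fun s => if s \in A then 1 else 0)) => [|s _]; last by case: (s \in A).
rewrite -big_mkcondr /= sumr_const.
have -> : #|fun s => (s \in simplices D) && ((r \subset s) && (#|s| == n)) && (s \in A)|
    = #|[set s in facets :&: A | r \subset s]|.
  apply: eq_card => s; rewrite !inE -!topredE /=.
  case rs: (r \subset s); last by rewrite /= !andbF.
  by rewrite (subset_trans ur rs) andbT.
have := cA r rD ur rn; move: #|_| => q oq.
rewrite -[q]odd_double_half (negPf oq) add0n -mul2n mulrnA.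
by rewrite (_ : 1 *+ 2 = 0 :> 'F_2) ?mul0rn //; apply: val_inj.
Qed.

Let chain_val A s : s \in facets -> extend (chain_of A) s = (s \in A)%:R.
Proof.
rewrite inE => /and3P[sD us /eqP sn]; apply: extend_restrict => //.
by rewrite uk.
Qed.

Let chain_neq0 (A : {set {set 'I_N}}) s : s \in facets -> s \in A -> chain_of A != 0.
Proof.
move=> sf sA; apply/eqP => A0; have := chain_val A sf.
rewrite A0 sA /extend; case: insubP => [w _ _|_]; rewrite ?ffunE.
  by move/esym/eqP; rewrite oner_eq0.
by move/esym/eqP; rewrite oner_eq0.
Qed.

(** Both sets define nonzero top cycles of the link, and there is only one. *)
Lemma closed_facets (A B : {set {set 'I_N}}) :
  (exists2 s, s \in facets & s \in A) -> closed A ->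
  (exists2 s, s \in facets & s \in B) -> closed B ->
  {in facets, A =i B}.
Proof.
move=> [s sf sA] cA [s' sf' sB] cB x xf.
have [f f_bij] : exists f : {linear homology 'F_2 L k -> ('F_2)^o}, bijective f.
  by case: sphere => _ /(_ u uD k); rewrite uk eqxx.
have := top_cycle_unique simplex_dim uk f_bij (chain_cycle cA) (chain_cycle cB)
  (chain_neq0 sf sA) (chain_neq0 sf' sB).
move/(congr1 (fun z => extend z x)); rewrite !chain_val //.
by case: (x \in A); case: (x \in B) => // /eqP; rewrite ?oner_eq0 // eq_sym oner_eq0.
Qed.

Lemma nonzero_cycle : exists2 z : chain 'F_2 L k,
  z \in @is_cycle N 'F_2 L k & exists2 s, s \in facets & extend z s != 0.
Proof.
have [f f_bij] : exists f : {linear homology 'F_2 L k -> ('F_2)^o}, bijective f.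
  by case: sphere => _ /(_ u uD k); rewrite uk eqxx.
have [z zc z0] := top_cycle_exists f_bij; exists z => //.
have [w zw] : exists w, z w != 0.
  apply/existsP; rewrite -negb_forall; apply: contra z0 => /forallP h.
  by apply/eqP/ffunP=> w; rewrite [RHS]ffunE; apply/eqP.
have /andP[] := valP w; rewrite mem_link => /andP[wu wD] /eqP wk.
exists (val w :|: u).
  by rewrite inE wD subsetUr cardsU disjoint_setI0 // cards0 subn0 wk uk eqxx.
by rewrite /extend (eqP (etrans (esym (disjoint_setUD _ _)) wu)) valK.
Qed.

End TopChains.

(** The coefficients of the nonzero top cycle of the link sum to zero, so there
    are two facets at least; among three facets, two pairs would be different
    cycles. *)
Lemma ridge_facets u : u \in simplices D -> #|u|.+1 = n ->
  #|star_facets u| = 2%N.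
Proof.
move=> uD un; have uk : (1 + #|u|)%N = n by rewrite add1n.
pose R := star_facets u; rewrite -/R.
have [z zc [s0 s0R zs0]] := nonzero_cycle uD uk.
have zsum : \sum_(s in R) extend z s = 0.
  have r0 : (set0 \in link (simplices D) u) && (#|@set0 (ordinal N)| == 0%N).
    by rewrite mem_link set0U uD cards0 disjoint_sym -setI_eq0 setI0 !eqxx.
  move/eqP/ffunP/(_ (Sub set0 r0)): zc; rewrite ffunE [RHS]ffunE /=.
  rewrite sum_extend ?cards0 //; last by case/andP: r0.
  rewrite set0U add0n un => e; rewrite -[RHS]e; apply: eq_bigl => s.
  by rewrite inE.
apply/eqP; rewrite eqn_leq; apply/andP; split; last first.
  rewrite ltnNge; apply/negP => R1.
  have Rs : R = [set s0].
    by apply/esym/eqP; rewrite eqEcard sub1set s0R cards1.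
  by move: zsum zs0; rewrite Rs big_set1 => ->; rewrite eqxx.
rewrite leqNgt; apply/negP => R3.
have [B BR B3] := exists_subset_card R3.
have : (2 < #|B|)%N by rewrite B3.
case/card_gt2P => [a [b [c [[aB bB cB] [ab bc ca]]]]].
have [aR bR cR] : [/\ a \in R, b \in R & c \in R] by split; apply: (subsetP BR).
have closed2 x y : x \in R -> y \in R -> x != y ->
  ridge_even u [set x; y].
  move=> xR yR xy r rD ur rn.
  have -> : r = u.
    by apply/eqP; rewrite eq_sym eqEcard ur /= -ltnS rn un.
  have -> : [set s in R :&: [set x; y] | u \subset s] = [set x; y].
    apply/setP=> s; rewrite !inE; apply/andP/idP => [[/andP[_ //]]|sxy].
    have : s \in R by case/orP: sxy => /eqP ->.
    by rewrite inE => /and3P[-> -> ->].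
  by rewrite cards2 xy.
have := closed_facets uD uk (A := [set a; b]) (B := [set a; c]) _ (closed2 a b aR bR ab)
  _ (closed2 a c aR cR _) cR.
rewrite !inE eqxx orbT [c == b]eq_sym (negPf bc) (negPf ca) /=.
move=> h; suff : false = true by []; apply: h.
- by exists a; rewrite ?set21.
- by exists a; rewrite ?set21.
- by rewrite eq_sym.
Qed.

(** For connectedness, a set of facets that is closed under adjacency around [u]
    contains both or none of the facets through each ridge, so it is a cycle
    just as the set of all facets around [u]. *)
Lemma homology_sphere_mod2 : mod2_sphere n (simplices D).
Proof.
split.
- exact: face_simplex.
- exact: empty_simplex.
- exact: simplex_dim.
- exact: facet_above.
- exact: ridge_facets.
- move=> u X [s sX [sD us sn]] hX x xD ux xn.
  have uD : u \in simplices D by apply: face_simplex us sD.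
  have uk : ((n - #|u|) + #|u|)%N = n by rewrite subnK // simplex_dim.
  pose R := star_facets u.
  have sR : s \in R by rewrite inE sD us sn eqxx.
  have xR : x \in R by rewrite inE xD ux xn eqxx.
  suff /(_ x xR) : {in R, X =i [set: {set 'I_N}]} by rewrite inE.
  have two r : r \in simplices D -> u \subset r -> #|r|.+1 = n ->
      exists t1 t2, [/\ t1 != t2, t1 \in R, t2 \in R, t1 :&: t2 = r &
        [set s in R | r \subset s] = [set t1; t2]].
    move=> rD ur rn; have := ridge_facets rD rn.
    have -> : star_facets r = [set s in R | r \subset s].
      apply/setP=> y; rewrite !inE; case ry: (r \subset y); last by rewrite !andbF.
      by rewrite (subset_trans ur ry) andbT.
    move/eqP/cards2P => [t1 [t2 [t12 e]]]; exists t1, t2.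
    have := set21 t1 t2; have := set22 t1 t2; rewrite -e !inE.
    move=> /andP[/and3P[t2D ut2 /eqP t2n] rt2] /andP[/and3P[t1D ut1 /eqP t1n] rt1].
    split=> //.
    - by rewrite t1D ut1 t1n eqxx.
    - by rewrite t2D ut2 t2n eqxx.
    apply/esym/eqP; rewrite eqEcard subsetI rt1 rt2 /= -ltnS rn -t1n.
    rewrite proper_card // properE subsetIl subsetI subxx /=.
    by apply: contra t12 => t1t2; rewrite eqEcard t1t2 t1n t2n leqnn.
  refine (closed_facets uD uk _ _ _ _).
  + by exists s.
  + move=> r rD ur rn; have [t1 [t2 [t12 t1R t2R tr e]]] := two r rD ur rn.
    have -> : [set s in R :&: X | r \subset s] = [set t1; t2] :&: X.
      by rewrite -e; apply/setP=> y; rewrite !inE andbAC.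
    have tX y y' : y \in R -> y' \in R -> y :&: y' = r -> y \in X -> y' \in X.
      rewrite !inE => /and3P[_ _ /eqP yn] /and3P[y'D _ /eqP y'n] yr yX.
      by apply: hX yX y'D yn y'n _ _; rewrite yr.
    have [t1X|t1X] := boolP (t1 \in X).
      have t2X := tX _ _ t1R t2R tr t1X.
      by rewrite (setIidPl _) ?cards2 ?t12 // subUset !sub1set t1X.
    have t2X : t2 \notin X by apply: contra t1X; apply: tX; rewrite // setIC.
    suff -> : [set t1; t2] :&: X = set0 by rewrite cards0.
    apply/setP=> y; rewrite !inE; case: eqP => [->|_] /=; first exact: negPf.
    by case: eqP => [->|_] //=; apply: negPf.
  + by exists s => //; apply: in_setT.
  + move=> r rD ur rn; have [t1 [t2 [t12 _ _ _ e]]] := two r rD ur rn.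
    by rewrite setIT e cards2 t12.
- move=> V V2 u k uD kn c hc.
  have kn' : k.+1 != n by rewrite neq_ltn kn.
  have := exact_coefficients V2 (star_exact uD kn').
  case/(_ c) => [r /and3P[rD ur /eqP rk]|d hd].
    rewrite -[RHS](hc r rD ur rk); apply: eq_bigl => t.
    case rt: (r \subset t); last by rewrite /= !andbF.
    by rewrite (subset_trans ur rt) andbT.
  exists d => t tD ut tk; rewrite hd ?tD ?ut ?tk ?eqxx //; apply: eq_bigl => s.
  case ts: (t \subset s); last by rewrite /= !andbF.
  by rewrite (subset_trans ut ts) andbT.
Qed.

End SphereLinks.


(** * Clearing denominators *)

Section Fractions.
Variables (B : comNzRingType) (K : fieldType) (phi : {rmorphism B -> K}).

Definition fraction_map := forall x : K,
  exists b c, phi c != 0 /\ phi c * x = phi b.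

Hypothesis phi_frac : fraction_map.

Lemma clear_denominators N (p : {mpoly K[N]}) :
  exists c q, phi c != 0 /\ map_mpoly phi q = phi c *: p.
Proof.
elim/mpolyind: p => [|x m p _ _ [c [q [c0 cq]]]].
  by exists 1, 0; rewrite rmorph1 oner_eq0 raddf0 scaler0.
have [b [c' [c'0 cb]]] := phi_frac x.
exists (c * c'), (c' *: q + (c * b) *: 'X_[m]); split.
  by rewrite rmorphM mulf_neq0.
rewrite raddfD /= !map_mpolyZ map_mpolyX cq scalerDr !scalerA.
rewrite addrC !rmorphM -cb /=; congr (_ *: _ + _ *: _); first exact: mulrA.
exact: mulrC.
Qed.

Lemma clear_denominators_seq N (f : nat -> {mpoly K[N]}) r :
  exists c (q : nat -> {mpoly B[N]}), phi c != 0 /\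
    forall s, (s < r)%N -> map_mpoly phi (q s) = phi c *: f s.
Proof.
elim: r => [|r [c [q [c0 cq]]]]; first by exists 1, (fun=> 0); rewrite rmorph1 oner_eq0.
have [c' [q' [c'0 cq']]] := clear_denominators (f r).
exists (c * c'), (fun s => if s == r then c *: q' else c' *: q s); split.
  by rewrite rmorphM mulf_neq0.
move=> s; rewrite ltnS leq_eqVlt; have [-> _|sr /= sr'] := eqVneq s r.
  by rewrite map_mpolyZ cq' scalerA rmorphM.
by rewrite map_mpolyZ cq // scalerA rmorphM mulrC.
Qed.

Lemma fraction_map_mpoly k :
  forall x : {fraction {mpoly K[k]}}, exists b c : {mpoly B[k]},
    FracField.tofrac (map_mpoly phi c) != 0 /\
    FracField.tofrac (map_mpoly phi c) * x = FracField.tofrac (map_mpoly phi b).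
Proof.
move=> x; have [p [q [q0 ->]]] := fractionP x.
have [c [p' [c0 cp]]] := clear_denominators p.
have [d [q' [d0 dq]]] := clear_denominators q.
have qF : FracField.tofrac q != 0 by rewrite tofrac_eq0.
exists (d *: p'), (c *: q'); rewrite !map_mpolyZ cp dq tofrac_eq0.
rewrite !scalerA [phi d * _]mulrC; have := mulf_neq0 c0 d0.
move: (phi c * phi d) => e e0; rewrite -!mul_mpolyC.
split; first by rewrite mulf_eq0 mpolyC_eq0 (negPf e0).
by rewrite 2!rmorphM /= -mulrA; congr (_ * _); rewrite mulrCA divff // mulr1.
Qed.

Lemma map_lform N (v : 'I_N -> B) :
  map_mpoly phi (lform v) = lform (fun j => phi (v j)).
Proof.
rewrite /lform raddf_sum /=; apply: eq_bigr => j _.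
by rewrite map_mpolyZ map_mpolyX.
Qed.

Variables (N : nat) (D : {set {set 'I_N}}) (a : nat -> 'I_N -> B).
Local Notation aK := (fun s j => phi (a s j)).

Lemma mod_ideal_map r p : mod_ideal a D r p -> mod_ideal aK D r (map_mpoly phi p).
Proof.
move=> [q hq]; exists (fun s => map_mpoly phi (q s)) => m mD.
transitivity (map_mpoly phi (p - \sum_(s < r) q s * lform (a s)))@_m.
  congr (mcoeff m _); rewrite (raddfB (map_mpoly phi)) /=.
  rewrite (raddf_sum (map_mpoly phi)) /=; congr (_ - _); apply: eq_bigr => s _.
  by rewrite rmorphM /= map_lform.
by rewrite mcoeff_map_mpoly (hq m mD) raddf0.
Qed.

Lemma mod_ideal_lift r p : mod_ideal aK D r (map_mpoly phi p) ->
  exists c y, [/\ phi c != 0, mod_ideal a D r y &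
    face_ideal D (map_mpoly phi (c *: p - y))].
Proof.
move=> [q hq]; have [c [q' [c0 cq]]] := clear_denominators_seq q r.
exists c, (\sum_(s < r) q' s * lform (a s)); split=> //.
  by apply: mod_ideal_sum => s _; apply: mod_ideal_theta.
move=> m mD; rewrite (raddfB (map_mpoly phi)) /= map_mpolyZ (raddf_sum (map_mpoly phi)) /=.
under eq_bigr => s _ do rewrite rmorphM /= map_lform cq // -scalerAl.
by rewrite -scaler_sumr -scalerBr mcoeffZ hq // mulr0.
Qed.

End Fractions.

(** * Descent from characteristic 0 to characteristic 2 *)

Section SeparatingFunctional.
Variables (K : fieldType) (k : nat) (W : 'rV[K]_k -> Prop).
Hypotheses (W0 : W 0) (WD : forall c u v, W u -> W v -> W (c *: u + v)).

(** [W] is the row space of any of its matrices whose rank is largest. *)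
Lemma separating_functional g : ~ W g ->
  exists2 l : 'cV[K]_k, (forall v, W v -> v *m l = 0) & g *m l != 0.
Proof.
move=> Wg; pose P r := `[< exists2 M : 'M[K]_k, (forall v : 'rV_k, (v <= M)%MS -> W v) & \rank M = r >].
have P0 : exists r, P r.
  exists 0%N; apply/asboolP; exists 0; last by rewrite mxrank0.
  by move=> v; rewrite submx0 => /eqP ->.
have Pk r : P r -> (r <= k)%N.
  by move/asboolP => [M _ <-]; apply: rank_leq_row.
case: (ex_maxnP P0 Pk) => r /asboolP[M WM rM] rmax.
have MW v : W v -> (v <= M)%MS.
  move=> Wv; apply: contraT => vM.
  suff : (\rank (M + v)%MS <= r)%N.
    rewrite -rM leqNgt => /negP[]; apply: rank_ltmx; rewrite ltmxE addsmxSl.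
    by apply: contra vM; apply: submx_trans; apply: addsmxSr.
  apply: rmax; apply/asboolP; exists (M + v)%MS => // u /sub_addsmxP[[x y] /= ->].
  rewrite addrC [y]mx11_scalar mul_scalar_mx; apply: WD => //.
  by apply: WM; apply: submxMl.
have : g *m cokermx M != 0.
  by apply/negP => gM; apply/Wg/WM; rewrite submxE.
case/rV0Pn => j gj; exists (cokermx M *m delta_mx j 0) => [v /MW|].
  by rewrite submxE mulmxA => /eqP ->; rewrite mul0mx.
rewrite mulmxA -colE; apply: contra gj => /eqP/matrixP/(_ 0 0).
by rewrite [LHS]mxE [RHS]mxE => ->.
Qed.

End SeparatingFunctional.

(** The ring [B] lies in [K] by [rho] and is reduced modulo the prime 2 by
    [red]. Statements over the localization of [B] at this prime are expressed over
    [B] itself, up to a multiple whose reduction is not zero. *)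
Section Descent.
Variables (n N : nat) (D : {set {set 'I_N}}) (dD : down_closed D).
Variables (B : idomainType) (K F : fieldType).
Variables (rho : {rmorphism B -> K}) (red : {rmorphism B -> F}).
Hypotheses (rho_inj : injective rho) (rho_frac : fraction_map rho).
Hypothesis red_frac : fraction_map red.
Hypothesis red_even : forall b, red b = 0 -> exists b', b = b' *+ 2.
Hypothesis red_odd_part : forall b, b != 0 ->
  exists e b', b = b' *+ 2 ^ e /\ red b' != 0.
Hypotheses (two_neq0 : 2%:R != 0 :> B) (red2 : 2%:R = 0 :> F).
Variable a : nat -> 'I_N -> B.
Local Notation aK := (fun s j => rho (a s j)).
Local Notation aF := (fun s j => red (a s j)).
Hypothesis regular : forall r p, (r < n)%N ->
  mod_ideal aF D r (p * lform (aF r)) -> mod_ideal aF D r p.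

Lemma face_ideal_half x : face_ideal D (map_mpoly red x) ->
  exists w, face_ideal D (x - w *+ 2).
Proof.
move=> hx; suff [w ew] : exists w, mfilter (fun m => supp m \in D) x = w *+ 2.
  by exists w => m mD; rewrite -ew mcoeffB mcoeff_mfilter mD subrr.
rewrite /mfilter; elim/big_ind: _ => [|p q [w ->] [v ->]|m mD].
- by exists 0; rewrite mul0rn.
- by exists (w + v); rewrite mulrnDl.
- have := hx m mD; rewrite mcoeff_map_mpoly => /red_even[b ->].
  by exists (b *: 'X_[m]); rewrite scalerMnl.
Qed.

Lemma mod_ideal_reduction r y : mod_ideal aF D r (map_mpoly red y) ->
  exists c w, red c != 0 /\ mod_ideal a D r (c *: y - w *+ 2).
Proof.
case/(mod_ideal_lift red_frac) => c [z [c0 hz /face_ideal_half[w hw]]].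
exists c, w; split=> //; rewrite -[_ - _](subrK z).
by apply: mod_idealD hz; rewrite addrAC; apply: mod_idealF.
Qed.

(** Since the linear forms are regular modulo 2, the number 2 is regular modulo
    the linear forms. *)
Lemma mod_ideal_torsion r h : (r <= n)%N -> mod_ideal a D r (h *+ 2) ->
  exists2 c, red c != 0 & mod_ideal a D r (c *: h).
Proof.
elim: r h => [|r IH] h.
  move=> _ [q]; rewrite big_ord0 subr0 => hh; exists 1; first by rewrite rmorph1 oner_eq0.
  apply: mod_idealF => m /hh /eqP; rewrite scale1r mcoeffMn -mulr_natr mulf_eq0.
  by rewrite (negPf two_neq0) orbF => /eqP.
move=> rn /mod_idealSr[y hy].
have : mod_ideal aF D r (map_mpoly red y).
  apply: regular => //; have := mod_ideal_map red hy.
  rewrite (raddfB (map_mpoly red)) /= rmorphM /= map_lform raddfMn /=.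
  rewrite -mulr_natr -mpolyC_nat red2 mpolyC0 mulr0 sub0r => /mod_idealN.
  by rewrite opprK.
case/mod_ideal_reduction => c [w [c0 hw]].
have [||c' c'0 hc'] := IH (c *: h - w * lform (a r)); first exact: ltnW.
  have -> : (c *: h - w * lform (a r)) *+ 2 =
      c *: (h *+ 2 - y * lform (a r)) + lform (a r) * (c *: y - w *+ 2).
    rewrite scalerBr mulrBr -!scalerAr -[lform (a r) * y]mulrC addrA subrK.
    by rewrite mulrnBl scalerMnr mulrnAr [lform (a r) * w]mulrC.
  by apply: mod_idealD; [apply: mod_idealZ | apply: mod_idealMl].
exists (c' * c); first by rewrite rmorphM mulf_neq0.
apply/mod_idealSr; exists (c' *: w); move: hc'.
by rewrite scalerBr scalerA -scalerAl.
Qed.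

Lemma mod_ideal_torsion_pow e h : mod_ideal a D n (h *+ 2 ^ e) ->
  exists2 c, red c != 0 & mod_ideal a D n (c *: h).
Proof.
elim: e h => [|e IH] h.
  by rewrite expn0 => hh; exists 1; rewrite ?scale1r // rmorph1 oner_eq0.
rewrite expnSr mulrnA => /(mod_ideal_torsion (leqnn n))[c c0].
rewrite -scalerMnr => /IH[c' c'0]; rewrite scalerA => hh.
by exists (c' * c) => //; rewrite rmorphM mulf_neq0.
Qed.

Lemma mod_ideal_generic r y : mod_ideal aK D r (map_mpoly rho y) ->
  exists2 c, c != 0 & mod_ideal a D r (c *: y).
Proof.
case/(mod_ideal_lift rho_frac) => c [z [c0 hz hw]].
exists c; first by apply: contra c0 => /eqP ->; rewrite raddf0.
rewrite -[_ *: _](subrK z); apply: mod_idealD hz; apply: mod_idealF => m /hw.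
rewrite mcoeff_map_mpoly => /eqP; rewrite -(raddf0 rho) (inj_eq rho_inj).
by move/eqP.
Qed.

Variables (m p : nat).
Hypothesis anisotropic : forall g : {mpoly F[N]}, g \is m.-homog ->
  mod_ideal aF D n ((\sum_i 'X_i) ^+ p * g ^+ 2) -> mod_ideal aF D n g.
Local Notation form g := ((\sum_i 'X_i) ^+ p * g ^+ 2).

Let map_form (L : fieldType) (phi : {rmorphism B -> L}) (g : {mpoly B[N]}) :
  map_mpoly phi (form g) = form (map_mpoly phi g).
Proof.
rewrite rmorphM !rmorphXn /= raddf_sum /=; congr (_ ^+ _ * _).
by apply: eq_bigr => i _; rewrite map_mpolyX.
Qed.

Let map_homog (L : fieldType) (phi : {rmorphism B -> L}) (g : {mpoly B[N]}) :
  g \is m.-homog -> map_mpoly phi g \is m.-homog.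
Proof.
move/dhomogP => hg; apply/dhomogP => m'; rewrite mcoeff_msupp mcoeff_map_mpoly.
move=> c0; apply: hg; rewrite mcoeff_msupp; apply: contra c0 => /eqP ->.
by rewrite raddf0.
Qed.

(** An isotropic class vanishes modulo 2, because there the form is anisotropic;
    so it is twice a class, and that class is isotropic as well. *)
Lemma isotropic_divisible g : g \is m.-homog ->
  mod_ideal aK D n (form (map_mpoly rho g)) ->
  exists c w, [/\ red c != 0, w \is m.-homog, mod_ideal a D n (c *: g - w *+ 2) &
    mod_ideal aK D n (form (map_mpoly rho w))].
Proof.
move=> gm hg; have := hg; rewrite -map_form => /mod_ideal_generic[c c0].
have [e [c' [-> c'0]]] := red_odd_part c0.
rewrite -scalerMnl => /mod_ideal_torsion_pow[c'' c''0]; rewrite scalerA.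
move/(mod_ideal_map red); rewrite map_mpolyZ map_form => hF.
have {}hF : mod_ideal aF D n (form (map_mpoly red g)).
  have := mod_idealZ (red (c'' * c'))^-1 dD hF.
  by rewrite scalerA mulVf ?scale1r // rmorphM mulf_neq0.
have [d [w [d0 hw]]] := mod_ideal_reduction (anisotropic (map_homog red gm) hF).
pose v := pihomog (@mdeg N) m w.
have hv : mod_ideal a D n (d *: g - v *+ 2).
  have := mod_ideal_pihomog m hw.
  by rewrite pihomogB linearZ raddfMn /= (pihomog_dE gm).
exists d, v; split; [exact: d0 | exact: pihomogP | exact: hv | ].
have {}hv := mod_ideal_map rho hv.
have two : 2%:R != 0 :> K.
  by rewrite -(rmorph_nat rho) -(raddf0 rho) (inj_eq rho_inj).
move: hv; rewrite (raddfB (map_mpoly rho)) /= map_mpolyZ raddfMn /=.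
move: (map_mpoly rho g) (map_mpoly rho v) hg => x y.
set P := (\sum_i 'X_i) ^+ p => hx hxy.
have e4 : 2%:R ^+ 2 *: (P * y ^+ 2) = rho d ^+ 2 *: (P * x ^+ 2) -
    P * (rho d *: x + y *+ 2) * (rho d *: x - y *+ 2).
  by rewrite -!mul_mpolyC !rmorphXn /= mpolyC_nat; ring.
rewrite -[P * _]scale1r -(mulVf (expf_neq0 2 two)) -scalerA e4.
apply: mod_idealZ => //; apply: mod_idealB; first exact: mod_idealZ.
exact: mod_idealMl.
Qed.

Lemma isotropic_divisible_pow g e : g \is m.-homog ->
  mod_ideal aK D n (form (map_mpoly rho g)) ->
  exists c w, [/\ red c != 0, w \is m.-homog &
    mod_ideal a D n (c *: g - w *+ 2 ^ e)].
Proof.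
elim: e g => [|e IH] g gm hg.
  exists 1, g; split=> //; first by rewrite rmorph1 oner_eq0.
  by rewrite scale1r expn0 mulr1n subrr; apply: mod_ideal0.
have [c [w [c0 wm hw /(IH _ wm)[c' [w' [c'0 w'm hw']]]]]] := isotropic_divisible gm hg.
exists (c' * c), w'; split=> //; first by rewrite rmorphM mulf_neq0.
have -> : (c' * c) *: g - w' *+ 2 ^ e.+1 =
    c' *: (c *: g - w *+ 2) + (c' *: w - w' *+ 2 ^ e) *+ 2.
  by rewrite mulrnBl scalerBr scalerA -scalerMnr addrA subrK expnSr mulrnA.
apply: mod_idealD; first exact: mod_idealZ.
by rewrite mulr2n; apply: mod_idealD.
Qed.

(** A linear functional that separates the class of [g] from zero can be scaled
    to take its values in [B]. Its value at [g] would be divisible by every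
    power of 2, up to factors with nonzero reduction. *)
Lemma descent_homog (g : {mpoly B[N]}) : g \is m.-homog ->
  mod_ideal aK D n (form (map_mpoly rho g)) -> mod_ideal aK D n (map_mpoly rho g).
Proof.
move=> gm hg; apply: contrapT => gJ.
pose T : finType := 'X_{1..N < m.+1}.
pose poly (v : 'rV[K]_#|T|) : {mpoly K[N]} := \sum_i v 0 i *: 'X_[(enum_val i : T)].
pose vec (x : {mpoly K[N]}) : 'rV[K]_#|T| := \row_i x@_(enum_val i : T).
have vecK x : x \is m.-homog -> poly (vec x) = x.
  move=> /dhomogP xm; rewrite [RHS](@mpolywE _ _ m.+1); last first.
    by rewrite msizeE; apply/bigmax_leqP_seq => m' hm _; have /= -> := xm _ hm.
  rewrite [RHS](reindex (enum_val : 'I_#|T| -> T)) /=; last exact/onW_bij/enum_val_bij.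
  by apply: eq_bigr => i _; rewrite mxE.
have polyD c u v : poly (c *: u + v) = c *: poly u + poly v.
  rewrite scaler_sumr -big_split; apply: eq_bigr => i _ /=.
  by rewrite !mxE scalerDl scalerA.
have [|||l lW lg] := @separating_functional _ _ (fun v => mod_ideal aK D n (poly v))
    _ _ (vec (map_mpoly rho g)).
- rewrite [poly 0]big1 => [|i _]; first exact: mod_ideal0.
  by rewrite mxE scale0r.
- by move=> c u v hu hv; rewrite polyD; apply: mod_idealD hv; apply: mod_idealZ.
- by rewrite vecK //; apply: map_homog.
have [c [q [c0 hq]]] := clear_denominators rho_frac (lform (fun i => l i 0)).
pose lam (x : {mpoly B[N]}) := \sum_i x@_(enum_val i : T) * q@_U_(i).
have lamE x : rho (lam x) = rho c * (vec (map_mpoly rho x) *m l) 0 0.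
  rewrite mxE mulr_sumr rmorph_sum; apply: eq_bigr => i _.
  rewrite /vec mxE mcoeff_map_mpoly rmorphM /=.
  have -> : rho q@_U_(i) = rho c * l i 0.
    by rewrite -mcoeff_map_mpoly hq mcoeffZ mcoeff_lformU.
  by rewrite mulrCA.
have lg0 : lam g != 0.
  rewrite -(inj_eq rho_inj) raddf0 lamE mulf_neq0 //; apply: contra lg => /eqP e.
  by apply/eqP/matrixP => i j; rewrite !ord1 e mxE.
have [f [b [eb b0]]] := red_odd_part lg0.
have [c' [w [c'0 wm hw]]] := isotropic_divisible_pow f.+1 gm hg.
have lam0 : lam (c' *: g - w *+ 2 ^ f.+1) = 0.
  apply: rho_inj; rewrite lamE raddf0 lW ?mxE ?mulr0 // vecK.
    exact: mod_ideal_map hw.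
  by apply: map_homog; rewrite rpredB ?rpredZ ?rpredMn.
have lamB : lam (c' *: g - w *+ 2 ^ f.+1) = c' * lam g - lam w *+ 2 ^ f.+1.
  rewrite mulr_sumr -sumrMnl -sumrB; apply: eq_bigr => i _.
  by rewrite mcoeffB mcoeffZ mcoeffMn mulrBl mulrA mulrnAl.
move/eqP: lam0; rewrite lamB eb expnS mulrnA mulrnAr -mulrnBl -mulr_natr mulf_eq0.
rewrite natrX [_ ^+ f == 0](negPf (expf_neq0 _ two_neq0)) orbF subr_eq0.
move/eqP/(congr1 red); rewrite rmorphM raddfMn /= -mulr_natr red2 mulr0 => /eqP.
by rewrite mulf_eq0 (negPf c'0) (negPf b0).
Qed.

Theorem descent (g : {mpoly K[N]}) : g \is m.-homog ->
  mod_ideal aK D n (form g) -> mod_ideal aK D n g.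
Proof.
move=> gm hg; have [c [q [c0 hq]]] := clear_denominators rho_frac g.
have e : map_mpoly rho (pihomog (@mdeg N) m q) = rho c *: g.
  rewrite -[in RHS](pihomog_dE gm) -linearZ -hq; apply/mpolyP => m'.
  rewrite mcoeff_map_mpoly !mcoeff_pihomog mcoeff_map_mpoly.
  by case: ifP => //; rewrite raddf0.
have := @descent_homog (pihomog (@mdeg N) m q) (pihomogP _ _ _).
rewrite e exprZn -scalerAr => /(_ (mod_idealZ _ dD hg)) /(mod_idealZ (rho c)^-1 dD).
by rewrite scalerA mulVf // scale1r.
Qed.

End Descent.


(** * The generic cohomology ring *)

Section Reductions.
Variables (n N : nat).
Local Notation B := {mpoly int[n * N]}.

Definition to_rational : {rmorphism B -> K0 n N} :=
  @FracField.tofrac {mpoly rat[n * N]} \o map_mpoly intr.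
Definition to_mod2 : {rmorphism B -> gen_field2 n N} :=
  @FracField.tofrac {mpoly 'F_2[n * N]} \o map_mpoly intr.

Lemma to_rational_inj : injective to_rational.
Proof.
apply: raddf_inj => b /eqP; rewrite /= tofrac_eq0 => /eqP/mpolyP b0.
apply/mpolyP => m; have := b0 m; rewrite mcoeff_map_mpoly !mcoeff0 => /eqP.
by rewrite intr_eq0 => /eqP.
Qed.

Lemma to_rational_frac : fraction_map to_rational.
Proof.
apply: (@fraction_map_mpoly _ _ intr) => x; exists (numq x), (denq x).
by rewrite /= intr_eq0 denq_neq0 mulrC numqE.
Qed.

Lemma to_mod2_frac : fraction_map to_mod2.
Proof.
apply: (@fraction_map_mpoly _ _ intr) => x; exists (val x)%:Z, 1.
by rewrite rmorph1 oner_eq0 mul1r /= -pmulrn natr_Zp.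
Qed.

Lemma to_mod2_coef b m : to_mod2 b = 0 -> (2 %| b@_m)%Z.
Proof.
move/eqP; rewrite /= tofrac_eq0 => /eqP/mpolyP/(_ m).
by rewrite mcoeff_map_mpoly mcoeff0 (dvdz_pcharf (pchar_Fp (isT : prime 2))) => ->.
Qed.

Lemma to_mod2_even b : to_mod2 b = 0 -> exists b', b = b' *+ 2.
Proof.
move=> b0; exists (\sum_(m <- msupp b) (b@_m %/ 2)%Z *: 'X_[m]).
rewrite {1}(mpolyE b) -sumrMnl; apply: eq_bigr => m _.
by rewrite scalerMnl -mulr_natr divzK // to_mod2_coef.
Qed.

(** The absolute value of a nonzero coefficient decreases at every division
    by 2. *)
Lemma to_mod2_odd_part b : b != 0 ->
  exists e b', b = b' *+ 2 ^ e /\ to_mod2 b' != 0.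
Proof.
move=> b0; have [m bm] : exists m, b@_m != 0.
  apply: contrapT => h; case/eqP: b0; apply/mpolyP => m; rewrite mcoeff0.
  by apply: contrapT => /eqP bm; apply: h; exists m.
have [k] := ubnP `|b@_m|%N; elim: k b bm {b0} => // k IH b bm bk.
have [/to_mod2_even[c e]|/eqP b1] := pselect (to_mod2 b = 0); last first.
  by exists 0%N, b; split; [rewrite expn0 mulr1n | exact: b1].
move: bm bk; rewrite {}e mcoeffMn => bm bk.
have [||f [b' [-> b'0]]] := IH c.
- by apply: contraNneq bm => ->; rewrite mul0rn.
- by move: bm bk; clear; lia.
by exists f.+1, b'; rewrite expnSr mulrnA.
Qed.

End Reductions.

Section Glue.
Variables (n N : nat) (D : simplicial_complex N).
Definition gen_coef0 (s : nat) (j : 'I_N) : K0 n N :=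
  to_rational n N (generic_coef int n s j).
Local Notation a := gen_coef0.

Lemma gen_coef0E (i : 'I_n) j : a i j = a_ i j.
Proof. by rewrite /gen_coef0 /= /generic_coef valK map_mpolyX. Qed.

Lemma theta_lform (i : 'I_n) : theta N i = lform (a i).
Proof. by apply: eq_bigr => j _; rewrite gen_coef0E. Qed.

Lemma SR_idealE p : p \in @SR_ideal n N D <-> face_ideal (simplices D) p.
Proof.
have prodX (S : {set 'I_N}) : \prod_(i in S) 'X_i = 'X_[mset S] :> {mpoly K0 n N[N]}.
  rewrite mpolyXE_id big_mkcond; apply: eq_bigr => i _.
  by rewrite msetE; case: (i \in S).
split=> [/asboolP[c ->] m mD|hp].
  rewrite raddf_sum big1 // => S SD; rewrite prodX.
  apply: (face_idealMl (c S) _ _ mD); first exact: face_simplex.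
  by apply: face_idealX; rewrite supp_mset.
rewrite (mpolyE p) big_seq; apply: rpred_sum => m; rewrite mcoeff_msupp => pm.
have mD : supp m \notin simplices D by apply: contra pm => /hp ->.
apply/asboolP; exists (fun S => if S == supp m then p@_m *: 'X_[m - mset S] else 0).
rewrite (bigD1 (supp m)) //= eqxx prodX [X in _ + X]big1 => [|S /andP[_ Sm]].
  rewrite addr0 -scalerAl -mpolyXD submK //; apply/mnm_lepP => i.
  by rewrite msetE mem_supp; case: (m i).
by rewrite (negPf Sm) mul0r.
Qed.

Lemma cohomology_class_eq0 (p : {mpoly K0 n N[N]}) :
  cohomology_class D p = 0 <-> mod_ideal a (simplices D) n p.
Proof.
have class0 (q : {mpoly K0 n N[N]}) : SR_class D q = 0 <-> face_ideal (simplices D) q.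
  have e : (q \in @SR_ideal n N D) = (SR_class D q == 0).
    by rewrite -[X in X \in _]subr0 Quotient.idealrBE rmorph0.
  split=> [q0|/SR_idealE]; first by apply/SR_idealE; rewrite e q0.
  by rewrite e => /eqP.
transitivity (SR_class D p \in @theta_ideal n N D).
  by rewrite -[X in X \in _]subr0 Quotient.idealrBE rmorph0; split=> /eqP.
have sumE (q : nat -> {mpoly K0 n N[N]}) :
    \sum_(s < n) q s * lform (a s) = \sum_(s < n) q s * theta N s.
  by apply: eq_bigr => s _; rewrite theta_lform.
have classE (x : {mpoly K0 n N[N]}) (q : nat -> {mpoly K0 n N[N]}) :
    SR_class D (x - \sum_(s < n) q s * theta N s) =
    SR_class D x - \sum_(s < n) SR_class D (q s) * SR_class D (theta N s).
  rewrite /SR_class rmorphB rmorph_sum; congr (_ - _).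
  by apply: eq_bigr => s _; rewrite rmorphM.
split=> [/asboolP[c e]|[q]].
  pose q s := if insub s is Some i then repr (c i) else 0.
  exists q; rewrite (sumE q); apply/class0; rewrite classE e -sumrB big1 // => i _.
  by rewrite /q valK [SR_class D (repr _)]reprK subrr.
rewrite (sumE q) => /class0; rewrite classE => /eqP; rewrite subr_eq0 => /eqP ->.
by apply/asboolP; exists (fun i : 'I_n => SR_class D (q i)).
Qed.

End Glue.

Theorem theorem1p3 (n N : nat) (D : simplicial_complex N)
    (D_sphere : homology_sphere 'F_2 n D) (m : nat) (le_mn : (m.*2 <= n)%N) :
  forall g : cohomology n D,
    in_degree m g -> ell n D ^+ (n - m.*2) * g ^+ 2 = 0 -> g = 0.
Proof.
move=> g [p pm ->] h; apply/cohomology_class_eq0.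
have sphD := homology_sphere_mod2 D_sphere.
have {h} hp : mod_ideal (@gen_coef0 n N) (simplices D) n
    ((\sum_i 'X_i) ^+ (n - m.*2) * p ^+ 2).
  apply/cohomology_class_eq0; rewrite -[RHS]h.
  rewrite /cohomology_class /SR_class !rmorphM !rmorphXn /=.
  by congr (_ ^+ _ * _); rewrite !rmorph_sum.
have red2 : 2%:R = 0 :> gen_field2 n N by apply/eqP; case/andP: (gen_field2_char n N).
have two0 : 2%:R != 0 :> {mpoly int[n * N]}.
  by rewrite -(rmorph_nat (@mpolyC _ _)) mpolyC_eq0.
have regular r q : (r < n)%N ->
    mod_ideal (@gen_coef2 n N) (simplices D) r (q * lform (@gen_coef2 n N r)) ->
    mod_ideal (@gen_coef2 n N) (simplices D) r q.
  move=> rn; apply: (face_ring_regular sphD) rn; last exact: generic_coef_rows.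
  exact: gen_field2_char.
have anisotropic (q : {mpoly gen_field2 n N[N]}) : q \is m.-homog ->
    mod_ideal (@gen_coef2 n N) (simplices D) n ((\sum_i 'X_i) ^+ (n - m.*2) * q ^+ 2) ->
    mod_ideal (@gen_coef2 n N) (simplices D) n q.
  by apply: generic_anisotropic_char2 => //; rewrite subnKC.
have coef2E : @gen_coef2 n N = (fun s j => to_mod2 n N (generic_coef int n s j)).
  apply/funext => s; apply/funext => j; rewrite /gen_coef2 /= /generic_coef.
  by case: insub => [i|]; rewrite ?map_mpolyX ?raddf0.
rewrite coef2E in regular anisotropic.
exact: (descent (sphere_down sphD) (@to_rational_inj n N) (@to_rational_frac n N)
  (@to_mod2_frac n N) (@to_mod2_even n N) (@to_mod2_odd_part n N) two0 red2
  regular anisotropic pm hp).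
Qed.
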